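(* Let $(\mu_n)_{n\in\mathbb N}$ be a sequence of Fourier transformable measures on $\mathbb R^d$, and let $\mu$ be a measure on $\mathbb R^d$ such that (i) for every $f\in\mathcal S(\mathbb R^d)$, $\mu_n(e^{-2\pi i t\cdot}f)\to\mu(e^{-2\pi i t\cdot}f)$ as $n\to\infty$, uniformly in $t\in\mathbb R^d$; (ii) $\{\mu_n: n\in\mathbb N\}$ is vaguely bounded; (iii) $\mu$ is tempered; (iv) $\{\widehat{\mu_n}:n\in\mathbb N\}$ is a set of equi translation bounded measures. Then $\mu$ is Fourier transformable and $\lim_{n\to\infty}\widehat{\mu_n}=\widehat\mu$ in the product topology.
   Context: Measures on $\mathbb R^d$ are complex Radon measures; $|\mu|$ is the total variation. Conventions: $\check f(y)=\int f(x)e^{2\pi ixy}dx$, $\widetilde f(x)=\overline{f(-x)}$; $e^{-2\pi i t\cdot}f$ denotes $x\mapsto e^{-2\pi i tx}f(x)$. A measure $\mu$ is Fourier transformable if there is a measure $\widehat\mu$ with $\check f\in L^2(\widehat\mu)$ and $\mu(f*\widetilde f)=\widehat\mu(|\check f|^2)$ for all $f\in C_c(\mathbb R^d)$; such measures are tempered (define tempered distributions), and $\mu(f)$ for $f\in\mathcal S(\mathbb R^d)$ denotes the action as a tempered distribution. A set of measures is vaguely bounded if $\{\nu(f)\}$ is bounded for every $f\in C_c(\mathbb R^d)$. Equi translation bounded: $\sup_n\sup_t|\widehat{\mu_n}|(t+K)<\infty$ for every compact $K$. Convergence $\nu_n\to\nu$ in the product topology means $\|(\nu_n-\nu)*g\|_\infty\to0$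 for all $g\in C_c(\mathbb R^d)$. *)

(* Defs.v *)
From HB Require Import structures.
From mathcomp Require Import all_boot all_order all_algebra.
From mathcomp Require Import complex.
From mathcomp Require Import all_classical all_reals all_analysis.
Set Implicit Arguments.
Unset Strict Implicit.
Unset Printing Implicit Defensive.
Import Order.TTheory GRing.Theory Num.Theory.
Import numFieldNormedType.Exports.
Local Open Scope ring_scope.
Local Open Scope classical_set_scope.

Section FourierMeasures.
Context {R : realType} {d : nat}.

Local Notation V := 'rV[R]_d.
Local Notation C := R[i].

Definition cnorm (z : C) : R := Num.sqrt (complex.Re z ^+ 2 + complex.Im z ^+ 2).

Definition dotv (x y : V) : R := \sum_(i < d) x 0 i * y 0 i.

Definition expi (theta : R) : C := (cos theta +i* sin theta)%C.

Definition ccont (f : V -> C) : Prop :=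
  continuous (fun x => complex.Re (f x)) /\ continuous (fun x => complex.Im (f x)).

Definition cpt_supp {T : Type} (z : T) (f : V -> T) : Prop :=
  exists K : set V, compact K /\ forall x, ~ K x -> f x = z.

Definition Cc (f : V -> C) : Prop := ccont f /\ cpt_supp 0 f.
Definition CcR (h : V -> R) : Prop := continuous h /\ cpt_supp 0 h.

Definition ebase (i : 'I_d) : V := \row_j (j == i)%:R.

Definition pder (s : seq 'I_d) (g : V -> R) : V -> R :=
  foldr (fun i h => fun x => 'D_(ebase i) h x) g s.

Definition smoothR (g : V -> R) : Prop :=
  forall (s : seq 'I_d) (i : 'I_d) (x : V), derivable (pder s g) x (ebase i).

Definition smooth (f : V -> C) : Prop :=
  smoothR (fun x => complex.Re (f x)) /\ smoothR (fun x => complex.Im (f x)).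

Definition cpder_norm (s : seq 'I_d) (f : V -> C) (x : V) : R :=
  cnorm (pder s (fun y => complex.Re (f y)) x +i* pder s (fun y => complex.Im (f y)) x)%C.

Definition Schwartz (f : V -> C) : Prop :=
  smooth f /\ forall (s : seq 'I_d) (k : nat), exists M : R,
    forall x : V, (1 + `|x|) ^+ k * cpder_norm s f x <= M.

Definition Ccinf (f : V -> C) : Prop := Cc f /\ smooth f.

Definition snorm (s : seq 'I_d) (k : nat) (f : V -> C) : \bar R :=
  ereal_sup [set ((1 + `|x|) ^+ k * cpder_norm s f x)%:E | x in [set: V]].

(* A complex Radon measure is a linear functional on C_c(R^d) which is
   bounded by a_K ||f||_oo on functions supported in each compact K. *)
Definition radon (mu : (V -> C) -> C) : Prop :=
  (forall (a : C) (f g : V -> C), Cc f -> Cc g ->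
      mu (fun x => a * f x + g x) = a * mu f + mu g) /\
  (forall K : set V, compact K -> exists aK : R,
      forall (f : V -> C) (M : R), Cc f -> (forall x, ~ K x -> f x = 0) ->
        (forall x, cnorm (f x) <= M) -> cnorm (mu f) <= aK * M).

Definition tv (mu : (V -> C) -> C) (h : V -> R) : \bar R :=
  ereal_sup [set (cnorm (mu g))%:E |
               g in [set g | Cc g /\ forall x, cnorm (g x) <= h x]].

Definition tvK (mu : (V -> C) -> C) (K : set V) : \bar R :=
  ereal_inf [set tv mu h |
    h in [set h | CcR h /\ (forall x, 0 <= h x) /\ (forall x, K x -> 1 <= h x)]].

(* mint_is mu g c : c is the integral of the (continuous, |mu|-integrable)
   function g against mu, i.e. the limit of mu(h g) as the cut-off h -> 1 *)
Definition mint_is (mu : (V -> C) -> C) (g : V -> C) (c : C) : Prop :=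
  forall eps : R, 0 < eps -> exists K : set V, compact K /\
    forall h : V -> R, CcR h -> (forall x, 0 <= h x <= 1) ->
      (forall x, K x -> h x = 1) ->
      cnorm (mu (fun x => (h x)%:C%C * g x) - c) <= eps.

Definition cint1 (f : R -> C) : C :=
  (Rintegral (@lebesgue_measure R) setT (fun t => complex.Re (f t)) +i*
   Rintegral (@lebesgue_measure R) setT (fun t => complex.Im (f t)))%C.

Definition upd (x : V) (k : nat) (t : R) : V :=
  \row_j (if (j : nat) == k then t else x 0 j).

Fixpoint iint (k : nat) (f : V -> C) (x : V) : C :=
  match k with
  | 0 => f x
  | k'.+1 => cint1 (fun t => iint k' f (upd x k' t))
  end.

(* integral over R^d (iterated, valid for C_c functions) *)
Definition lint (f : V -> C) : C := iint d f 0.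

Definition icheck (f : V -> C) (y : V) : C :=
  lint (fun x => f x * expi (2 * pi * dotv x y)).

Definition ctilde (f : V -> C) (x : V) : C := Num.conj (f (- x)).

Definition conv (f g : V -> C) (x : V) : C := lint (fun y => f y * g (x - y)).

Definition modul (t : V) (f : V -> C) (x : V) : C :=
  expi (- (2 * pi * dotv t x)) * f x.

Definition FT (mu muhat : (V -> C) -> C) : Prop :=
  radon muhat /\
  forall f : V -> C, Cc f ->
    (tv muhat (fun y => (cnorm (icheck f y) ^+ 2)%R) < +oo)%E /\
    mint_is muhat (fun y => ((cnorm (icheck f y) ^+ 2)%:C)%C)
                  (mu (conv f (ctilde f))).

Definition Fourier_transformable (mu : (V -> C) -> C) : Prop :=
  exists muhat, FT mu muhat.

(* T is the (continuous) extension to S(R^d) of the functional mu restricted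
   to C_c^infty(R^d), i.e. T is "mu acting as a tempered distribution". *)
Definition tempered_ext (mu : (V -> C) -> C) (T : (V -> C) -> C) : Prop :=
  (forall (a : C) (f g : V -> C), Schwartz f -> Schwartz g ->
      T (fun x => a * f x + g x) = a * T f + T g) /\
  (exists (F : seq (seq 'I_d * nat)) (M : R), 0 <= M /\
     forall f, Schwartz f ->
       ((cnorm (T f))%:E <= M%:E * \sum_(p <- F) snorm p.1 p.2 f)%E) /\
  (forall f, Ccinf f -> T f = mu f).

Definition tempered (mu : (V -> C) -> C) : Prop := exists T, tempered_ext mu T.

Definition vaguely_bounded (mu_ : nat -> (V -> C) -> C) : Prop :=
  forall f : V -> C, Cc f -> exists M : R, forall n, cnorm (mu_ n f) <= M.

Definition equi_translation_bounded (nu_ : nat -> (V -> C) -> C) : Prop :=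
  forall K : set V, compact K -> exists M : R,
    forall (n : nat) (t : V), (tvK (nu_ n) [set (t + k)%R | k in K] <= M%:E)%E.

(* nu_n -> nu in the product topology: ||(nu_n - nu) * g||_oo -> 0 *)
Definition prod_conv (nu_ : nat -> (V -> C) -> C) (nu : (V -> C) -> C) : Prop :=
  forall g : V -> C, Cc g -> forall eps : R, 0 < eps -> exists N : nat,
    forall n : nat, (N <= n)%N -> forall x : V,
      cnorm (nu_ n (fun y => g (x - y)) - nu (fun y => g (x - y))) <= eps.

End FourierMeasures.

(* Main.v *)
Require Import Defs.
From HB Require Import structures.
From mathcomp Require Import all_boot all_order all_algebra.
From mathcomp Require Import complex.
From mathcomp Require Import all_classical all_reals all_analysis.
From mathcomp Require Import measurable_realfun ring lra.
Import Order.TTheory GRing.Theory Num.Theory.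
Import numFieldNormedType.Exports.
Local Open Scope ring_scope.
Local Open Scope classical_set_scope.

(** A translation bounded functional is bounded for the amalgam norm (suprema
    over unit cells, summed over the cells).  This norm is finite for [f^] when
    [f] is Schwartz (second differences) and for [|f^|^2] when [f] is in C_c
    (large sieve inequality).  Hence, with the bound (iv),
    [mu_n] acts on a Schwartz [f] as the integral of [f^] against [muhat_n], and
    (i) says that [muhat_n (f^(. - t))] converges uniformly in [t].  Transforms
    of smooth compactly supported functions are dense in C_c for the amalgam norm
    (Fejer interpolation times the transform of a bump), so [muhat_n (g(. - t))]
    converges uniformly in [t] for every [g] in C_c; the limit is [muhat].  In
    the limit, [muhat(chi^) = mu chi] for smooth bumps [chi], then
    [muhat(h^ chi^) = mu(h * chi)] by Riemann sums of translates of [chi], and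
    [muhat(h^) = mu h] by letting [chi] shrink, applied to [h = f * f~]. *)

(** Measures are functionals on [Cc] functions, whereas a transform is in general not compactly
    supported; its integral is therefore a limit along cut-offs ([mint_is]). The amalgam norm
    controls these limits: the cut-off radius depends on the integrand and on the common bound, not
    on the measure, so the limit in [n] and the cut-off limit commute. A single weight [wt], the
    product of the factors [1 / (1 + x_i^2)], serves throughout: it is integrable, has bounded sums
    over cells, and its second differences are bounded by multiples of itself, so that its own
    transform decays like it. Hypothesis (i) is stated for every choice of continuous extensions, so
    the proof may choose them; taking integrals of transforms turns the modulation in (i) into a
    translation of the measure. No Fourier inversion enters: the approximants of a given function of
    the dual variable are transforms by construction. Two smoothing steps are needed at the end
    because [f * f~] is only continuous, while convergence is known on smooth functions only. *)

Section ComplexNorm.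
Context {R : realType}.
Implicit Types (z a b : R[i]) (r : R).

Lemma cnormE z : (cnorm z)%:C%C = `|z|.
Proof. by rewrite normc_def /cnorm. Qed.

Lemma cnorm_ge0 z : 0 <= cnorm z.
Proof. exact: sqrtr_ge0. Qed.

Lemma cnormM a b : cnorm (a * b) = cnorm a * cnorm b.
Proof. by apply: complexI; rewrite rmorphM/= !cnormE normrM. Qed.

Lemma cnormD a b : cnorm (a + b) <= cnorm a + cnorm b.
Proof. by rewrite -lecR rmorphD/= !cnormE ler_normD. Qed.

Lemma cnormN a : cnorm (- a) = cnorm a.
Proof. by apply: complexI; rewrite !cnormE normrN. Qed.

Lemma cnorm0 : cnorm (0 : R[i]) = 0.
Proof. by apply: complexI; rewrite cnormE normr0. Qed.

Lemma cnorm1 : cnorm (1 : R[i]) = 1.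
Proof. by apply: complexI; rewrite cnormE normr1. Qed.

Lemma cdistC a b : cnorm (a - b) = cnorm (b - a).
Proof. by rewrite -cnormN opprB. Qed.

Lemma cdist_triangle b a c : cnorm (a - c) <= cnorm (a - b) + cnorm (b - c).
Proof. by rewrite (le_trans _ (cnormD _ _))// addrA subrK. Qed.

Lemma cnorm_eq0 a : cnorm a = 0 -> a = 0.
Proof. by move=> a0; apply/normr0_eq0; rewrite -cnormE a0. Qed.

Lemma cnorm_real r : cnorm r%:C%C = `|r|.
Proof. by rewrite /cnorm /= expr0n addr0 sqrtr_sqr. Qed.

Lemma cnorm_realM r a : 0 <= r -> cnorm (r%:C%C * a) = r * cnorm a.
Proof. by move=> r0; rewrite cnormM cnorm_real ger0_norm. Qed.

Lemma cnorm_conj a : cnorm (Num.conj a) = cnorm a.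
Proof. by apply: complexI; rewrite !cnormE norm_conjC. Qed.

Lemma normr_Re_cnorm a : `|complex.Re a| <= cnorm a.
Proof. by rewrite -lecR cnormE normc_ge_Re. Qed.

Lemma normr_Im_cnorm a : `|complex.Im a| <= cnorm a.
Proof. by rewrite -sqrtr_sqr /cnorm ler_wsqrtr// lerDr sqr_ge0. Qed.

Lemma cnorm_ReIm a : cnorm a <= `|complex.Re a| + `|complex.Im a|.
Proof.
rewrite -[leRHS]ger0_norm ?addr_ge0// -sqrtr_sqr ler_wsqrtr// sqrrD !real_normK ?num_real//.
by rewrite addrAC lerDl mulrn_wge0// mulr_ge0.
Qed.

Lemma cnorm_sum (I : finType) (F : I -> R[i]) :
  cnorm (\sum_i F i) <= \sum_i cnorm (F i).
Proof.
elim/big_ind2: _ => [|a b a' b' aa bb|//]; first by rewrite cnorm0.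
by rewrite (le_trans (cnormD _ _))// lerD.
Qed.

Lemma cnorm_sqrE a : ((cnorm a) ^+ 2)%:C%C = a * Num.conj a.
Proof. by rewrite rmorphXn/= cnormE normCK. Qed.

Lemma ReD a b : complex.Re (a + b) = complex.Re a + complex.Re b.
Proof. by case: a; case: b. Qed.
Lemma ImD a b : complex.Im (a + b) = complex.Im a + complex.Im b.
Proof. by case: a; case: b. Qed.
Lemma ReN a : complex.Re (- a) = - complex.Re a.
Proof. by case: a. Qed.
Lemma ImN a : complex.Im (- a) = - complex.Im a.
Proof. by case: a. Qed.
Lemma ReM a b :
  complex.Re (a * b) = complex.Re a * complex.Re b - complex.Im a * complex.Im b.
Proof. by case: a; case: b. Qed.
Lemma ImM a b :
  complex.Im (a * b) = complex.Re a * complex.Im b + complex.Im a * complex.Re b.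
Proof. by case: a; case: b. Qed.

Lemma complex_ext a b :
  complex.Re a = complex.Re b -> complex.Im a = complex.Im b -> a = b.
Proof. by case: a; case: b => /= ? ? ? ? -> ->. Qed.

Lemma expi0 : expi (0 : R) = 1.
Proof. by rewrite /expi cos0 sin0. Qed.

Lemma expiD r s : expi (r + s) = expi r * expi s.
Proof.
by apply: complex_ext; rewrite /expi ?ReM ?ImM/= ?cosD ?sinD//; ring.
Qed.

Lemma expiN r : expi (- r) = Num.conj (expi r).
Proof. by rewrite /expi cosN sinN. Qed.

Lemma cnorm_expi r : cnorm (expi r) = 1.
Proof. by rewrite /cnorm /= cos2Dsin2 sqrtr1. Qed.

Lemma expiMn r n : expi (r *+ n) = expi r ^+ n.
Proof. by elim: n => [|n IH]; rewrite ?expi0 // mulrS expiD IH exprS. Qed.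

Lemma MVT_bound (f df : R -> R) (M x y : R) :
  (forall t, is_derive t (1:R) f (df t)) -> (forall t, `|df t| <= M) ->
  `|f x - f y| <= M * `|x - y|.
Proof.
move=> fdf dfM.
wlog xy : x y / y < x => [H|].
  have [xy|xy|->] := ltgtP x y; [|exact: H|by rewrite !subrr normr0 mulr0].
  by rewrite distrC [in leRHS]distrC H.
have [] := @MVT _ f df y x xy.
  apply: continuous_subspaceT => t.
  by apply/differentiable_continuous/derivable1_diffP; have [] := fdf t.
by move=> c _ ->; rewrite normrM ler_wpM2r.
Qed.

(** The constant 2 comes from bounding the real and the imaginary part separately; the sharp value 1
    would bring nothing. *)
Lemma expi_lipschitz r s : cnorm (expi r - expi s) <= 2 * `|r - s|.
Proof.
rewrite (le_trans (cnorm_ReIm _))// ?ReD ?ImD ?ReN ?ImN/= mulr2n mulrDl mul1r lerD//.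
  rewrite -[leRHS]mul1r; apply: (@MVT_bound _ (fun t => - sin t)) => t.
  rewrite normrN ler_norml sin_le1 sin_geN1//.
rewrite -[leRHS]mul1r; apply: (@MVT_bound _ cos) => t.
by rewrite ler_norml cos_le1 cos_geN1.
Qed.

End ComplexNorm.

(** * Continuous and compactly supported functions on R^d *)

Section VectorSpace.
Context {R : realType} {d : nat}.
Local Notation V := 'rV[R]_d.
Local Notation C := R[i].
Implicit Types (f g : V -> C).

Lemma normr_coord (x : V) i : `|x 0 i| <= `|x|.
Proof.
by rewrite [leRHS]/Num.norm /= mx_normrE; apply/bigmax_geP; right; exists (0, i).
Qed.

Lemma normr_rV_le (x : V) (r : R) : 0 <= r -> (forall i, `|x 0 i| <= r) -> `|x| <= r.
Proof.
move=> r0 H; rewrite /Num.norm/= mx_normrE; apply/bigmax_leP; split => // -[i j] _ /=.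
by rewrite ord1.
Qed.

Lemma normr_rV_gt (x : V) (r : R) : 0 <= r -> r < `|x| -> exists i, r < `|x 0 i|.
Proof.
move=> r0; apply: contraPP => /forallNP H; apply/negP; rewrite -leNgt.
by apply: normr_rV_le => // i; rewrite leNgt; apply/negP/H.
Qed.

Lemma continuous_edP {T : normedModType R} (f : T -> R) :
  continuous f <-> forall (x : T) (e : R), 0 < e -> exists2 D : R, 0 < D &
    forall y, `|x - y| < D -> `|f x - f y| < e.
Proof.
split=> [cf x e e0|H x].
  have /cvgrPdist_lt/(_ _ e0)/nbhs_ballP[D D0 DP] := cf x.
  by exists D => // y xy; apply: DP; rewrite -ball_normE.
apply/cvgrPdist_lt => e e0; have [D D0 DP] := H x e e0.
by apply/nbhs_ballP; exists D => // y; rewrite -ball_normE; exact: DP.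
Qed.

Lemma ccont_edP f :
  ccont f <-> forall (x : V) (e : R), 0 < e -> exists2 D : R, 0 < D &
    forall y, `|x - y| < D -> cnorm (f x - f y) < e.
Proof.
split=> [[/continuous_edP cR /continuous_edP cI] x e e0|H].
  have e20 : 0 < e / 2 by rewrite divr_gt0.
  have [D D0 DP] := cR x _ e20; have [E E0 EP] := cI x _ e20.
  exists (Num.min D E) => [|y]; first by rewrite lt_min D0.
  rewrite lt_min => /andP[/DP yD /EP yE].
  rewrite (le_lt_trans (cnorm_ReIm _))// ReD ImD ReN ImN [ltRHS](splitr e).
  exact: ltrD.
split; apply/continuous_edP => x e e0; have [D D0 DP] := H x e e0; exists D => // y /DP;
  apply: le_lt_trans.
  by rewrite -ReN -ReD normr_Re_cnorm.
by rewrite -ImN -ImD normr_Im_cnorm.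
Qed.

Lemma cnorm_dist (a b : C) : `|cnorm a - cnorm b| <= cnorm (a - b).
Proof.
rewrite ler_distl; apply/andP; split.
  by rewrite lerBlDr cdistC (le_trans _ (cnormD _ _))// addrC subrK.
by rewrite (le_trans _ (cnormD _ _))// addrC subrK.
Qed.

Lemma ccont_cnorm f : ccont f -> continuous (fun x => cnorm (f x)).
Proof.
move=> /ccont_edP cf; apply/continuous_edP => x e /(cf x)[D D0 DP].
by exists D => // y /DP; apply: le_lt_trans; exact: cnorm_dist.
Qed.

Lemma ccont_real (h : V -> R) : continuous h -> ccont (fun x => (h x)%:C%C).
Proof. by move=> ch; split=> //= x; exact: cst_continuous. Qed.

Lemma ccont_cst (c : C) : ccont (fun _ : V => c).
Proof. by split => x; exact: cst_continuous. Qed.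

Lemma continuousDR {T : topologicalType} (f g : T -> R) :
  continuous f -> continuous g -> continuous (fun x => f x + g x).
Proof. by move=> cf cg x; apply: (@cvgD R R^o T _ _ f g _ _ (cf x) (cg x)). Qed.

Lemma continuousBR {T : topologicalType} (f g : T -> R) :
  continuous f -> continuous g -> continuous (fun x => f x - g x).
Proof. by move=> cf cg x; apply: (@cvgB R R^o T _ _ f g _ _ (cf x) (cg x)). Qed.

Lemma continuousMR {T : topologicalType} (f g : T -> R) :
  continuous f -> continuous g -> continuous (fun x => f x * g x).
Proof. by move=> cf cg x; apply: (@cvgM R T _ _ f g _ _ (cf x) (cg x)). Qed.

Lemma continuous_compR {S T U : topologicalType} (f : S -> T) (g : T -> U) :
  continuous f -> continuous g -> continuous (fun x => g (f x)).
Proof. by move=> cf cg x; apply: continuous_comp; [exact: cf|exact: cg]. Qed.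

Lemma ccontD f g : ccont f -> ccont g -> ccont (fun x => f x + g x).
Proof.
move=> [fR fI] [gR gI]; split.
  by rewrite (eq_fun (fun x => ReD (f x) (g x))); exact: continuousDR.
by rewrite (eq_fun (fun x => ImD (f x) (g x))); exact: continuousDR.
Qed.

Lemma ccontM f g : ccont f -> ccont g -> ccont (fun x => f x * g x).
Proof.
move=> [fR fI] [gR gI]; split.
  by rewrite (eq_fun (fun x => ReM (f x) (g x))); apply: continuousBR; exact: continuousMR.
by rewrite (eq_fun (fun x => ImM (f x) (g x))); apply: continuousDR; exact: continuousMR.
Qed.

Lemma ccontZ (c : C) f : ccont f -> ccont (fun x => c * f x).
Proof. exact/ccontM/ccont_cst. Qed.

Lemma ccontN f : ccont f -> ccont (fun x => - f x).
Proof. by move=> cf; under eq_fun do rewrite -mulN1r; exact: ccontZ. Qed.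

Lemma ccontB f g : ccont f -> ccont g -> ccont (fun x => f x - g x).
Proof. by move=> cf cg; apply: ccontD => //; exact: ccontN. Qed.

Lemma ccont_conj f : ccont f -> ccont (fun x => Num.conj (f x)).
Proof.
move=> /ccont_edP cf; apply/ccont_edP => x e /(cf x)[D D0 DP].
by exists D => // y; rewrite -rmorphB cnorm_conj; exact: DP.
Qed.

Lemma ccont_sum (I : finType) (F : I -> V -> C) :
  (forall i, ccont (F i)) -> ccont (fun x => \sum_i F i x).
Proof.
move=> H; elim: (index_enum I) => [|i s IH].
  by under eq_fun do rewrite big_nil; exact: ccont_cst.
by under eq_fun do rewrite big_cons; exact: ccontD.
Qed.

Lemma ccont_expi (t : V -> R) : continuous t -> ccont (fun x => expi (t x)).
Proof.
by move=> ct; split => x /=; apply: continuous_comp; [exact: ct|exact: continuous_cos|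
  exact: ct|exact: continuous_sin].
Qed.

Lemma continuous_sumR {T : topologicalType} (I : finType) (F : I -> T -> R) :
  (forall i, continuous (F i)) -> continuous (fun x => \sum_i F i x).
Proof.
move=> H; elim: (index_enum I) => [|i s IH].
  by under eq_fun do rewrite big_nil; move=> x; exact: cst_continuous.
by under eq_fun do rewrite big_cons; exact: continuousDR.
Qed.

Lemma continuous_prodR {T : topologicalType} (I : finType) (F : I -> T -> R) :
  (forall i, continuous (F i)) -> continuous (fun x => \prod_i F i x).
Proof.
move=> H; elim: (index_enum I) => [|i s IH].
  by under eq_fun do rewrite big_nil; move=> x; exact: cst_continuous.
by under eq_fun do rewrite big_cons; exact: continuousMR.
Qed.

Lemma continuous_coord (i : 'I_d) : continuous (fun x : V => x 0 i).
Proof. exact: coord_continuous. Qed.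

Lemma continuous_prod_coord (b : 'I_d -> R -> R) :
  (forall i, continuous (b i)) -> continuous (fun x : V => \prod_i b i (x 0 i)).
Proof.
move=> cb; apply: continuous_prodR => i.
exact: (continuous_compR _ _ (continuous_coord i) (cb i)).
Qed.

Lemma continuous_dotvr (y : V) : continuous (fun x => dotv x y).
Proof.
apply: continuous_sumR => i; apply: continuousMR; [exact: continuous_coord|].
by move=> x; exact: cst_continuous.
Qed.

Lemma dotvC (x y : V) : dotv x y = dotv y x.
Proof. by apply: eq_bigr => i _; rewrite mulrC. Qed.

Lemma dotvDl (x y z : V) : dotv (x + y) z = dotv x z + dotv y z.
Proof. by rewrite -big_split; apply: eq_bigr => i _; rewrite mxE mulrDl. Qed.

Lemma dotvNl (x y : V) : dotv (- x) y = - dotv x y.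
Proof. by rewrite -sumrN; apply: eq_bigr => i _; rewrite mxE mulNr. Qed.

Lemma dotvDr (x y z : V) : dotv z (x + y) = dotv z x + dotv z y.
Proof. by rewrite dotvC dotvDl !(dotvC z). Qed.

Lemma dotvNr (x y : V) : dotv x (- y) = - dotv x y.
Proof. by rewrite dotvC dotvNl dotvC. Qed.

Lemma normr_dotv_le (x y : V) : `|dotv x y| <= d%:R * (`|x| * `|y|).
Proof.
rewrite (le_trans (ler_norm_sum _ _ _))//.
rewrite -[X in X%:R](card_ord d) mulr_natl -sumr_const ler_sum// => i _.
by rewrite normrM ler_pM// normr_coord.
Qed.

Lemma compact_ballV (L : R) : compact [set x : V | `|x| <= L].
Proof.
apply: bounded_closed_compact.
  exists L; split; first exact: num_real.
  by move=> r Lr x /= xL; rewrite (le_trans xL)// ltW.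
apply: (@preimage_closed _ _ (fun x : V => `|x|) [set t | t <= L]).
  by move=> x _; exact: norm_continuous.
exact: closed_le.
Qed.

Lemma cpt_suppP {T : Type} (z : T) (h : V -> T) :
  cpt_supp z h <-> exists2 L : R, 0 < L & forall x, L < `|x| -> h x = z.
Proof.
split=> [[K [cK KP]]|[L L0 LP]]; last first.
  exists [set x : V | `|x| <= L]; split; first exact: compact_ballV.
  by move=> x /= /negP; rewrite -ltNge; exact: LP.
have [M [_ MP]] := compact_bounded cK.
exists (Num.max 1 (M + 1)) => [|x]; first by rewrite lt_max ltr01.
rewrite gt_max => /andP[_ Mx]; apply: KP => Kx.
have M1 : M < M + 1 by rewrite ltrDl.
by have := MP _ M1 x Kx => /=; rewrite leNgt Mx.
Qed.

Lemma compact_sub_ball (K : set V) : compact K ->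
  exists2 L : R, 0 < L & forall x, K x -> `|x| <= L.
Proof.
move=> cK; have [M [_ MP]] := compact_bounded cK.
exists (Num.max 1 (M + 1)) => [|x Kx]; first by rewrite lt_max ltr01.
by rewrite le_max; apply/orP; right; apply: (MP (M + 1)); rewrite ?ltrDl.
Qed.

Lemma Cc_bounded_supp f : Cc f -> exists2 L : R, 0 < L & forall x, L < `|x| -> f x = 0.
Proof. by case=> _ /cpt_suppP. Qed.

Lemma CcI f (L : R) : 0 < L -> ccont f -> (forall x, L < `|x| -> f x = 0) -> Cc f.
Proof. by move=> L0 cf fL; split=> //; apply/cpt_suppP; exists L. Qed.

Lemma CcMl g f : ccont g -> Cc f -> Cc (fun x => g x * f x).
Proof.
move=> cg fc; have [L L0 fL] := Cc_bounded_supp _ fc; case: fc => cf _.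
by apply: (CcI _ L) => // [|x /fL ->]; [exact: ccontM|rewrite mulr0].
Qed.

Lemma CcZ (c : C) f : Cc f -> Cc (fun x => c * f x).
Proof. exact/CcMl/ccont_cst. Qed.

Lemma CcD f g : Cc f -> Cc g -> Cc (fun x => f x + g x).
Proof.
move=> fc gc; have [L L0 fL] := Cc_bounded_supp _ fc; have [M M0 gM] := Cc_bounded_supp _ gc.
case: fc gc => cf _ [cg _].
apply: (CcI _ (Num.max L M)) => [||x]; first by rewrite lt_max L0.
  exact: ccontD.
by rewrite gt_max => /andP[/fL -> /gM ->]; rewrite addr0.
Qed.

Lemma CcB f g : Cc f -> Cc g -> Cc (fun x => f x - g x).
Proof.
by move=> fc gc; under eq_fun do rewrite -mulN1r; apply: CcD => //; exact: CcZ.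
Qed.

Lemma Cc0 : Cc (fun _ : V => 0 : C).
Proof. by apply: (CcI _ 1) => //; exact: ccont_cst. Qed.

Lemma Cc_sum (I : finType) (F : I -> V -> C) :
  (forall i, Cc (F i)) -> Cc (fun x => \sum_i F i x).
Proof.
move=> H; elim: (index_enum I) => [|i s IH].
  by under eq_fun do rewrite big_nil; exact: Cc0.
by under eq_fun do rewrite big_cons; exact: CcD.
Qed.

Lemma ccont_isometry (u : V -> V) f :
  (forall x y : V, `|u x - u y| = `|x - y|) -> ccont f -> ccont (fun x => f (u x)).
Proof.
move=> iu /ccont_edP cf; apply/ccont_edP => x e /(cf (u x))[D D0 DP].
by exists D => // y; rewrite -iu; exact: DP.
Qed.

Lemma ccont_shift f (a : V) : ccont f -> ccont (fun x => f (x - a)).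
Proof. by apply: (ccont_isometry (fun x => x - a)) => x y; rewrite opprB addrA subrK. Qed.

Lemma ccont_opp f : ccont f -> ccont (fun x => f (- x)).
Proof. by apply: (ccont_isometry -%R) => x y; rewrite opprK addrC distrC. Qed.

Lemma Cc_shift f (a : V) : Cc f -> Cc (fun x => f (x - a)).
Proof.
move=> fc; have [L L0 fL] := Cc_bounded_supp _ fc; case: fc => cf _.
apply: (CcI _ (L + `|a|)) => [||x Lx]; first by rewrite ltr_wpDr.
  exact: ccont_shift.
by apply: fL; rewrite -(ltrD2r `|a|) (lt_le_trans Lx)// -{1}(subrK a x) ler_normD.
Qed.

Lemma Cc_opp f : Cc f -> Cc (fun x => f (- x)).
Proof.
move=> fc; have [L L0 fL] := Cc_bounded_supp _ fc; case: fc => cf _.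
apply: (CcI _ L) => // [|x Lx]; first exact: ccont_opp.
by apply: fL; rewrite normrN.
Qed.

Lemma Cc_conj f : Cc f -> Cc (fun x => Num.conj (f x)).
Proof.
move=> fc; have [L L0 fL] := Cc_bounded_supp _ fc; case: fc => cf _.
by apply: (CcI _ L) => // [|x /fL ->]; [exact: ccont_conj|rewrite rmorph0].
Qed.

Lemma Cc_ctilde f : Cc f -> Cc (ctilde f).
Proof. by move=> /Cc_opp; exact: Cc_conj. Qed.

Lemma Cc_CcR (h : V -> R) : CcR h -> Cc (fun x => (h x)%:C%C).
Proof.
move=> [ch /cpt_suppP[L L0 hL]]; apply: (CcI _ L) => //; first exact: ccont_real.
by move=> x /hL ->.
Qed.

Lemma Cc_bounded f : Cc f -> exists2 M : R, 0 < M & forall x, cnorm (f x) <= M.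
Proof.
move=> fc; have [L L0 fL] := Cc_bounded_supp _ fc; case: fc => cf _.
have nf := ccont_cnorm _ cf.
have [|c _ cP] := compact_EVT_max _ (compact_ballV L) (continuous_subspaceT nf).
  by exists 0 => /=; rewrite normr0 ltW.
exists (1 + cnorm (f c)) => [|x]; first by rewrite ltr_pwDl ?cnorm_ge0.
have [xL|/fL ->] := leP `|x| L; last by rewrite cnorm0 addr_ge0// cnorm_ge0.
by rewrite (le_trans (cP x _))// ?lerDr// inE.
Qed.

(** Only [x] is confined to the ball, while [y] may leave it. This asymmetry yields uniform
    continuity on all of R^d for a function vanishing outside the ball. *)
Lemma compact_uniform_continuous f (L : R) : ccont f -> forall e : R, 0 < e ->
  exists2 D : R, 0 < D & forall x y : V, `|x| <= L -> `|x - y| < D -> cnorm (f x - f y) < e.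
Proof.
move=> /ccont_edP cf e e0.
have /compact_near_coveringP cK := compact_ballV L.
have := cK R 0^'+ (fun D x => forall y, `|x - y| < D -> cnorm (f x - f y) < e).
case=> [x _|D0 /= D00 DP].
  have [D D0 DP] := cf x (e / 2) (divr_gt0 e0 (ltr0n _ 2)).
  near=> x' D'.
  have D'D : D' < D / 2 by near: D'; apply: nbhs_right_lt; rewrite divr_gt0.
  have xx' : `|x - x'| < D / 2.
    near: x'; apply/nbhs_ballP; exists (D / 2); first by rewrite /= divr_gt0.
    by move=> z; rewrite -ball_normE.
  move=> y x'y.
  rewrite (le_lt_trans (cdist_triangle (f x) _ _))// (splitr e) ltrD//.
    by rewrite cdistC; apply: DP; rewrite (lt_trans xx')// ltr_pdivrMr// mulr_natr mulr2n ltrDl.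
  apply: DP; rewrite -(subrK x' x) -addrA (le_lt_trans (ler_normD _ _))// (splitr D) ltrD//.
  exact: lt_trans x'y D'D.
exists (D0 / 2); first by rewrite divr_gt0.
move=> x y xL; apply: (DP (D0 / 2)) => //=; last by rewrite divr_gt0.
by rewrite sub0r normrN gtr0_norm ?divr_gt0// ltr_pdivrMr// mulr_natr mulr2n ltrDl.
Unshelve. all: by end_near. Qed.

Lemma Cc_uniform_continuous f : Cc f -> forall e : R, 0 < e ->
  exists2 D : R, 0 < D & forall x y : V, `|x - y| < D -> cnorm (f x - f y) < e.
Proof.
move=> fc e e0; have [L L0 fL] := Cc_bounded_supp _ fc; case: fc => cf _.
have [D D0 DP] := compact_uniform_continuous _ L cf _ e0.
exists D => // x y xy.
have [xL|xL] := leP `|x| L; first exact: DP.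
have [yL|yL] := leP `|y| L; first by rewrite cdistC; apply: DP => //; rewrite distrC.
by rewrite !fL// subrr cnorm0.
Qed.

End VectorSpace.

(** * The integral on the line for continuous functions dominated by [1 / (1 + t^2)] *)

Section RealIntegral.
Context {R : realType}.
Implicit Types (f g : R -> R).
Local Notation mu := (@lebesgue_measure R).

(** This weight is chosen because translation changes it by a bounded factor ([qw_shift]), its sums
    over integer translates are bounded ([sum_qw]), and second differences reproduce it
    ([delta2_qw]). *)
Definition qw (t : R) : R := (1 + t ^+ 2)^-1.
Definition intR f : R := Rintegral mu setT f.
(** Domination replaces integrability: together with continuity it implies it, and it passes to
    parameter integrals with an explicit constant. *)
Definition qdom (M : R) f := forall t, `|f t| <= M * qw t.

Lemma one_sqr_gt0 (t : R) : 0 < 1 + t ^+ 2.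
Proof. by rewrite ltr_pwDl// sqr_ge0. Qed.

Lemma qw_gt0 t : 0 < qw t.
Proof. by rewrite invr_gt0 one_sqr_gt0. Qed.

Lemma qw_ge0 t : 0 <= qw t.
Proof. exact/ltW/qw_gt0. Qed.

Lemma qw_le1 t : qw t <= 1.
Proof. by rewrite invf_le1 ?one_sqr_gt0// lerDl sqr_ge0. Qed.

Lemma qwN t : qw (- t) = qw t.
Proof. by rewrite /qw sqrrN. Qed.

Lemma continuous_qw : continuous qw.
Proof. exact: continuous_oneDsqrV. Qed.

Lemma continuous_measurableE f : continuous f ->
  measurable_fun setT (EFin \o f).
Proof. by move=> cf; have mf := continuous_measurable_fun cf; exact/measurable_EFinP. Qed.

Lemma integrable_qw : mu.-integrable setT (fun t => (qw t)%:E).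
Proof.
apply/integrableP; split; first by apply: continuous_measurableE; exact: continuous_qw.
under eq_integral do rewrite gee0_abs ?lee_fin ?qw_ge0//.
rewrite ge0_symfun_integralT; [|exact: qw_ge0|exact: continuous_qw|by move=> t /=; rewrite qwN].
by rewrite -set_itvcy integral0y_oneDsqr -EFinM ltry.
Qed.

Lemma qdom_integrable M f : continuous f -> qdom M f ->
  mu.-integrable setT (fun t => (f t)%:E).
Proof.
move=> cf fM.
apply: (@le_integrable _ _ _ mu setT measurableT _ (fun t => (M * qw t)%:E)).
- exact: continuous_measurableE.
- by move=> t _; rewrite !abse_EFin lee_fin (le_trans (fM t))// ler_norm.
- exact: (integrableZl measurableT M integrable_qw).
Qed.

Lemma intR_lin (a : R) M N f g : continuous f -> continuous g -> qdom M f -> qdom N g ->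
  intR (fun t => a * f t + g t) = a * intR f + intR g.
Proof.
move=> cf cg fM gN; have If := qdom_integrable _ _ cf fM; have Ig := qdom_integrable _ _ cg gN.
rewrite /intR -RintegralZl// -RintegralD//; exact: (integrableZl measurableT a If).
Qed.

Lemma intR_le M N f g : continuous f -> continuous g -> qdom M f -> qdom N g ->
  (forall t, f t <= g t) -> intR f <= intR g.
Proof.
move=> cf cg fM gN fg; apply: le_Rintegral => //; exact: qdom_integrable.
Qed.

Lemma qdom_qw M : 0 <= M -> qdom M (fun t => M * qw t).
Proof. by move=> M0 t; rewrite ger0_norm// mulr_ge0// qw_ge0. Qed.

Lemma continuousZR {T : topologicalType} (a : R) (f : T -> R) : continuous f ->
  continuous (fun x => a * f x).
Proof. by apply: continuousMR => x; exact: cst_continuous. Qed.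

Lemma intRZ (a : R) M f : continuous f -> qdom M f ->
  intR (fun t => a * f t) = a * intR f.
Proof.
by move=> cf fM; rewrite /intR RintegralZl//; exact: qdom_integrable cf fM.
Qed.

Definition Iqw : R := intR qw.

Lemma Iqw_ge0 : 0 <= Iqw.
Proof. by apply: Rintegral_ge0 => t _; exact: qw_ge0. Qed.

Lemma qdom_ge0 M f : qdom M f -> 0 <= M.
Proof.
by move=> /(_ 0); rewrite /qw expr0n addr0 invr1 mulr1; apply: le_trans.
Qed.

Lemma intR_bound M f : continuous f -> qdom M f -> `|intR f| <= M * Iqw.
Proof.
move=> cf fM; have M0 := qdom_ge0 _ _ fM.
have cq := continuousZR M _ continuous_qw.
have cN : continuous (fun t => - M * qw t) by exact/continuousZR/continuous_qw.
have dN : qdom M (fun t => - M * qw t) by move=> t; rewrite mulNr normrN; exact: qdom_qw.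
have dq : qdom 1 qw by move=> t; rewrite mul1r ger0_norm ?qw_ge0.
rewrite ler_norml -mulNr -(intRZ _ 1 _ continuous_qw dq) -(intRZ M 1 _ continuous_qw dq).
apply/andP; split; apply: (intR_le M M) => //; try exact: qdom_qw.
  by move=> t; have := fM t; rewrite ler_norml mulNr => /andP[].
by move=> t; have := fM t; rewrite ler_norml => /andP[].
Qed.

(** Peetre's inequality: with [s = t + a], the difference [2 (1 + a^2) (1 + s^2) - (1 + t^2)] equals
    [1 + (t + 2 a)^2 + 2 (a s)^2]. *)
Lemma qw_shift (a t : R) : qw (t + a) <= 2 * (1 + a ^+ 2) * qw t.
Proof.
rewrite /qw ler_pdivlMr ?one_sqr_gt0// mulrC ler_pdivrMr ?one_sqr_gt0//.
have := sqr_ge0 (t + 2 * a); have := sqr_ge0 (a * (t + a)); nra.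
Qed.

Lemma qdom_shift M f (a : R) : qdom M f -> qdom (M * (2 * (1 + a ^+ 2))) (fun t => f (t + a)).
Proof.
move=> fM t; rewrite (le_trans (fM _))// -mulrA ler_wpM2l ?(qdom_ge0 _ _ fM)//.
exact: qw_shift.
Qed.

Lemma continuous_addR (a : R) : continuous (fun t : R => t + a).
Proof. by apply: continuousDR => t; [exact: cvg_id|exact: cst_continuous]. Qed.

Lemma integral_shift f (a : R) : continuous f -> (forall t, 0 <= f t) ->
  (\int[mu]_t (f t)%:E = \int[mu]_t (f (t + a))%:E)%E.
Proof.
move=> cf f0.
have dE : (fun t : R => t + a)^`()%classic = cst 1.
  by apply/funext => t; rewrite derive1E derive_val addr0.
rewrite (@increasing_ge0_integration_by_substitutionT _ (fun t => t + a))//.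
- by apply: eq_integral => t _; rewrite fctE dE /= mulr1.
- by move=> x y xy; rewrite ltrD2r.
- by rewrite dE => t; exact: cst_continuous.
- by rewrite dE; exact: is_cvg_cst.
- by rewrite dE; exact: is_cvg_cst.
- apply/cvgrNyPle => A; exists (A - a); split; first exact: num_real.
  by move=> x; rewrite -lerBrDr => /ltW.
- apply/cvgryPge => A; exists (A - a); split; first exact: num_real.
  by move=> x; rewrite -lerBlDr => /ltW.
Qed.

Lemma integral_reflect f : continuous f -> (forall t, 0 <= f t) ->
  (\int[mu]_t (f t)%:E = \int[mu]_t (f (- t))%:E)%E.
Proof.
move=> cf f0.
have cN : continuous (fun t => f (- t)).
  by apply: (@continuous_compR _ R R -%R f) => // t; exact: opp_continuous.
pose A := `]-oo, 0%R[%classic : set R; pose B := `[0%R, +oo[%classic : set R.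
have split_int (h : R -> R) : continuous h -> (forall t, 0 <= h t) ->
    (\int[mu]_t (h t)%:E = \int[mu]_(t in `]-oo, 0%R]) (h t)%:E +
                           \int[mu]_(t in `[0%R, +oo[) (h t)%:E)%E.
  move=> ch h0.
  have mh := continuous_measurableE _ ch.
  have -> : [set: R] = A `|` B.
    by rewrite /A /B -(@itv_bndbnd_setU _ _ -oo%O (BLeft 0) +oo%O)// set_itvNyy.
  rewrite ge0_integral_setU//=.
  - by congr (_ + _)%E; rewrite integral_itv_bndo_bndc//; exact: measurable_funTS.
  - exact: measurable_itv.
  - exact: measurable_itv.
  - exact: measurable_funTS.
  - by move=> t _; rewrite lee_fin.
  - rewrite disj_set2E; apply/eqP/seteqP; split => // t [].
    by rewrite /A /B /= !in_itv/= andbT => t0; rewrite leNgt t0.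
rewrite (split_int _ cf f0) (split_int _ cN (fun t => f0 (- t))) addeC.
have E (h : R -> R) : continuous h -> (forall t, 0 <= h t) ->
    (\int[mu]_(t in `]-oo, 0%R]) (h t)%:E = \int[mu]_(t in `[0%R, +oo[) (h (- t))%:E)%E.
  move=> ch h0; rewrite -{1}oppr0 ge0_integration_by_substitutionNy//.
  exact: continuous_subspaceT.
rewrite (E _ cf f0) (E _ cN (fun t => f0 (- t))).
by under [X in (X + _)%E]eq_integral do rewrite -[X in f X]opprK.
Qed.

(** The substitution rules for translation and reflection are available for nonnegative integrands.
    The rule is applied to [f + M qw], which is nonnegative by domination, and to [M qw];
    subtraction gives it for [f]. *)
Lemma intR_invariant (u : R -> R) : continuous u ->
  (forall M f, qdom M f -> exists N, qdom N (fun t => f (u t))) ->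
  (forall f, continuous f -> (forall t, 0 <= f t) ->
     (\int[mu]_t (f t)%:E = \int[mu]_t (f (u t))%:E)%E) ->
  forall M f, continuous f -> qdom M f -> intR (fun t => f (u t)) = intR f.
Proof.
move=> cu du iu M f cf fM.
have M0 := qdom_ge0 _ _ fM.
have [N fN] := du _ _ fM; have dq : qdom M (fun t => M * qw t) := qdom_qw M M0.
have cq := continuousZR M _ continuous_qw.
have [N' qN] := du _ _ dq.
have cfu := continuous_compR _ _ cu cf; have cqu := continuous_compR _ _ cu cq.
have h0 t : 0 <= 1 * f t + M * qw t.
  by have := fM t; rewrite mul1r ler_norml addrC -lerBlDl sub0r => /andP[].
have ch : continuous (fun t => 1 * f t + M * qw t).
  by apply: continuousDR => //; exact: continuousZR.
have qE : intR (fun t => M * qw t) = intR (fun t => M * qw (u t)).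
  by congr fine; exact: (iu _ cq (fun t => mulr_ge0 M0 (qw_ge0 t))).
have hE : intR (fun t => 1 * f t + M * qw t) = intR (fun t => 1 * f (u t) + M * qw (u t)).
  by congr fine; exact: (iu _ ch h0).
move: hE; rewrite (intR_lin _ _ _ _ _ cf cq fM dq) (intR_lin _ _ _ _ _ cfu cqu fN qN) !mul1r.
by rewrite -qE => /addIr.
Qed.

Lemma intR_shift (a : R) M f : continuous f -> qdom M f ->
  intR (fun t => f (t + a)) = intR f.
Proof.
apply: (intR_invariant (fun t => t + a)).
- exact: continuous_addR.
- by move=> N g gN; exists (N * (2 * (1 + a ^+ 2))); exact: qdom_shift.
- by move=> g; exact: integral_shift.
Qed.

Lemma intR_opp M f : continuous f -> qdom M f -> intR (fun t => f (- t)) = intR f.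
Proof.
apply: (intR_invariant -%R).
- by move=> t; exact: opp_continuous.
- by move=> N g gN; exists N => t; rewrite -qwN.
- by move=> g; exact: integral_reflect.
Qed.

(** A failure of continuity at [x] would occur along some sequence converging to [x]; dominated
    convergence with majorant [M qw] excludes this. *)
Lemma continuous_intR_param {d : nat} (F : 'rV[R]_d -> R -> R) (M : R) :
  (forall x, continuous (F x)) -> (forall t, continuous (fun x => F x t)) ->
  (forall x, qdom M (F x)) -> continuous (fun x => intR (F x)).
Proof.
move=> cF cFx FM; apply/continuous_edP => x e e0; apply: contrapT => H.
have K n : exists y : 'rV[R]_d, `|x - y| < n.+1%:R^-1 /\ e <= `|intR (F x) - intR (F y)|.
  apply: contrapT => H'; apply: H; exists n.+1%:R^-1 => [|y xy]; first by rewrite invr_gt0 ltr0n.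
  by rewrite ltNge; apply/negP => ey; apply: H'; exists y.
have [y yP] := choice K.
have cvy t : F (y n) t @[n --> \oo] --> F x t.
  apply/cvgrPdist_lt => z z0.
  have /continuous_edP/(_ x z z0)[D D0 DP] := cFx t.
  near=> n; apply: DP; rewrite (lt_trans (yP n).1)//.
  by near: n; exact: (near_infty_natSinv_lt (PosNum D0)).
have cv : (\int[mu]_t (F (y n) t)%:E)%E @[n --> \oo] --> (\int[mu]_t (F x t)%:E)%E.
  apply: (@dominated_cvg _ _ _ mu setT measurableT (fun n t => (F (y n) t)%:E)
    (fun t => (F x t)%:E) (fun t => (M * qw t)%:E)).
  - by move=> n; exact: continuous_measurableE.
  - by move=> t _; apply: cvg_EFin; [exact: nearW|exact: cvy].
  - by [].
  - exact: (integrableZl measurableT M integrable_qw).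
  - by move=> n t _; rewrite abse_EFin lee_fin; exact: FM.
have I z := qdom_integrable _ _ (cF z) (FM z).
have : intR (F (y n)) @[n --> \oo] --> intR (F x).
  apply: fine_cvg; rewrite fineK; last exact: integrable_fin_num (I x).
  exact: cv.
move=> /cvgrPdist_lt/(_ e e0)[N _ /(_ N (leqnn N))] /=.
by rewrite ltNge (yP N).2.
Unshelve. all: by end_near. Qed.

End RealIntegral.

(** * Iterated integrals of functions dominated by a product weight *)

Section IteratedIntegral.
Context {R : realType} {d : nat}.
Local Notation V := 'rV[R]_d.
Local Notation C := R[i].

Fixpoint rint (k : nat) (f : V -> R) (x : V) : R :=
  if k is k'.+1 then intR (fun t => rint k' f (upd x k' t)) else f x.

Lemma iintE k (f : V -> C) x :
  iint k f x = (rint k (fun y => complex.Re (f y)) x +i*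
                rint k (fun y => complex.Im (f y)) x)%C.
Proof.
elim: k x => [x|k IH x] /=; first by case: (f x).
by rewrite /cint1; congr (Complex _ _); congr Rintegral; apply/funext => t; rewrite IH.
Qed.

(** The part of the weight that survives once the coordinates of index below [k] have been
    integrated out. *)
Definition wtk (k : nat) (x : V) : R := \prod_(i < d | (k <= i)%N) qw (x 0 i).
Definition wt (x : V) : R := \prod_(i < d) qw (x 0 i).

Lemma wtk_gt0 k x : 0 < wtk k x.
Proof. by apply: prodr_gt0 => i _; exact: qw_gt0. Qed.

Lemma wt_gt0 x : 0 < wt x.
Proof. exact: (wtk_gt0 0). Qed.

Lemma wt_ge0 x : 0 <= wt x.
Proof. exact/ltW/wt_gt0. Qed.

Lemma wtk_le1 k x : wtk k x <= 1.
Proof. by apply: prodr_ile1 => i _; rewrite qw_ge0 qw_le1. Qed.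

Lemma continuous_wt : continuous wt.
Proof. by apply: (continuous_prod_coord (fun=> qw)) => i; exact: continuous_qw. Qed.

(** One integration maps level [k] to level [k.+1] at the cost of a factor [Iqw] ([rdom_step]), so
    every slice met in the iteration is integrable. *)
Definition rdom (k : nat) (M : R) (f : V -> R) :=
  continuous f /\ forall x, `|f x| <= M * wtk k x.

Lemma rdom_ge0 k M f : rdom k M f -> 0 <= M.
Proof.
by move=> [_ /(_ 0)] H; rewrite -(pmulr_lge0 _ (wtk_gt0 k 0)) (le_trans _ H).
Qed.

Lemma upd_coord (x : V) k t (j : 'I_d) : upd x k t 0 j = if (j : nat) == k then t else x 0 j.
Proof. by rewrite mxE. Qed.

Lemma wtk_upd (x : V) (k : 'I_d) t : wtk k (upd x k t) = qw t * wtk k.+1 x.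
Proof.
rewrite /wtk (bigD1 k)//= upd_coord eqxx; congr (_ * _).
rewrite (eq_bigl (fun i : 'I_d => k < i)%N) => [|i].
  by apply: eq_bigr => i ki; rewrite upd_coord gtn_eqF.
by rewrite ltn_neqAle eq_sym andbC.
Qed.

Lemma continuous_upd_t (f : V -> R) x k : continuous f -> continuous (fun t => f (upd x k t)).
Proof.
move=> /continuous_edP cf; apply/continuous_edP => t e e0.
have [D D0 DP] := cf (upd x k t) e e0; exists D => // s ts; apply: DP.
apply: le_lt_trans ts; apply: normr_rV_le => // i; rewrite !mxE.
by case: ifP => // _; rewrite subrr normr0.
Qed.

Lemma continuous_upd_x (f : V -> R) k t : continuous f -> continuous (fun x => f (upd x k t)).
Proof.
move=> /continuous_edP cf; apply/continuous_edP => x e e0.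
have [D D0 DP] := cf (upd x k t) e e0; exists D => // y xy; apply: DP.
apply: le_lt_trans xy; apply: normr_rV_le => // i; rewrite !mxE.
case: ifP => [_|_]; first by rewrite subrr normr0.
by rewrite (le_trans _ (normr_coord _ i))// !mxE.
Qed.

Lemma rdom_qdom (k : 'I_d) M f x : rdom k M f ->
  qdom (M * wtk k.+1 x) (fun t => f (upd x k t)).
Proof.
by move=> [cf fM] t; rewrite (le_trans (fM _))// wtk_upd mulrCA mulrC lexx.
Qed.

Lemma rdom_step (k : 'I_d) M f : rdom k M f ->
  rdom k.+1 (M * Iqw) (fun x => intR (fun t => f (upd x k t))).
Proof.
move=> fM; have M0 := rdom_ge0 _ _ _ fM; have [cf _] := fM; split.
  apply: (continuous_intR_param _ M) => [x|t|x].
  - exact: continuous_upd_t.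
  - exact: continuous_upd_x.
  move=> t; rewrite (le_trans (rdom_qdom _ _ _ x fM t))// ler_wpM2r ?qw_ge0//.
  by rewrite ler_piMr// wtk_le1.
move=> x; rewrite mulrAC; apply: intR_bound (rdom_qdom _ _ _ x fM).
exact: continuous_upd_t.
Qed.

Lemma rint_rdom k M f : (k <= d)%N -> rdom 0 M f -> rdom k (M * Iqw ^+ k) (rint k f).
Proof.
move=> + fM; elim: k => [_|k IH kd]; first by rewrite expr0 mulr1.
by rewrite exprSr mulrA; exact: (rdom_step (Ordinal kd) _ _ (IH (ltnW kd))).
Qed.

Lemma rint_continuous_t k M f x : (k < d)%N -> rdom 0 M f ->
  continuous (fun t => rint k f (upd x k t)).
Proof. by move=> kd fM; apply: continuous_upd_t; have [] := rint_rdom _ _ _ (ltnW kd) fM. Qed.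

Lemma rint_qdom k M f x : (k < d)%N -> rdom 0 M f ->
  qdom (M * Iqw ^+ k * wtk k.+1 x) (fun t => rint k f (upd x k t)).
Proof. by move=> kd fM; exact: (rdom_qdom (Ordinal kd) _ _ x (rint_rdom _ _ _ (ltnW kd) fM)). Qed.

Lemma rint_lin k (a : R) M N f g x : (k <= d)%N -> rdom 0 M f -> rdom 0 N g ->
  rint k (fun y => a * f y + g y) x = a * rint k f x + rint k g x.
Proof.
move=> + fM gN; elim: k x => [//|k IH] x kd /=.
under [in LHS]eq_fun do rewrite (IH _ (ltnW kd)).
exact: intR_lin (rint_continuous_t _ _ _ x kd fM) (rint_continuous_t _ _ _ x kd gN)
  (rint_qdom _ _ _ x kd fM) (rint_qdom _ _ _ x kd gN).
Qed.

Lemma rint_le k M N f g x : (k <= d)%N -> rdom 0 M f -> rdom 0 N g ->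
  (forall y, f y <= g y) -> rint k f x <= rint k g x.
Proof.
move=> + fM gN fg; elim: k x => [//|k IH] x kd /=.
apply: intR_le (rint_continuous_t _ _ _ x kd fM) (rint_continuous_t _ _ _ x kd gN)
  (rint_qdom _ _ _ x kd fM) (rint_qdom _ _ _ x kd gN) _ => t; apply: IH; exact: ltnW.
Qed.

(** In the coordinates already integrated the translation is absorbed by [intR_shift]; the remaining
    ones keep it. At [k = d] nothing remains, which is translation invariance. *)
Lemma rint_shift k M f (a x : V) : (k <= d)%N -> rdom 0 M f ->
  rint k (fun y => f (y + a)) x =
  rint k f (x + \row_j (if (k <= j)%N then a 0 j else 0)).
Proof.
move=> + fM; elim: k x => [|k IH] x kd /=.
  by congr (f (_ + _)); apply/rowP => j; rewrite mxE.
set x' := (x + _ : V).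
under [in LHS]eq_fun do rewrite (IH _ (ltnW kd)).
rewrite -[RHS](intR_shift (a 0 (Ordinal kd)) _ _ (rint_continuous_t _ _ _ x' kd fM)
  (rint_qdom _ _ _ x' kd fM)).
congr intR; apply/funext => t; congr rint; apply/rowP => j; rewrite !mxE.
have [jk|] := eqVneq (j : nat) k.
  by rewrite jk leqnn; congr (_ + a _ _); exact: val_inj.
by move=> jk; rewrite leq_eqVlt eq_sym (negPf jk).
Qed.

Lemma rint_opp k M f (x : V) : (k <= d)%N -> rdom 0 M f ->
  rint k (fun y => f (- y)) x =
  rint k f (\row_j (if (k <= j)%N then - x 0 j else x 0 j)).
Proof.
move=> + fM; elim: k x => [|k IH] x kd /=.
  by congr f; apply/rowP => j; rewrite !mxE.
set x' := (\row_j _ : V).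
under [in LHS]eq_fun do rewrite (IH _ (ltnW kd)).
rewrite -[RHS](intR_opp _ _ (rint_continuous_t _ _ _ x' kd fM)
  (rint_qdom _ _ _ x' kd fM)).
congr intR; apply/funext => t; congr rint; apply/rowP => j; rewrite !mxE.
have [jk|] := eqVneq (j : nat) k; first by rewrite jk leqnn.
by move=> jk; rewrite leq_eqVlt eq_sym (negPf jk).
Qed.

Lemma rint_indep k f (x y : V) : (forall j : 'I_d, (k <= j)%N -> x 0 j = y 0 j) ->
  rint k f x = rint k f y.
Proof.
elim: k x y => [|k IH] x y xy /=; first by congr f; apply/rowP => j; exact: xy.
congr intR; apply/funext => t; apply: IH => j kj; rewrite !mxE.
by have [//|jk] := eqVneq; apply: xy; rewrite ltn_neqAle eq_sym jk.
Qed.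

Lemma rint_prod (b : 'I_d -> R -> R) (k : nat) (x : V) : (k <= d)%N ->
  (forall i, continuous (b i)) -> (forall i, exists M, qdom M (b i)) ->
  rint k (fun y => \prod_i b i (y 0 i)) x =
  \prod_(i < d) (if (k <= i)%N then b i (x 0 i) else intR (b i)).
Proof.
move=> + cb bM; elim: k x => [|k IH] x kd /=; first exact: eq_bigr.
pose k' := Ordinal kd; have [M kM] := bM k'.
under [in LHS]eq_fun => t.
  rewrite (IH _ (ltnW kd)) (bigD1 k')//= leqnn upd_coord eqxx mulrC; over.
rewrite (eq_fun (fun t => _ : _ = (\prod_(i < d | i != k')
   (if (k < i)%N then b i (x 0 i) else intR (b i))) * b k' t)); last first.
  move=> t; congr (_ * _); apply: eq_bigr => i ik.
  have ik' : (i : nat) != k by [].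
  by rewrite upd_coord (negPf ik') leq_eqVlt eq_sym (negPf ik').
rewrite (intRZ _ M)//.
by rewrite [in RHS](bigD1 k')//= ltnn mulrC.
Qed.

End IteratedIntegral.

(** * The complex integral over R^d *)

Section ComplexIntegral.
Context {R : realType} {d : nat}.
Local Notation V := 'rV[R]_d.
Local Notation C := R[i].
Implicit Types (f g : V -> C) (h : V -> R) (M N : R).

Definition rlint h : R := rint d h 0.
(** This is the integral of [wt] over R^d. *)
Definition Lam : R := Iqw ^+ d.
Definition cdom M f := ccont f /\ forall x, cnorm (f x) <= M * wt x.

Lemma Lam_ge0 : 0 <= Lam.
Proof. by rewrite exprn_ge0// Iqw_ge0. Qed.

Lemma cdom_ge0 M f : cdom M f -> 0 <= M.
Proof.
by move=> [_ /(_ 0)] H; rewrite -(pmulr_lge0 M (wt_gt0 (0 : V))) (le_trans _ H)// cnorm_ge0.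
Qed.

Lemma cdom_Re M f : cdom M f -> rdom 0 M (fun x => complex.Re (f x)).
Proof.
by move=> [[cR _] fM]; split=> // x; rewrite (le_trans (normr_Re_cnorm _))// fM.
Qed.

Lemma cdom_Im M f : cdom M f -> rdom 0 M (fun x => complex.Im (f x)).
Proof.
by move=> [[_ cI] fM]; split=> // x; rewrite (le_trans (normr_Im_cnorm _))// fM.
Qed.

Lemma cdom_real M h : rdom 0 M h -> cdom M (fun x => (h x)%:C%C).
Proof.
by move=> [ch hM]; split=> [|x]; [exact: ccont_real|rewrite cnorm_real hM].
Qed.

Lemma cdomZ (a : C) M f : cdom M f -> cdom (cnorm a * M) (fun x => a * f x).
Proof.
move=> [cf fM]; split=> [|x]; first exact: ccontZ.
by rewrite cnormM -mulrA ler_wpM2l ?cnorm_ge0.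
Qed.

Lemma cdomD M N f g : cdom M f -> cdom N g -> cdom (M + N) (fun x => f x + g x).
Proof.
move=> [cf fM] [cg gN]; split=> [|x]; first exact: ccontD.
by rewrite (le_trans (cnormD _ _))// mulrDl lerD.
Qed.

Lemma cdomMb N M g f : ccont g -> (forall x, cnorm (g x) <= N) -> cdom M f ->
  cdom (N * M) (fun x => f x * g x).
Proof.
move=> cg gN [cf fM]; split=> [|x]; first exact: ccontM.
by rewrite cnormM mulrC -mulrA ler_pM ?cnorm_ge0.
Qed.

Lemma lintE f : lint f = (rlint (fun x => complex.Re (f x)) +i* rlint (fun x => complex.Im (f x)))%C.
Proof. exact: iintE. Qed.

Lemma rlint_lin (a : R) M N h (h' : V -> R) : rdom 0 M h -> rdom 0 N h' ->
  rlint (fun x => a * h x + h' x) = a * rlint h + rlint h'.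
Proof. exact: rint_lin. Qed.

Lemma rlint_le M N h (h' : V -> R) : rdom 0 M h -> rdom 0 N h' ->
  (forall x, h x <= h' x) -> rlint h <= rlint h'.
Proof. exact: rint_le. Qed.

Lemma rlint_bound M h : rdom 0 M h -> `|rlint h| <= M * Lam.
Proof.
move=> /(rint_rdom d _ _ (leqnn d))[_ /(_ 0)] H; rewrite (le_trans H)//.
by rewrite /wtk big_pred0 ?mulr1// => i; rewrite leqNgt ltn_ord.
Qed.

Lemma rdom00 : rdom 0 0 (fun _ : V => 0 : R).
Proof. by split=> [x|x]; [exact: cst_continuous|rewrite normr0 mul0r]. Qed.

Lemma rlint0 : rlint (fun _ => 0) = 0.
Proof. by apply/normr0_eq0/le_anti; rewrite normr_ge0 andbT (le_trans (rlint_bound _ _ rdom00))// mul0r. Qed.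

Lemma rlintZ (a : R) M h : rdom 0 M h -> rlint (fun x => a * h x) = a * rlint h.
Proof.
move=> hM; rewrite -[RHS]addr0 -rlint0 -(rlint_lin _ _ _ _ _ hM rdom00).
by congr rlint; apply/funext => x; rewrite addr0.
Qed.

Lemma rdomZ (a : R) M h : rdom 0 M h -> rdom 0 (`|a| * M) (fun x => a * h x).
Proof.
by move=> [ch hM]; split=> [|x]; [exact: continuousZR|rewrite normrM -mulrA ler_wpM2l].
Qed.

Lemma rlint_ge0 M h : rdom 0 M h -> (forall x, 0 <= h x) -> 0 <= rlint h.
Proof. by move=> hM h0; rewrite -rlint0; exact: rlint_le rdom00 hM h0. Qed.

Lemma lint_real h : lint (fun x => (h x)%:C%C) = (rlint h)%:C%C.
Proof. by rewrite lintE /= rlint0. Qed.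

Lemma lintD M N f g : cdom M f -> cdom N g ->
  lint (fun x => f x + g x) = lint f + lint g.
Proof.
move=> fM gN; rewrite !lintE.
apply: complex_ext; rewrite ?ReD ?ImD /=.
  rewrite -[X in X + _]mul1r -(rlint_lin _ _ _ _ _ (cdom_Re _ _ fM) (cdom_Re _ _ gN)).
  by congr rlint; apply/funext => x; rewrite ReD mul1r.
rewrite -[X in X + _]mul1r -(rlint_lin _ _ _ _ _ (cdom_Im _ _ fM) (cdom_Im _ _ gN)).
by congr rlint; apply/funext => x; rewrite ImD mul1r.
Qed.

Lemma lintZ (a : C) M f : cdom M f -> lint (fun x => a * f x) = a * lint f.
Proof.
move=> fM; rewrite !lintE; have fR := cdom_Re _ _ fM; have fI := cdom_Im _ _ fM.
apply: complex_ext; rewrite ?ReM ?ImM /=.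
  rewrite addrC -mulNr -(rlintZ _ _ _ fR) -(rlint_lin _ _ _ _ _ fI (rdomZ _ _ _ fR)).
  by congr rlint; apply/funext => x; rewrite ReM addrC mulNr.
rewrite -(rlintZ _ _ _ fR) -(rlint_lin _ _ _ _ _ fI (rdomZ _ _ _ fR)).
by congr rlint; apply/funext => x; rewrite ImM.
Qed.

Lemma lint0 : lint (fun _ : V => 0 : C) = 0.
Proof. by rewrite (lint_real (fun=> 0)) rlint0. Qed.

Lemma cdomB M N f g : cdom M f -> cdom N g -> cdom (M + N) (fun x => f x - g x).
Proof.
move=> fM gN; under eq_fun do rewrite -mulN1r.
by have := cdomD _ _ _ _ fM (cdomZ (-1) _ _ gN); rewrite cnormN cnorm1 mul1r.
Qed.

Lemma lintB M N f g : cdom M f -> cdom N g ->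
  lint (fun x => f x - g x) = lint f - lint g.
Proof.
move=> fM gN; rewrite -mulN1r -(lintZ _ _ _ gN) -(lintD _ _ _ _ fM (cdomZ _ _ _ gN)).
by congr lint; apply/funext => x; rewrite mulN1r.
Qed.

Lemma cdom0 : cdom 0 (fun _ : V => 0 : C).
Proof. by split=> [|x]; [exact: ccont_cst|rewrite cnorm0 mul0r]. Qed.

Lemma cdom_sum (I : finType) (F : I -> V -> C) (m : I -> R) :
  (forall i, cdom (m i) (F i)) -> cdom (\sum_i m i) (fun x => \sum_i F i x).
Proof.
move=> H; elim: (index_enum I) => [|i s IH].
  by rewrite (eq_fun (fun x => big_nil _ _ _ _)) big_nil; exact: cdom0.
by rewrite (eq_fun (fun x => big_cons _ _ _ _ _ _)) big_cons; exact: cdomD.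
Qed.

Lemma lint_sum (I : finType) (F : I -> V -> C) (m : I -> R) :
  (forall i, cdom (m i) (F i)) -> lint (fun x => \sum_i F i x) = \sum_i lint (F i).
Proof.
move=> H.
suff : forall s : seq I, (exists N, cdom N (fun x => \sum_(i <- s) F i x)) /\
    lint (fun x => \sum_(i <- s) F i x) = \sum_(i <- s) lint (F i) by move=> /(_ (index_enum I))[].
elim=> [|i s [[N sN] IH]].
  rewrite (eq_fun (fun x => big_nil _ _ _ _)) big_nil.
  by split; [exists 0; exact: cdom0|exact: lint0].
rewrite (eq_fun (fun x => big_cons _ _ _ _ _ _)) big_cons -IH /=.
by split; [exists (m i + N); exact: cdomD|rewrite (lintD _ _ _ _ (H i) sN)].
Qed.

(** The factor 2 again comes from splitting into real and imaginary part; it recurs in all later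
    constants. *)
Lemma lint_le M N f h : cdom M f -> rdom 0 N h -> (forall x, cnorm (f x) <= h x) ->
  cnorm (lint f) <= 2 * rlint h.
Proof.
move=> fM hN fh; rewrite (le_trans (cnorm_ReIm _))// lintE /= mulr_natl mulr2n.
have hN' := rdomZ (-1) _ _ hN; have fR := cdom_Re _ _ fM; have fI := cdom_Im _ _ fM.
have hR x : `|complex.Re (f x)| <= h x by rewrite (le_trans (normr_Re_cnorm _)).
have hI x : `|complex.Im (f x)| <= h x by rewrite (le_trans (normr_Im_cnorm _)).
have E (k : V -> R) : rdom 0 M k -> (forall x, `|k x| <= h x) -> `|rlint k| <= rlint h.
  move=> kM kh; rewrite ler_norml -mulN1r -(rlintZ _ _ _ hN).
  apply/andP; split; [apply: (rlint_le _ _ _ _ hN' kM)|apply: (rlint_le _ _ _ _ kM hN)] => x;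
    by have := kh x; rewrite ler_norml ?mulN1r => /andP[].
by rewrite lerD// E.
Qed.

Lemma rdom_wt : rdom 0 1 (wt : V -> R).
Proof.
by split=> [|x]; [exact: continuous_wt|rewrite mul1r ger0_norm// wt_ge0].
Qed.

Lemma lint_bound M f : cdom M f -> cnorm (lint f) <= 2 * (M * Lam).
Proof.
move=> fM; have M0 := cdom_ge0 _ _ fM.
have MW := rdomZ M _ _ rdom_wt; rewrite (le_trans (lint_le _ _ _ _ fM MW fM.2))//.
by rewrite ler_wpM2l// (le_trans (ler_norm _))// (le_trans (rlint_bound _ _ MW))// mulr1 ger0_norm.
Qed.

Lemma lint_shift M f (a : V) : cdom M f -> lint (fun x => f (x + a)) = lint f.
Proof.
move=> fM; rewrite !lintE /rlint (rint_shift d M (fun x => complex.Re (f x)))//; last exact: cdom_Re.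
rewrite (rint_shift d M (fun x => complex.Im (f x)))//; last exact: cdom_Im.
by congr Complex; apply: rint_indep => j; rewrite leqNgt ltn_ord.
Qed.

Lemma lint_opp M f : cdom M f -> lint (fun x => f (- x)) = lint f.
Proof.
move=> fM; rewrite !lintE /rlint (rint_opp d M (fun x => complex.Re (f x)))//; last exact: cdom_Re.
rewrite (rint_opp d M (fun x => complex.Im (f x)))//; last exact: cdom_Im.
by congr Complex; apply: rint_indep => j; rewrite leqNgt ltn_ord.
Qed.

Lemma lint_conj M f : cdom M f -> lint (fun x => Num.conj (f x)) = Num.conj (lint f).
Proof.
move=> fM; rewrite !lintE; apply: complex_ext => /=.
  by congr rlint; apply/funext => x; case: (f x).
rewrite -mulN1r -(rlintZ _ _ _ (cdom_Im _ _ fM)).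
by congr rlint; apply/funext => x; rewrite mulN1r; case: (f x).
Qed.

Lemma wt_lower (L : R) (x : V) : `|x| <= L -> ((1 + L ^+ 2) ^+ d)^-1 <= wt x.
Proof.
move=> xL; rewrite -exprVn -[X in _ ^+ X](card_ord d) -prodr_const; apply: ler_prod => i _.
rewrite invr_ge0 addr_ge0 ?sqr_ge0//= lef_pV2 ?posrE ?one_sqr_gt0// lerD2l.
rewrite -[leLHS](real_normK (num_real _)); apply: ler_pM => //; exact: le_trans (normr_coord x i) xL.
Qed.

Lemma rdom_supp (L B : R) h : 0 <= B -> continuous h -> (forall x, `|h x| <= B) ->
  (forall x, L < `|x| -> h x = 0) -> rdom 0 (B * (1 + L ^+ 2) ^+ d) h.
Proof.
move=> B0 ch hB hL; split=> // x; have [xL|/hL ->] := leP `|x| L; last first.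
  by rewrite normr0 mulr_ge0 ?mulr_ge0 ?exprn_ge0 ?wt_ge0// ltW// one_sqr_gt0.
rewrite (le_trans (hB x))// -mulrA ler_peMr// mulrC -ler_pdivrMr ?exprn_gt0 ?one_sqr_gt0//.
by rewrite mul1r wt_lower.
Qed.

Lemma cdom_supp (L B : R) f : 0 <= B -> ccont f -> (forall x, cnorm (f x) <= B) ->
  (forall x, L < `|x| -> f x = 0) -> cdom (B * (1 + L ^+ 2) ^+ d) f.
Proof.
move=> B0 cf fB fL; split=> // x.
have [] := rdom_supp L B (fun x => cnorm (f x)) B0 (ccont_cnorm _ cf).
- by move=> y; rewrite ger0_norm ?cnorm_ge0.
- by move=> y /fL ->; rewrite cnorm0.
by move=> _ /(_ x); rewrite ger0_norm ?cnorm_ge0.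
Qed.

Lemma Cc_cdom f : Cc f -> exists M, cdom M f.
Proof.
move=> fc; have [L L0 fL] := Cc_bounded_supp _ fc; have [B B0 fB] := Cc_bounded _ fc.
by exists (B * (1 + L ^+ 2) ^+ d); apply: cdom_supp => //; [exact: ltW|have [] := fc].
Qed.

End ComplexIntegral.

(** * Elementary properties of the Fourier transform *)

Section FourierTransform.
Context {R : realType} {d : nat}.
Local Notation V := 'rV[R]_d.
Local Notation C := R[i].
Implicit Types (f g : V -> C) (h : V -> R) (M N : R).

Definition ee (y x : V) : C := expi (2 * pi * dotv x y).

Lemma ccont_ee y : ccont (ee y).
Proof. exact/ccont_expi/continuousZR/continuous_dotvr. Qed.

Lemma cnorm_ee y x : cnorm (ee y x) = 1.
Proof. exact: cnorm_expi. Qed.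

Lemma eeC y x : ee y x = ee x y.
Proof. by rewrite /ee dotvC. Qed.

Lemma eeDr y x z : ee y (x + z) = ee y x * ee y z.
Proof. by rewrite /ee dotvDl mulrDr expiD. Qed.

Lemma eeDl x y z : ee (x + y) z = ee x z * ee y z.
Proof. by rewrite !(eeC _ z) eeDr. Qed.

Lemma eeNr y x : ee y (- x) = Num.conj (ee y x).
Proof. by rewrite /ee dotvNl mulrN expiN. Qed.

Lemma eeNl y x : ee (- y) x = Num.conj (ee y x).
Proof. by rewrite !(eeC _ x) eeNr. Qed.

Lemma ee0 x : ee 0 x = 1.
Proof. by rewrite /ee /dotv big1 ?mulr0 ?expi0// => i _; rewrite mxE mulr0. Qed.

Lemma ee_lipschitz (x y z : V) :
  cnorm (ee y x - ee z x) <= (4 * pi * d%:R) * (`|x| * `|y - z|).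
Proof.
rewrite (le_trans (expi_lipschitz _ _))// -mulrBr -dotvNr -dotvDr normrM.
rewrite ger0_norm ?mulr_ge0 ?pi_ge0// (_ : 4 = 2 * 2 :> R); last by rewrite -natrM.
rewrite -!mulrA ler_wpM2l// ler_wpM2l// ler_wpM2l ?pi_ge0//.
by rewrite (le_trans (normr_dotv_le _ _)).
Qed.

Lemma icheckE f y : icheck f y = lint (fun x => f x * ee y x).
Proof. by []. Qed.

Lemma cdom_ee M f y : cdom M f -> cdom M (fun x => f x * ee y x).
Proof.
move=> [cf fM]; split=> [|x]; first exact: ccontM cf (ccont_ee y).
by rewrite cnormM cnorm_ee mulr1.
Qed.

Lemma icheckZ (a : C) M f y : cdom M f -> icheck (fun x => a * f x) y = a * icheck f y.
Proof.
move=> fM; rewrite !icheckE -(lintZ _ _ _ (cdom_ee _ _ y fM)).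
by congr lint; apply/funext => x; rewrite mulrA.
Qed.

Lemma icheckD M N f g y : cdom M f -> cdom N g ->
  icheck (fun x => f x + g x) y = icheck f y + icheck g y.
Proof.
move=> fM gN; rewrite !icheckE -(lintD _ _ _ _ (cdom_ee _ _ y fM) (cdom_ee _ _ y gN)).
by congr lint; apply/funext => x; rewrite mulrDl.
Qed.

Lemma icheckB M N f g y : cdom M f -> cdom N g ->
  icheck (fun x => f x - g x) y = icheck f y - icheck g y.
Proof.
move=> fM gN; rewrite !icheckE -(lintB _ _ _ _ (cdom_ee _ _ y fM) (cdom_ee _ _ y gN)).
by congr lint; apply/funext => x; rewrite mulrBl.
Qed.

Lemma icheck_sum (I : finType) (F : I -> V -> C) (m : I -> R) y :
  (forall i, cdom (m i) (F i)) -> icheck (fun x => \sum_i F i x) y = \sum_i icheck (F i) y.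
Proof.
move=> H; rewrite icheckE -(lint_sum _ _ m) => [|i]; last exact: cdom_ee.
by congr lint; apply/funext => x; rewrite mulr_suml.
Qed.

Lemma icheck_bound M f y : cdom M f -> cnorm (icheck f y) <= 2 * (M * Lam (R:=R) (d:=d)).
Proof. by move=> fM; apply: lint_bound; exact: cdom_ee. Qed.

Lemma wt_shift (a x : V) : wt (x + a) <= (\prod_i (2 * (1 + a 0 i ^+ 2))) * wt x.
Proof.
rewrite -big_split; apply: ler_prod => i _ /=.
by rewrite qw_ge0 mxE qw_shift.
Qed.

Lemma prod_shift_ge0 (a : V) : 0 <= \prod_i (2 * (1 + a 0 i ^+ 2)).
Proof. by apply: prodr_ge0 => i _; rewrite mulr_ge0// ltW// one_sqr_gt0. Qed.

Lemma cdom_shift M f (a : V) : cdom M f ->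
  cdom (M * \prod_i (2 * (1 + (- a) 0 i ^+ 2))) (fun x => f (x - a)).
Proof.
move=> fM; have M0 := cdom_ge0 _ _ fM; case: fM => cf fM; split; first exact: ccont_shift.
by move=> x; rewrite (le_trans (fM _))// -mulrA ler_wpM2l// wt_shift.
Qed.

Lemma icheck_shift M f (a y : V) : cdom M f ->
  icheck (fun x => f (x - a)) y = ee y a * icheck f y.
Proof.
move=> fM; have fa := cdom_ee _ _ y (cdom_shift _ _ a fM).
rewrite !icheckE -(lint_shift _ _ a fa) -(lintZ _ _ _ (cdom_ee _ _ y fM)).
by congr lint; apply/funext => x; rewrite addrK eeDr; ring.
Qed.

(** Through this identity the uniformity in [t] of hypothesis (i) becomes uniformity over all
    translates of the transformed measures. *)
Lemma icheck_modul f (t y : V) : icheck (modul t f) y = icheck f (y - t).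
Proof.
rewrite !icheckE; congr lint; apply/funext => x.
by rewrite eeDl eeNl /modul expiN -/(ee x t) eeC; ring.
Qed.

Lemma modul0 f : modul 0 f = f.
Proof. by apply/funext => x; rewrite /modul expiN -/(ee x 0) eeC ee0 rmorph1 mul1r. Qed.

Lemma wt_opp (x : V) : wt (- x) = wt x.
Proof. by apply: eq_bigr => i _; rewrite mxE qwN. Qed.

Lemma cdom_conj M f : cdom M f -> cdom M (fun x => Num.conj (f x)).
Proof. by move=> [cf fM]; split=> [|x]; [exact: ccont_conj|rewrite cnorm_conj]. Qed.

Lemma icheck_ctilde M f y : cdom M f -> icheck (ctilde f) y = Num.conj (icheck f y).
Proof.
move=> fM; rewrite !icheckE -(lint_conj _ _ (cdom_ee _ _ y fM)).
rewrite -(lint_opp _ _ (cdom_conj _ _ (cdom_ee _ _ y fM))).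
by congr lint; apply/funext => x; rewrite rmorphM/= -eeNr opprK.
Qed.

(** One additional power of [|x|] is dominated, which is what a Lipschitz bound on the transform
    requires. *)
Definition cdom1 M f := ccont f /\ forall x, (1 + `|x|) * cnorm (f x) <= M * wt x.

Lemma cdom1_cdom M f : cdom1 M f -> cdom M f.
Proof.
move=> [cf fM]; split=> // x; apply: le_trans (fM x).
by rewrite ler_peMl ?cnorm_ge0// lerDl.
Qed.

Lemma icheck_lipschitz M f (y z : V) : cdom1 M f ->
  cnorm (icheck f y - icheck f z) <= 2 * (4 * pi * d%:R * `|y - z| * M * Lam (R:=R) (d:=d)).
Proof.
move=> fM1; have fM := cdom1_cdom _ _ fM1; case: fM1 => cf f1.
rewrite !icheckE -(lintB _ _ _ _ (cdom_ee _ _ y fM) (cdom_ee _ _ z fM)).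
apply: lint_bound; split; first by apply: ccontB; apply: ccontM => //; exact: ccont_ee.
move=> x; rewrite -mulrBr cnormM mulrC.
rewrite (le_trans (ler_wpM2r (cnorm_ge0 _) (ee_lipschitz _ _ _)))//.
rewrite -!mulrA ler_wpM2l// ler_wpM2l ?pi_ge0// ler_wpM2l//.
rewrite mulrCA ler_wpM2l// (le_trans _ (f1 x))// ler_wpM2r ?cnorm_ge0//.
by rewrite lerDr.
Qed.

Lemma lipschitz_ccont g (K : R) : (forall y z : V, cnorm (g y - g z) <= K * `|y - z|) -> ccont g.
Proof.
move=> gK; apply/ccont_edP => x e e0.
have K0 : 0 < `|K| + 1 by rewrite ltr_wpDl.
exists (e / (`|K| + 1)) => [|y]; first by rewrite divr_gt0.
rewrite ltr_pdivlMr// => xy; rewrite (le_lt_trans (gK _ _))// (le_lt_trans _ xy)// mulrC ler_wpM2l//.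
by rewrite (le_trans (ler_norm _))// lerDl.
Qed.

Lemma ccont_icheck M f : cdom1 M f -> ccont (icheck f).
Proof.
move=> fM; apply: (lipschitz_ccont _ (2 * (4 * pi * d%:R * M * Lam (R:=R) (d:=d)))) => y z.
rewrite (le_trans (icheck_lipschitz _ _ _ _ fM))// -!mulrA !ler_wpM2l ?pi_ge0//.
by rewrite mulrCA (mulrC Lam).
Qed.

Lemma Cc_cdom1 f : Cc f -> exists M, cdom1 M f.
Proof.
move=> fc; have [L L0 fL] := Cc_bounded_supp _ fc; have [M fM] := Cc_cdom _ fc.
have M0 := cdom_ge0 _ _ fM.
exists ((1 + L) * M); split; first by have [] := fc.
move=> x; have [xL|/fL ->] := leP `|x| L; last first.
  by rewrite cnorm0 mulr0 mulr_ge0 ?wt_ge0// mulr_ge0// addr_ge0// ltW.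
by rewrite -mulrA ler_pM ?addr_ge0 ?cnorm_ge0 ?lerD2l//; case: fM.
Qed.

Lemma Cc_ccont_icheck f : Cc f -> ccont (icheck f).
Proof. by move=> /Cc_cdom1[M]; exact: ccont_icheck. Qed.

End FourierTransform.

(** * Unit cells, partitions of unity and the amalgam norm *)

Section Cells.
Context {R : realType} {d : nat}.
Local Notation V := 'rV[R]_d.
Local Notation C := R[i].

Definition ramp (s : R) : R := Num.min (Num.max s 0) 1.
(** The hat function [max(1 - |s|, 0)], written as a unit increment of [ramp] so that the sum of its
    integer translates telescopes. *)
Definition tent (s : R) : R := ramp (s + 1) - ramp s.

Lemma ramp_ge0 s : 0 <= ramp s.
Proof. by rewrite /ramp le_min ler01 le_max lexx orbT. Qed.

Lemma ramp_le1 s : ramp s <= 1.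
Proof. by rewrite /ramp ge_min lexx orbT. Qed.

Lemma ramp_eq0 s : s <= 0 -> ramp s = 0.
Proof. by move=> s0; rewrite /ramp (max_r s0) min_l. Qed.

Lemma ramp_eq1 s : 1 <= s -> ramp s = 1.
Proof. by move=> s1; rewrite /ramp min_r// le_max s1. Qed.

Lemma ramp_le s t : s <= t -> ramp s <= ramp t.
Proof.
by move=> st; rewrite /ramp le_min !ge_min lexx orbT andbT ge_max !le_max st lexx orbT.
Qed.

Lemma continuous_ramp : continuous ramp.
Proof.
apply/continuous_edP => s e e0; exists e => // t; apply: le_lt_trans.
have h1 := ler_norm (s - t); have h2 := ler_norm (t - s); rewrite distrC in h2.
have h0 := normr_ge0 (s - t).
rewrite ler_norml /ramp !minEle !maxEle.
by case: (leP s 0) => s0; case: (leP t 0) => t0; rewrite ?ler01;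
  case: (leP s 1) => s1; case: (leP t 1) => t1; apply/andP; split; lra.
Qed.

Lemma tent_ge0 s : 0 <= tent s.
Proof. by rewrite subr_ge0 ramp_le// lerDl. Qed.

Lemma tent_eq0 s : 1 <= `|s| -> tent s = 0.
Proof.
rewrite ler_normr => /orP[s1|s1]; rewrite /tent.
  by rewrite !ramp_eq1 ?subrr// (le_trans s1)// lerDl.
by rewrite !ramp_eq0 ?subrr; lra.
Qed.

Lemma continuous_tent : continuous tent.
Proof.
apply: continuousBR; last exact: continuous_ramp.
exact: (continuous_compR _ _ (continuous_addR 1) continuous_ramp).
Qed.

Lemma sum_tent N (s : R) : `|s| <= N%:R ->
  \sum_(j < N.*2.+1) tent (s - (j%:R - N%:R)) = 1.
Proof.
rewrite ler_norml => /andP[s1 s2].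
rewrite -(big_mkord xpredT (fun j => tent (s - (j%:R - N%:R)))).
rewrite (eq_bigr (fun j : nat => - (ramp (s - (j.+1%:R - N%:R) + 1) - ramp (s - (j%:R - N%:R) + 1)))).
  rewrite sumrN telescope_sumr// ramp_eq0 ?ramp_eq1; first by rewrite sub0r opprK.
    by rewrite sub0r opprK; lra.
  by rewrite -addnn -natr1 natrD; lra.
move=> j _; rewrite (_ : s - (j.+1%:R - N%:R) + 1 = s - (j%:R - N%:R)) ?[RHS]opprB//.
by rewrite -natr1; ring.
Qed.

(** Distributivity reduces sums over a grid in R^d to one-dimensional sums. It serves the partition
    of unity, the cell sums of [wt] and the Fejer kernel. *)
Lemma sum_prod_ffun n (kap : 'I_n -> R -> R) (x : V) :
  \sum_(k : {ffun 'I_d -> 'I_n}) \prod_i kap (k i) (x 0 i) =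
  \prod_i \sum_j kap j (x 0 i).
Proof. by rewrite bigA_distr_bigA. Qed.

Definition cellc N (k : {ffun 'I_d -> 'I_(N.*2.+1)}) : V := \row_i ((k i)%:R - N%:R).

(** Cells are closed sup-norm balls of radius 1 around integer points; they overlap, so that each
    function [tau] is supported in a single cell. *)
Definition in_cells N (y : {ffun 'I_d -> 'I_(N.*2.+1)} -> V) :=
  forall k, `|y k - cellc N k| <= 1.

Definition tau N (k : {ffun 'I_d -> 'I_(N.*2.+1)}) (x : V) : R :=
  \prod_i tent (x 0 i - (cellc N k) 0 i).

Lemma tau_ge0 N k (x : V) : 0 <= tau N k x.
Proof. by apply: prodr_ge0 => i _; exact: tent_ge0. Qed.

Lemma continuous_tau N k : continuous (tau N k).
Proof.
apply: (continuous_prod_coord (fun i t => tent (t - cellc N k 0 i))) => i.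
exact: (continuous_compR _ _ (continuous_addR _) continuous_tent).
Qed.

Lemma sum_tau N (x : V) : `|x| <= N%:R -> \sum_k tau N k x = 1.
Proof.
move=> xN.
transitivity (\sum_(k : {ffun 'I_d -> 'I_(N.*2.+1)})
   \prod_i (fun (j : 'I_(N.*2.+1)) t => tent (t - (j%:R - N%:R))) (k i) (x 0 i)).
  by apply: eq_bigr => k _; apply: eq_bigr => i _; rewrite mxE.
rewrite (sum_prod_ffun _ (fun (j : 'I_(N.*2.+1)) t => tent (t - (j%:R - N%:R))) x).
rewrite big1// => i _; apply: sum_tent.
exact: le_trans (normr_coord _ _) xN.
Qed.

Lemma tau_eq0 N k (x : V) : 1 < `|x - cellc N k| -> tau N k x = 0.
Proof.
move=> H; have [i +] := normr_rV_gt _ _ (@ler01 R) H; rewrite !mxE => /ltW xi.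
by rewrite /tau (bigD1 i)//= !mxE tent_eq0// mul0r.
Qed.

Lemma tau_le1 N k (x : V) : `|x| <= N%:R -> tau N k x <= 1.
Proof.
move=> xN; rewrite -(sum_tau N x xN) (bigD1 k)//= lerDl sumr_ge0// => j _; exact: tau_ge0.
Qed.

(** A bound for the amalgam norm: testing all choices of sample points replaces the suprema over
    cells, and all [N] replace the infinite sum. Every estimate thereby becomes one on finite
    sums. *)
Definition amalg (g : V -> R) (B : R) :=
  forall N y, in_cells N y -> \sum_k g (y k) <= B.

Lemma amalg_le g g' B : (forall x, g x <= g' x) -> amalg g' B -> amalg g B.
Proof. by move=> gg' g'B N y /g'B; apply: le_trans; apply: ler_sum. Qed.

Lemma amalg_leB g B B' : B <= B' -> amalg g B -> amalg g B'.
Proof. by move=> BB' gB N y /gB yB; exact: le_trans yB BB'. Qed.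

Lemma amalgD g g' B B' : amalg g B -> amalg g' B' -> amalg (fun x => g x + g' x) (B + B').
Proof. by move=> gB gB' N y yc; rewrite big_split /= lerD ?gB ?gB'. Qed.

Lemma amalgZ (a : R) g B : 0 <= a -> amalg g B -> amalg (fun x => a * g x) (a * B).
Proof. by move=> a0 gB N y yc; rewrite -mulr_sumr ler_wpM2l// gB. Qed.

Lemma in_cells_c N : in_cells N (cellc N).
Proof. by move=> k; rewrite subrr normr0. Qed.

Lemma amalg_ge0 g B : (forall x, 0 <= g x) -> amalg g B -> 0 <= B.
Proof. by move=> g0 /(_ 0%N _ (in_cells_c 0)); apply: le_trans; rewrite sumr_ge0. Qed.

(** A bounded function whose unit increments dominate [qw], so that sums of [qw] telescope. The
    factor 4 suffices in each of the three ranges of [x] in [qw_phiq]. *)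
Definition phiq (x : R) : R := 4 * (x / (1 + `|x|)).

Lemma qw_phiq x : qw x <= phiq x - phiq (x - 1).
Proof.
have [x1|x1] := leP 1 x.
  rewrite /phiq ger0_norm ?ger0_norm; [|lra|lra].
  rewrite (_ : 1 + (x - 1) = x); last lra.
  rewrite (_ : _ - _ = 4 / (x * (1 + x))); last by field; lra.
  rewrite /qw ler_pdivlMr; last nra.
  by rewrite mulrC ler_pdivrMr ?one_sqr_gt0//; nra.
have [x0|x0] := leP x 0.
  rewrite /phiq ler0_norm ?ler0_norm; [|lra|lra].
  rewrite (_ : _ - _ = 4 / ((1 - x) * (2 - x))); last by field; lra.
  rewrite /qw ler_pdivlMr; last nra.
  by rewrite mulrC ler_pdivrMr ?one_sqr_gt0//; nra.
apply: le_trans (qw_le1 x) _; rewrite /phiq ger0_norm ?ler0_norm; [|lra|lra].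
rewrite (_ : _ - _ = (4 * x * (2 - x) + 4 * (1 - x) * (1 + x)) / ((1 + x) * (2 - x))); last first.
  by field; lra.
by rewrite ler_pdivlMr; nra.
Qed.

Lemma phiq_bound x : `|phiq x| <= 4.
Proof.
have x0 : 0 < 1 + `|x| by rewrite ltr_pwDl.
rewrite /phiq normrM normf_div (gtr0_norm x0) ger0_norm// ler_piMr//.
by rewrite ler_pdivrMr// mul1r lerDr.
Qed.

Lemma sum_qw n (c : R) : \sum_(j < n) qw (j%:R - c) <= 8.
Proof.
rewrite -(big_mkord xpredT (fun j => qw (j%:R - c))).
apply: (@le_trans _ _ (\sum_(0 <= j < n) (phiq (j.+1%:R - c - 1) - phiq (j%:R - c - 1)))).
  apply: ler_sum => j _; rewrite (_ : j.+1%:R - c - 1 = j%:R - c) ?qw_phiq//.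
  by rewrite -natr1; ring.
rewrite telescope_sumr// (le_trans (ler_norm _))// (le_trans (ler_normB _ _))//.
by have := phiq_bound (n%:R - c - 1); have := phiq_bound (0%:R - c - 1); lra.
Qed.

Lemma qw_near (a t s : R) : `|t - s| <= 1 -> qw (a - t) <= 4 * qw (a - s).
Proof.
move=> ts; rewrite (_ : a - t = a - s + (s - t)); last ring.
rewrite (le_trans (qw_shift _ _))// ler_wpM2r ?qw_ge0//.
have : (s - t) ^+ 2 <= 1.
  by rewrite -(real_normK (num_real (s - t))) -[1](expr1n _ 2) lerXn2r ?nnegrE// distrC.
lra.
Qed.

(** In each coordinate [32 = 4 * 8]: a factor 4 for moving the sample point to the centre of its
    cell, and 8 for the sum over integer translates. *)
Lemma cell_sum_wt N y (z : V) : in_cells N y -> \sum_k wt (z - y k) <= 32 ^+ d.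
Proof.
move=> yc.
apply: (@le_trans _ _ (\sum_(k : {ffun 'I_d -> 'I_(N.*2.+1)})
   \prod_i (fun (j : 'I_(N.*2.+1)) t => 4 * qw (j%:R - t)) (k i) ((z + const_mx N%:R) 0 i))).
  apply: ler_sum => k _; apply: ler_prod => i _; rewrite qw_ge0 /=.
  have ki := le_trans (normr_coord (y k - cellc N k) i) (yc k).
  rewrite !mxE in ki *.
  rewrite (le_trans (qw_near (z 0 i) _ _ ki))// -[in leLHS]qwN ler_wpM2l// (_ : - (z 0 i - _) = (k i)%:R - (z 0 i + N%:R))//; ring.
rewrite (sum_prod_ffun _ (fun (j : 'I_(N.*2.+1)) t => 4 * qw (j%:R - t)) (z + const_mx N%:R)).
rewrite -[X in _ ^+ X](card_ord d) -prodr_const; apply: ler_prod => i _.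
rewrite sumr_ge0 => [|j _]; last by rewrite mulr_ge0// qw_ge0.
by rewrite -mulr_sumr; have := sum_qw N.*2.+1 ((z + const_mx N%:R) 0 i); lra.
Qed.

Lemma amalg_wt : amalg wt (32 ^+ d).
Proof.
move=> N y yc; have := cell_sum_wt _ _ 0 yc; apply: le_trans; apply: ler_sum => k _.
by rewrite sub0r wt_opp.
Qed.

Lemma amalg_cdom M (f : V -> C) : cdom M f -> amalg (fun x => cnorm (f x)) (M * 32 ^+ d).
Proof.
move=> fM; apply: (amalg_le _ (fun x => M * wt x)); first by case: fM.
by apply: amalgZ; [exact: cdom_ge0 fM|exact: amalg_wt].
Qed.

(** The supremum of the cell sums of [g] is attained up to [e] by some finite configuration [y0].
    Sample points in the other cells can be adjoined to [y0] without exceeding the supremum, so they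
    carry at most [e]; the cells of [y0] lie in the ball where [h] vanishes. *)
Lemma amalg_tail g B (e : R) : (forall x, 0 <= g x) -> amalg g B -> 0 < e ->
  exists2 L : R, 0 < L & forall h : V -> R, (forall x, 0 <= h x <= g x) ->
    (forall x, `|x| <= L -> h x = 0) -> amalg h e.
Proof.
move=> g0 gB e0.
pose S := [set s : R | exists N y, in_cells N y /\ s = \sum_k g (y k)].
have supS : has_sup S.
  split; first by exists (\sum_k g (cellc 0 k)), 0%N, (cellc 0); split => //; exact: in_cells_c.
  by exists B => s [N [y [yc ->]]]; exact: gB.
have [_ [N0 [y0 [yc0 ->]]] Hs] := sup_adherent e0 supS.
(* Index 0 of the grid of size [N] stands for the coordinate [-N], so the small grid enters the
   large one with indices raised by [N - N0]. *)
pose emb N (k0 : {ffun 'I_d -> 'I_(N0.*2.+1)}) : {ffun 'I_d -> 'I_(N.*2.+1)} :=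
  [ffun i => inord (k0 i + (N - N0))].
have embE N k0 i : (N0 <= N)%N -> emb N k0 i = (k0 i + (N - N0))%N :> nat.
  by move=> NN; rewrite ffunE inordK// ltnS -[X in (_ <= X.*2)%N](subnKC NN) doubleD
    leq_add//; [rewrite -ltnS|rewrite -addnn leq_addr].
have embc N k0 : (N0 <= N)%N -> cellc N (emb N k0) = cellc N0 k0.
  move=> NN; apply/rowP => i; rewrite !mxE embE// natrD natrB//; ring.
have cell_le N (k : {ffun 'I_d -> 'I_(N.*2.+1)}) : `|cellc N k| <= N%:R.
  apply: normr_rV_le => // i; rewrite mxE ler_distl -natrD addnn ler_nat.
  by rewrite subrr ler0n -ltnS ltn_ord.
exists (N0%:R + 1) => [|h hg hL N y yc]; first by rewrite ltr_wpDl.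
have yN k : `|y k| <= `|cellc N k| + 1.
  by rewrite -[y k](subrK (cellc N k)) addrC (le_trans (ler_normD _ _))// lerD2l.
have [NN|NN] := leqP N0 N; last first.
  rewrite big1 ?ltW// => k _; apply: hL; rewrite (le_trans (yN k))// lerD2r.
  by rewrite (le_trans (cell_le _ _))// ler_nat ltnW.
have emb_inj : injective (emb N).
  by move=> k k' /ffunP kk; apply/ffunP => i; apply/val_inj/eqP;
    rewrite -(eqn_add2r (N - N0)) -!embE// kk.
pose im : {set {ffun 'I_d -> 'I_(N.*2.+1)}} := imset (emb N) (mem predT).
(* The competing configuration: [y0] on the embedded small grid, [y] elsewhere. *)
pose y' k := if [pick k0 | emb N k0 == k] is Some k0 then y0 k0 else y k.
have y'c : in_cells N y'.
  by move=> k; rewrite /y'; case: pickP => [k0 /eqP <-|_]; rewrite ?embc.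
have y'emb k0 : y' (emb N k0) = y0 k0.
  by rewrite /y'; case: pickP => [k1 /eqP/emb_inj ->//|/(_ k0)]; rewrite eqxx.
have sumle : \sum_k g (y' k) <= sup S.
  by apply: (sup_upper_bound supS); exists N, y'.
have imE k : (k \in im) = [exists k0, emb N k0 == k].
  apply/imsetP/existsP => [[k0 _ ->]|[k0 /eqP <-]]; first by exists k0.
  by exists k0; rewrite ?inE.
move: sumle; rewrite (bigID (fun k => k \in im))/=.
rewrite big_imset /=; last by move=> ? ? _ _; exact: emb_inj.
rewrite (eq_bigr (fun k0 => g (y0 k0))) => [|k0 _]; last by rewrite y'emb.
rewrite (eq_bigl xpredT) => [|k0]; last by rewrite inE.
move=> sumle.
rewrite (bigID (fun k => k \in im))/= big1 ?add0r => [|k]; last first.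
  rewrite imE => /existsP[k0 /eqP ek]; apply: hL; rewrite (le_trans (yN k))// lerD2r -ek embc//.
apply: (@le_trans _ _ (\sum_(k | k \notin im) g (y' k))); last by lra.
apply: ler_sum => k; rewrite imE negb_exists => /forallP kim.
rewrite /y'; case: pickP => [k0 ek|_]; first by have := kim k0; rewrite ek.
by have /andP[] := hg (y k).
Qed.

End Cells.

(** * Functionals bounded for the amalgam norm, and integrals of functions without compact
    support *)

Section TranslationBounded.
Context {R : realType} {d : nat}.
Local Notation V := 'rV[R]_d.
Local Notation C := R[i].
Implicit Types (nu : (V -> C) -> C) (f g : V -> C) (h : V -> R).

Definition Cc_linear nu := forall (a : C) f g, Cc f -> Cc g ->
  nu (fun x => a * f x + g x) = a * nu f + nu g.

Definition wb nu (M : R) := Cc_linear nu /\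
  forall g B, Cc g -> amalg (fun x => cnorm (g x)) B -> cnorm (nu g) <= M * B.

Definition trans nu (t : V) : (V -> C) -> C := fun g => nu (fun x => g (x - t)).

Lemma Cc_linearD nu f g : Cc_linear nu -> Cc f -> Cc g ->
  nu (fun x => f x + g x) = nu f + nu g.
Proof.
move=> lnu fc gc; rewrite -[X in X + _]mul1r -lnu//.
by congr nu; apply/funext => x; rewrite mul1r.
Qed.

Lemma Cc_linear0 nu : Cc_linear nu -> nu (fun=> 0) = 0.
Proof.
move=> lnu; have := Cc_linearD _ _ _ lnu Cc0 Cc0; rewrite (_ : (fun _ => 0 + 0) = fun=> 0).
  by move=> /eqP; rewrite -[X in X == _]addr0 => /eqP/addrI.
by apply/funext => x; rewrite addr0.
Qed.

Lemma Cc_linearZ nu (a : C) f : Cc_linear nu -> Cc f -> nu (fun x => a * f x) = a * nu f.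
Proof.
move=> lnu fc; rewrite -[RHS]addr0 -(Cc_linear0 _ lnu) -lnu//; last exact: Cc0.
by congr nu; apply/funext => x; rewrite addr0.
Qed.

Lemma Cc_linearB nu f g : Cc_linear nu -> Cc f -> Cc g ->
  nu (fun x => f x - g x) = nu f - nu g.
Proof.
move=> lnu fc gc; rewrite -mulN1r -Cc_linearZ// -Cc_linearD//; last exact: CcZ.
by congr nu; apply/funext => x; rewrite mulN1r.
Qed.

Lemma Cc_linear_sum nu (I : finType) (F : I -> V -> C) : Cc_linear nu ->
  (forall i, Cc (F i)) -> nu (fun x => \sum_i F i x) = \sum_i nu (F i).
Proof.
move=> lnu H.
suff : forall s : seq I, Cc (fun x => \sum_(i <- s) F i x) /\
    nu (fun x => \sum_(i <- s) F i x) = \sum_(i <- s) nu (F i) by move=> /(_ (index_enum I))[].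
elim=> [|i s [sc IH]].
  by rewrite (eq_fun (fun x => big_nil _ _ _ _)) big_nil; split; [exact: Cc0|exact: Cc_linear0].
rewrite (eq_fun (fun x => big_cons _ _ _ _ _ _)) big_cons -IH /=.
by split; [exact: CcD|exact: Cc_linearD].
Qed.

Lemma Cc_linear_trans nu t : Cc_linear nu -> Cc_linear (trans nu t).
Proof. by move=> lnu a f g fc gc; rewrite /trans -lnu//; exact: Cc_shift. Qed.

Lemma cell_argmax f (c : V) : ccont f ->
  exists2 y, `|y - c| <= 1 & forall x, `|x - c| <= 1 -> cnorm (f x) <= cnorm (f y).
Proof.
move=> cf; have cs := ccont_cnorm _ (ccont_shift _ (- c) cf).
have [|z zK zP] := compact_EVT_max _ (compact_ballV 1) (continuous_subspaceT cs).
  by exists 0 => /=; rewrite normr0.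
rewrite inE/= in zK; exists (z + c); first by rewrite addrK.
move=> x xc; have := zP (x - c); rewrite inE/= => /(_ xc).
by rewrite !opprK subrK.
Qed.

(** The partition of unity splits [g] into pieces supported in single cells. Each piece is dominated
    by the maximum of [|g|] on its cell times a test function that is at least 1 there, and these
    maxima, taken at points of the cells, are summed by [amalg]. *)
Lemma wb_trans nu (M : R) : 0 <= M -> Cc_linear nu ->
  (forall t, (tvK nu [set (t + k)%R | k in [set k : V | (`|k| <= 1)%R]] <= M%:E)%E) ->
  forall t, wb (trans nu t) (M + 1).
Proof.
move=> M0 lnu nuM t; have lt := Cc_linear_trans _ t lnu; split=> // g B gc gB.
have M1 : 0 <= M + 1 by rewrite addr_ge0.
have [L L0 gL] := Cc_bounded_supp _ gc; have cg : ccont g by have [] := gc.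
have [N LN] : exists N : nat, L <= N%:R.
  by exists (Num.bound L); exact/ltW/archi_boundP/ltW.
pose G k x := (tau N k x)%:C%C * g x.
have Gc k : Cc (G k) by apply: CcMl => //; exact/ccont_real/continuous_tau.
have gE : g = fun x => \sum_k G k x.
  apply/funext => x; rewrite -mulr_suml -rmorph_sum /=.
  have [xL|/gL ->] := leP `|x| L; last by rewrite mulr0.
  by rewrite sum_tau ?mul1r// (le_trans xL).
have K (k : {ffun 'I_d -> 'I_(N.*2.+1)}) : exists z : V, `|z - cellc N k| <= 1 /\
    forall x : V, `|x - cellc N k| <= 1 -> cnorm (g x) <= cnorm (g z).
  by have [z z1 z2] := cell_argmax _ (cellc N k) cg; exists z.
have [y yP] := choice K.
rewrite [in trans _ _ _]gE Cc_linear_sum// (le_trans (cnorm_sum _ _))//.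
have yc : in_cells N y by move=> k; have [] := yP k.
rewrite (le_trans _ (ler_wpM2l M1 (gB N y yc)))// mulr_sumr; apply: ler_sum => k _.
have [h [hc [h0 h1]] tvh] : exists2 h, CcR h /\ (forall x, 0 <= h x) /\
    (forall x, `|x - (t + cellc N k)| <= 1 -> 1 <= h x) & (tv nu h < (M + 1)%:E)%E.
  (* [tvK] is an infimum that need not be attained; the slack between [M] and [M + 1] provides an
     actual test function. *)
  have /ereal_inf_lt : (tvK nu [set (t + cellc N k + k0)%R | k0 in [set k : V | (`|k| <= 1)%R]] < (M + 1)%:E)%E.
    by rewrite (le_lt_trans (nuM _))// lte_fin ltrDl.
  case=> _ [h [hc [h0 h1]] <-] tvh; exists h => //; split=> //; split=> // x xt.
  by apply: h1; exists (x - (t + cellc N k)) => //=; rewrite addrC subrK.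
have Gt0 x : cnorm (G k (x - t)) <= cnorm (g (y k)) * h x.
  rewrite /G cnorm_realM ?tau_ge0//.
  have [xt|xt] := leP `|x - (t + cellc N k)| 1; last first.
    rewrite tau_eq0 ?mul0r ?mulr_ge0 ?cnorm_ge0//.
    by rewrite -addrA -opprD.
  have gy : cnorm (g (x - t)) <= cnorm (g (y k)).
    by have [_] := yP k; apply; rewrite -addrA -opprD.
  have [xL|/gL ->] := leP `|x - t| L; last by rewrite cnorm0 mulr0 mulr_ge0 ?cnorm_ge0.
  have tau1 := tau_le1 N k (x - t) (le_trans xL LN).
  rewrite (le_trans (ler_wpM2r (cnorm_ge0 _) tau1))// mul1r (le_trans gy)//.
  by rewrite ler_peMr ?cnorm_ge0// h1.
(* The normalisation below divides by this maximum; if it is 0, the piece vanishes identically. *)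
have [gy0|gy0] := eqVneq (cnorm (g (y k))) 0.
  rewrite gy0 mulr0 /trans (_ : (fun x => G k (x - t)) = fun=> 0) ?Cc_linear0 ?cnorm0//.
  apply/funext => x; apply: cnorm_eq0; apply/le_anti; rewrite cnorm_ge0 andbT.
  by rewrite (le_trans (Gt0 x))// gy0 mul0r.
have gyp : 0 < cnorm (g (y k)) by rewrite lt_def gy0 cnorm_ge0.
pose F x := (cnorm (g (y k)))^-1%:C%C * G k (x - t).
have Fc : Cc F by apply/CcZ/Cc_shift.
have : ((cnorm (nu F))%:E <= tv nu h)%E.
  apply: ereal_sup_ubound; exists F => //; split=> // x.
  by rewrite /F cnorm_realM ?invr_ge0 ?cnorm_ge0// mulrC ler_pdivrMr// mulrC.
move=> /le_lt_trans/(_ tvh); rewrite lte_fin /F Cc_linearZ//; last exact: Cc_shift.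
by rewrite cnorm_realM ?invr_ge0 ?cnorm_ge0// mulrC ltr_pdivrMr// => /ltW.
Qed.

Definition cut (L : R) (x : V) : R := ramp (L + 1 - `|x|).

Lemma cut01 L x : 0 <= cut L x <= 1.
Proof. by rewrite ramp_ge0 ramp_le1. Qed.

Lemma cut_eq1 L x : `|x| <= L -> cut L x = 1.
Proof. by move=> xL; apply: ramp_eq1; lra. Qed.

Lemma cut_CcR L : 0 <= L -> CcR (cut L).
Proof.
move=> L0; split.
  apply: (continuous_compR (fun x : V => L + 1 - `|x|) ramp); last exact: continuous_ramp.
  apply: continuousBR; first by move=> x; exact: cst_continuous.
  exact: norm_continuous.
apply/cpt_suppP; exists (L + 1) => [|x xL]; first by rewrite ltr_wpDl.
by apply: ramp_eq0; lra.
Qed.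

Lemma cut_unify (K : set V) (L : R) : compact K -> exists2 L', L <= L' & forall x, K x -> `|x| <= L'.
Proof.
move=> /compact_sub_ball[L1 L10 KL]; exists (Num.max L L1); first by rewrite le_max lexx.
by move=> x /KL xL; rewrite le_max xL orbT.
Qed.

Lemma mint_is_unique nu g (c c' : C) : mint_is nu g c -> mint_is nu g c' -> c = c'.
Proof.
move=> gc gc'; apply/subr0_eq/cnorm_eq0/le_anti; rewrite cnorm_ge0 andbT.
apply/ler_addgt0Pr => e e0; rewrite add0r.
have e20 : 0 < e / 2 by rewrite divr_gt0.
have [K [cK KP]] := gc _ e20; have [K' [cK' KP']] := gc' _ e20.
have [L L0 KL] := cut_unify K 0 cK; have [L' LL' KL'] := cut_unify K' L cK'.
have hc := cut_CcR L' (le_trans L0 LL').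
have h1 x : K x -> cut L' x = 1 by move=> /KL xL; apply/cut_eq1/(le_trans xL).
have h1' x : K' x -> cut L' x = 1 by move=> /KL' xL; exact: cut_eq1.
rewrite (le_trans (cdist_triangle (nu (fun x => (cut L' x)%:C%C * g x)) _ _))// (splitr e) lerD//.
  by rewrite cdistC; apply: KP => //; exact: cut01.
by apply: KP' => //; exact: cut01.
Qed.

Lemma Cc_cutM h g : CcR h -> ccont g -> Cc (fun x => (h x)%:C%C * g x).
Proof.
move=> hc cg; have := CcMl g _ cg (Cc_CcR _ hc).
by congr Cc; apply/funext => x; rewrite mulrC.
Qed.

Lemma amalg_cut_diff g B (e : R) : ccont g -> amalg (fun x => cnorm (g x)) B -> 0 < e ->
  exists2 L : R, 0 < L & forall h h', CcR h -> CcR h' ->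
    (forall x, 0 <= h x <= 1) -> (forall x, 0 <= h' x <= 1) ->
    (forall x, `|x| <= L -> h x = 1) -> (forall x, `|x| <= L -> h' x = 1) ->
    amalg (fun x => cnorm ((h x)%:C%C * g x - (h' x)%:C%C * g x)) e.
Proof.
move=> cg gB e0.
have [L L0 LP] := amalg_tail _ _ e (fun x => cnorm_ge0 (g x)) gB e0.
exists L => // h h' _ _ h0 h'0 h1 h'1; apply: LP => [x|x xL]; last first.
  by rewrite h1// h'1// subrr cnorm0.
rewrite cnorm_ge0/= -mulrBl -rmorphB cnormM cnorm_real ler_piMl ?cnorm_ge0//.
by have := h0 x; have := h'0 x; rewrite ler_norml; lra.
Qed.

Lemma mint_isP nu g (c : C) : mint_is nu g c <-> forall e : R, 0 < e -> exists2 L : R, 0 < L &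
  forall h, CcR h -> (forall x, 0 <= h x <= 1) -> (forall x, `|x| <= L -> h x = 1) ->
    cnorm (nu (fun x => (h x)%:C%C * g x) - c) <= e.
Proof.
split=> gc e e0.
  have [K [cK KP]] := gc e e0; have [L L0 KL] := compact_sub_ball _ cK.
  by exists L => // h hc h0 h1; apply: KP => // x /KL; exact: h1.
have [L L0 LP] := gc e e0; exists [set x | `|x| <= L].
by split; [exact: compact_ballV|exact: LP].
Qed.

Lemma real_cauchy_lim (u : nat -> R) :
  (forall e : R, 0 < e -> exists N, forall m n, (N <= m)%N -> (N <= n)%N -> `|u m - u n| <= e) ->
  exists c, forall e : R, 0 < e -> exists N, forall n, (N <= n)%N -> `|u n - c| <= e.
Proof.
move=> H; have : cvg (u n @[n --> \oo]).
  apply/cauchy_cvgP/cauchy_exP => e e0.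
  have e20 : 0 < e / 2 by rewrite divr_gt0.
  have [N NP] := H _ e20; exists (u N), N => // n /= Nn.
  rewrite -ball_normE /=; apply: (le_lt_trans (NP N n (leqnn N) Nn)).
  by rewrite ltr_pdivrMr// ltr_pMr// ltr1n.
move=> /cvg_ex[c /cvgrPdist_le cP]; exists c => e /cP[N _ NP]; exists N => n Nn.
by rewrite distrC; exact: NP.
Qed.

Lemma cauchy_lim (u : nat -> C) :
  (forall e : R, 0 < e -> exists N, forall m n, (N <= m)%N -> (N <= n)%N -> cnorm (u m - u n) <= e) ->
  exists c, forall e : R, 0 < e -> exists N, forall n, (N <= n)%N -> cnorm (u n - c) <= e.
Proof.
move=> H.
have [|a aP] := real_cauchy_lim (fun n => complex.Re (u n)).
  move=> e /H[N NP]; exists N => m n Nm Nn.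
  by rewrite (le_trans _ (NP m n Nm Nn))// -ReN -ReD normr_Re_cnorm.
have [|b bP] := real_cauchy_lim (fun n => complex.Im (u n)).
  move=> e /H[N NP]; exists N => m n Nm Nn.
  by rewrite (le_trans _ (NP m n Nm Nn))// -ImN -ImD normr_Im_cnorm.
exists (a +i* b)%C => e e0; have e20 : 0 < e / 2 by rewrite divr_gt0.
have [N NP] := aP _ e20; have [N' NP'] := bP _ e20; exists (maxn N N') => n.
rewrite geq_max => /andP[/NP an /NP' bn].
by rewrite (le_trans (cnorm_ReIm _))// ReD ImD ReN ImN (splitr e) lerD.
Qed.

(** The radius [L] is chosen before [nu]: it depends on the tail of [g] and on [M] only. This
    uniformity permits the exchange of limits in [mint_limit]. *)
Lemma wb_cut (M : R) g B (e : R) : 0 <= M -> ccont g -> amalg (fun x => cnorm (g x)) B -> 0 < e ->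
  exists2 L : R, 0 < L & forall nu h h', wb nu M -> CcR h -> CcR h' ->
    (forall x, 0 <= h x <= 1) -> (forall x, 0 <= h' x <= 1) ->
    (forall x, `|x| <= L -> h x = 1) -> (forall x, `|x| <= L -> h' x = 1) ->
    cnorm (nu (fun x => (h x)%:C%C * g x) - nu (fun x => (h' x)%:C%C * g x)) <= e.
Proof.
move=> M0 cg gB e0; have M1 : 0 < M + 1 by rewrite ltr_wpDl.
have [|L L0 LP] := amalg_cut_diff _ _ (e / (M + 1)) cg gB; first by rewrite divr_gt0.
exists L => // nu h h' [lnu nuM] hc hc' h0 h0' h1 h1'.
have hgc := Cc_cutM _ _ hc cg; have hgc' := Cc_cutM _ _ hc' cg.
rewrite -Cc_linearB//.
rewrite (le_trans (nuM _ _ (CcB _ _ hgc hgc') (LP _ _ hc hc' h0 h0' h1 h1')))//.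
by rewrite mulrCA ler_piMr ?(ltW e0)// ler_pdivrMr// mul1r lerDl.
Qed.

Lemma mint_exists nu (M : R) g B : 0 <= M -> wb nu M -> ccont g ->
  amalg (fun x => cnorm (g x)) B -> exists c, mint_is nu g c.
Proof.
move=> M0 nuM cg gB.
pose u n := nu (fun x => (cut n%:R x)%:C%C * g x).
have cutc n : CcR (cut n%:R) by exact: cut_CcR.
have key e : 0 < e -> exists N : nat, exists2 L : R, 0 < L & forall h n, CcR h -> (forall x, 0 <= h x <= 1) ->
    (forall x, `|x| <= L -> h x = 1) -> (N <= n)%N -> cnorm (nu (fun x => (h x)%:C%C * g x) - u n) <= e.
  move=> e0; have [L L0 LP] := wb_cut _ _ _ _ M0 cg gB e0.
  exists (Num.bound L); exists L => // h n hc h0 h1 Ln.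
  apply: LP => // [x|x xL]; first exact: cut01.
  apply: cut_eq1; rewrite (le_trans xL)// (le_trans (ltW (archi_boundP (ltW L0))))//.
  by rewrite ler_nat.
have [|c cP] := cauchy_lim u.
  move=> e /key[N [L L0 NP]]; exists (maxn N (Num.bound L)) => m n.
  rewrite !geq_max => /andP[Nm Lm] /andP[Nn Ln]; apply: NP => // [x|x xL]; first exact: cut01.
  apply: cut_eq1; rewrite (le_trans xL)// (le_trans (ltW (archi_boundP (ltW L0))))//.
  by rewrite ler_nat.
exists c; apply/mint_isP => e e0; have e20 : 0 < e / 2 by rewrite divr_gt0.
have [N [L L0 NP]] := key _ e20; have [N' NP'] := cP _ e20.
exists L => // h hc h0 h1.
rewrite (le_trans (cdist_triangle (u (maxn N N')) _ _))// (splitr e) lerD//.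
  by apply: NP => //; exact: leq_maxl.
by apply: NP'; exact: leq_maxr.
Qed.

Lemma mint_cut (M : R) g B (e : R) : 0 <= M -> ccont g -> amalg (fun x => cnorm (g x)) B -> 0 < e ->
  exists2 L : R, 0 < L & forall nu c h, wb nu M -> mint_is nu g c -> CcR h ->
    (forall x, 0 <= h x <= 1) -> (forall x, `|x| <= L -> h x = 1) ->
    cnorm (nu (fun x => (h x)%:C%C * g x) - c) <= e.
Proof.
move=> M0 cg gB e0; have [L L0 LP] := wb_cut _ _ _ _ M0 cg gB e0.
exists L => // nu c h nuM /mint_isP nuc hc h0 h1; apply/ler_addgt0Pr => e' e'0.
have [L' L'0 LP'] := nuc _ e'0.
have mc : CcR (cut (Num.max L L')) by apply: cut_CcR; rewrite le_max ltW.
have m1 x : `|x| <= L -> cut (Num.max L L') x = 1.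
  by move=> xL; apply: cut_eq1; rewrite le_max xL.
have m1' x : `|x| <= L' -> cut (Num.max L L') x = 1.
  by move=> xL; apply: cut_eq1; rewrite le_max xL orbT.
rewrite (le_trans (cdist_triangle (nu (fun x => (cut (Num.max L L') x)%:C%C * g x)) _ _))// lerD//.
  by apply: LP => //; exact: cut01.
by apply: LP' => //; exact: cut01.
Qed.

Lemma mint_lin nu (a : C) g g' c c' : Cc_linear nu -> ccont g -> ccont g' ->
  mint_is nu g c -> mint_is nu g' c' -> mint_is nu (fun x => a * g x + g' x) (a * c + c').
Proof.
move=> lnu cg cg' /mint_isP gc /mint_isP gc'; apply/mint_isP => e e0.
have a1 : 0 < cnorm a + 1 by rewrite ltr_wpDl ?cnorm_ge0.
have [|L L0 LP] := gc (e / (2 * (cnorm a + 1))); first by rewrite divr_gt0 ?mulr_gt0.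
have [|L' L'0 LP'] := gc' (e / 2); first by rewrite divr_gt0.
exists (Num.max L L') => [|h hc h0 h1]; first by rewrite lt_max L0.
have hgc := Cc_cutM _ _ hc cg; have hgc' := Cc_cutM _ _ hc cg'.
rewrite (_ : (fun x => _ * _) = fun x => a * ((h x)%:C%C * g x) + (h x)%:C%C * g' x); last first.
  by apply/funext => x; ring.
rewrite lnu// opprD addrACA -mulrBr (splitr e) (le_trans (cnormD _ _))// lerD//.
  rewrite cnormM (@le_trans _ _ (cnorm a * (e / (2 * (cnorm a + 1)))))//.
    rewrite ler_wpM2l ?cnorm_ge0//; apply: LP => // x xL.
    by apply: h1; rewrite le_max xL.
  rewrite [leRHS](_ : _ = (cnorm a + 1) * (e / (2 * (cnorm a + 1)))); last by field; lra.
  by rewrite ler_wpM2r ?lerDl// divr_ge0 ?mulr_ge0 ?ltW.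
by apply: LP' => // x xL; apply: h1; rewrite le_max xL orbT.
Qed.

Lemma mint0 nu : Cc_linear nu -> mint_is nu (fun=> 0) 0.
Proof.
move=> lnu; apply/mint_isP => e e0; exists 1 => // h hc h0 h1.
rewrite (_ : (fun x => _ * _) = fun=> 0) ?Cc_linear0// ?subr0 ?cnorm0 ?ltW//.
by apply/funext => x; rewrite mulr0.
Qed.

Lemma mintD nu g g' c c' : Cc_linear nu -> ccont g -> ccont g' ->
  mint_is nu g c -> mint_is nu g' c' -> mint_is nu (fun x => g x + g' x) (c + c').
Proof.
move=> lnu cg cg' gc gc'; have := mint_lin _ 1 _ _ _ _ lnu cg cg' gc gc'.
by rewrite mul1r (eq_fun (fun x => congr1 (fun z => z + g' x) (mul1r (g x)))).
Qed.

Lemma mintZ nu (a : C) g c : Cc_linear nu -> ccont g ->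
  mint_is nu g c -> mint_is nu (fun x => a * g x) (a * c).
Proof.
move=> lnu cg gc; have := mint_lin _ a _ _ _ _ lnu cg (ccont_cst 0) gc (mint0 _ lnu).
by rewrite addr0 (eq_fun (fun x => addr0 (a * g x))).
Qed.

Lemma mintB nu g g' c c' : Cc_linear nu -> ccont g -> ccont g' ->
  mint_is nu g c -> mint_is nu g' c' -> mint_is nu (fun x => g x - g' x) (c - c').
Proof.
move=> lnu cg cg' gc gc'; have := mint_lin _ (-1) _ _ _ _ lnu cg' cg gc' gc.
rewrite mulN1r addrC (_ : (fun x => _) = fun x => g x - g' x)//.
by apply/funext => x; rewrite mulN1r addrC.
Qed.

Lemma mint_sum nu (I : finType) (F : I -> V -> C) (c : I -> C) : Cc_linear nu ->
  (forall i, ccont (F i)) -> (forall i, mint_is nu (F i) (c i)) ->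
  mint_is nu (fun x => \sum_i F i x) (\sum_i c i).
Proof.
move=> lnu cF Fc.
suff : forall s : seq I, ccont (fun x => \sum_(i <- s) F i x) /\
    mint_is nu (fun x => \sum_(i <- s) F i x) (\sum_(i <- s) c i) by move=> /(_ (index_enum I))[].
elim=> [|i s [cs IH]].
  rewrite (eq_fun (fun x => big_nil _ _ _ _)) big_nil; split; first exact: ccont_cst.
  exact: mint0.
rewrite (eq_fun (fun x => big_cons _ _ _ _ _ _)) big_cons /=.
by split; [exact: ccontD|exact: mintD].
Qed.

Lemma mint_Cc nu g : Cc g -> mint_is nu g (nu g).
Proof.
move=> gc; have [L L0 gL] := Cc_bounded_supp _ gc; apply/mint_isP => e e0.
exists L => // h hc h0 h1; rewrite (_ : (fun x => _) = g) ?subrr ?cnorm0 ?ltW//.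
apply/funext => x; have [xL|/gL ->] := leP `|x| L; last by rewrite mulr0.
by rewrite h1// mul1r.
Qed.

Lemma mint_bound nu (M : R) g c B : wb nu M -> ccont g ->
  mint_is nu g c -> amalg (fun x => cnorm (g x)) B -> cnorm c <= M * B.
Proof.
move=> [lnu nuM] cg /mint_isP gc gB; apply/ler_addgt0Pr => e e0.
have [L L0 LP] := gc e e0; have hc := cut_CcR L (ltW L0).
have Lc := LP _ hc (cut01 L) (fun x => cut_eq1 L x).
rewrite -(subKr (nu (fun x => (cut L x)%:C%C * g x)) c) (le_trans (cnormD _ _))// cnormN lerD//.
apply: nuM; first exact: Cc_cutM.
apply: (amalg_le _ _ _ _ gB) => x; rewrite cnorm_realM; last by have /andP[] := cut01 L x.
by rewrite ler_piMl ?cnorm_ge0//; have /andP[] := cut01 L x.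
Qed.

Lemma mint_dist nu (M : R) g g' c c' B : wb nu M -> ccont g -> ccont g' ->
  mint_is nu g c -> mint_is nu g' c' -> amalg (fun x => cnorm (g x - g' x)) B ->
  cnorm (c - c') <= M * B.
Proof.
move=> nuM cg cg' gc gc' gB; apply: (mint_bound nu M (fun x => g x - g' x)) => //.
  exact: ccontB.
by apply: mintB => //; case: nuM.
Qed.

Lemma mint_trans nu (t : V) g c : mint_is (trans nu t) g c -> mint_is nu (fun x => g (x - t)) c.
Proof.
move=> /mint_isP gc; apply/mint_isP => e e0; have [L L0 LP] := gc e e0.
exists (L + `|t|) => [|h [ch /cpt_suppP[L' L'0 hL']] h0 h1]; first by rewrite ltr_wpDr.
have := LP (fun x => h (x + t)).
rewrite /trans (_ : (fun x => (h (x - t + t))%:C%C * g (x - t)) = fun x => (h x)%:C%C * g (x - t)); last first.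
  by apply/funext => x; rewrite subrK.
apply.
- split.
    have [cs _] := ccont_shift _ (- t) (ccont_real _ ch).
    by move: cs; under eq_fun do rewrite opprK.
  apply/cpt_suppP; exists (L' + `|t|) => [|x xL]; first by rewrite ltr_wpDr.
  by apply: hL'; rewrite -(ltrD2r `|t|) (lt_le_trans xL)// -{1}(addrK t x) ler_normB.
- by move=> x; exact: h0.
- by move=> x xL; apply: h1; rewrite (le_trans (ler_normD _ _))// lerD2r.
Qed.

(** Only convergence on [Cc] functions is assumed. By [mint_cut] one cut-off approximates all the
    integrals against [nu_ n] within [e / 3], and for that fixed cut-off the integrand is compactly
    supported. *)
Lemma mint_limit (nu_ : nat -> (V -> C) -> C) nu (M : R) g B (c_ : nat -> C) c : 0 <= M ->
  (forall n, wb (nu_ n) M) -> ccont g -> amalg (fun x => cnorm (g x)) B ->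
  (forall f, Cc f -> forall e : R, 0 < e -> exists N, forall n, (N <= n)%N ->
     cnorm (nu_ n f - nu f) <= e) ->
  (forall n, mint_is (nu_ n) g (c_ n)) ->
  (forall e : R, 0 < e -> exists N, forall n, (N <= n)%N -> cnorm (c_ n - c) <= e) ->
  mint_is nu g c.
Proof.
move=> M0 nuM cg gB nuc gc cc; apply/mint_isP => e e0.
have e30 : 0 < e / 3 by rewrite divr_gt0.
have [L L0 LP] := mint_cut _ _ _ _ M0 cg gB e30; exists L => // h hc h0 h1.
have [N NP] := nuc _ (Cc_cutM _ _ hc cg) _ e30; have [N' NP'] := cc _ e30.
pose n := maxn N N'.
have H1 := NP n (leq_maxl _ _); have H2 := NP' n (leq_maxr _ _).
have H3 := LP _ _ _ (nuM n) (gc n) hc h0 h1.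
have := cdist_triangle (nu_ n (fun x => (h x)%:C%C * g x)) (nu (fun x => (h x)%:C%C * g x)) c.
have := cdist_triangle (c_ n) (nu_ n (fun x => (h x)%:C%C * g x)) c.
rewrite cdistC in H1; lra.
Qed.

End TranslationBounded.

(** * Decay of transforms from second differences *)

Section Decay.
Context {R : realType} {d : nat}.
Local Notation V := 'rV[R]_d.
Local Notation C := R[i].
Implicit Types (f g : V -> C).

Definition D2 (i : 'I_d) (h : R) f (x : V) : C :=
  f (x + h *: ebase i) + f (x - h *: ebase i) - 2 * f x.

Fixpoint DD (h : 'I_d -> R) (s : seq 'I_d) f : V -> C :=
  if s is i :: s' then DD h s' (D2 i (h i) f) else f.

Lemma D2E i h f :
  D2 i h f = fun x => (f (x - - (h *: ebase i)) + f (x - h *: ebase i)) - 2 * f x.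
Proof. by apply/funext => x; rewrite opprK. Qed.

Lemma cdom_D2 i h M f : cdom M f -> exists N, cdom N (D2 i h f).
Proof.
move=> fM; have f1 := cdom_shift _ _ (- (h *: ebase i)) fM.
have f2 := cdom_shift _ _ (h *: ebase i) fM.
by rewrite D2E; eexists; exact: cdomB (cdomD _ _ _ _ f1 f2) (cdomZ 2 _ _ fM).
Qed.

Lemma dotv_ebase (y : V) h i : dotv (h *: ebase i) y = h * y 0 i.
Proof.
rewrite /dotv (bigD1 i)//= !mxE eqxx mulr1 big1 ?addr0// => j ji.
by rewrite !mxE (negPf ji) mulr0 mul0r.
Qed.

(** The multiplier is [2 cos (2 pi h y_i) - 2]. It takes its extreme value [-4] when
    [h |y_i| = 1/2], the step used in [icheck_DD]. *)
Lemma icheck_D2 i h M f (y : V) : cdom M f ->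
  icheck (D2 i h f) y = (expi (2 * pi * (h * y 0 i)) + expi (- (2 * pi * (h * y 0 i))) - 2) * icheck f y.
Proof.
move=> fM; have f1 := cdom_shift _ _ (- (h *: ebase i)) fM.
have f2 := cdom_shift _ _ (h *: ebase i) fM.
rewrite D2E (icheckB _ _ _ _ _ (cdomD _ _ _ _ f1 f2) (cdomZ 2 _ _ fM)).
rewrite (icheckD _ _ _ _ _ f1 f2) (icheckZ _ _ _ _ fM) !(icheck_shift _ _ _ _ fM).
rewrite eeNr /ee dotv_ebase expiN; ring.
Qed.

Lemma icheck_DD h s M f (y : V) : cdom M f ->
  (forall i, i \in s -> h i * `|y 0 i| = 2^-1) ->
  exists N, cdom N (DD h s f) /\ icheck (DD h s f) y = (- 4) ^+ size s * icheck f y.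
Proof.
elim: s M f => [|i s IH] M f fM hy /=; first by exists M; rewrite expr0 mul1r.
have [N fN] := cdom_D2 i (h i) _ _ fM.
have [j js|N' [gN' ->]] := IH N _ fN; first by apply: hy; rewrite inE js orbT.
exists N'; split=> //; rewrite (icheck_D2 _ _ _ _ _ fM).
suff -> : expi (2 * pi * (h i * y 0 i)) + expi (- (2 * pi * (h i * y 0 i))) - 2 = - 4.
  by rewrite exprSr mulrA.
have hi := hy i (mem_head _ _).
have pihalf : 2 * pi * 2^-1 = pi :> R by field.
rewrite expiN; have [yi|yi] := leP 0 (y 0 i).
  rewrite ger0_norm// in hi; rewrite hi pihalf /expi cospi sinpi.
  by apply: complex_ext; rewrite !(ReD,ImD,ReN,ImN)/=; lra.
rewrite ltr0_norm// mulrN in hi.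
rewrite (_ : h i * y 0 i = - 2^-1); last by rewrite -hi opprK.
rewrite mulrN pihalf expiN /expi cospi sinpi.
by apply: complex_ext; rewrite !(ReD,ImD,ReN,ImN)/=; lra.
Qed.

(** Schwartz functions satisfy this by the mean value theorem ([rDD_bound]), and [wt] by direct
    computation ([delta2_qw]); [icheck_decay] then covers both. *)
Definition DDbound (K : R) f (s : seq 'I_d) := forall h : 'I_d -> R, (forall i, 0 <= h i <= 1) ->
  forall x, cnorm (DD h s f x) <= K * \prod_(i <- s) (8 * h i ^+ 2) * wt x.

(** Differences are taken only in the coordinates with [|y_i| >= 1], with step [1 / (2 |y_i|)]: each
    gains a factor 4 on the transform and costs [8 h_i^2 = 2 / y_i^2]. In every other coordinate
    [qw] is at least [1/2], so a factor 2 per coordinate suffices in all cases, whence [2 ^+ d]. *)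
Lemma icheck_decay M K f : cdom M f -> 0 <= K ->
  (forall A : {set 'I_d}, DDbound K f (enum A)) ->
  forall y, cnorm (icheck f y) <= 2 * (K * Lam (R:=R) (d:=d)) * 2 ^+ d * wt y.
Proof.
move=> fM K0 fK y.
pose A : {set 'I_d} := finset (fun i => 1 <= `|y 0 i|).
have inA i : (i \in enum A) = (1 <= `|y 0 i|) by rewrite mem_enum inE.
pose h i : R := if 1 <= `|y 0 i| then (2 * `|y 0 i|)^-1 else 0.
have h01 i : 0 <= h i <= 1.
  rewrite /h; case: ifP => [yi|_]; last by rewrite lexx ler01.
  by rewrite invr_ge0 mulr_ge0//= invf_le1; lra.
have [|N [DN E]] := icheck_DD h (enum A) _ _ y fM.
  move=> i; rewrite inA /h => yi; rewrite yi; field; lra.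
have DK : cdom (K * \prod_(i <- enum A) (8 * h i ^+ 2)) (DD h (enum A) f).
  by case: DN => cD _; split=> // x; exact: fK.
have := icheck_bound _ _ y DK; rewrite E cnormM.
have -> : cnorm ((- 4 : C) ^+ size (enum A)) = 4 ^+ size (enum A).
  elim: (size _) => [|n IH]; first by rewrite !expr0 cnorm1.
  by rewrite !exprS cnormM IH cnormN (_ : (4 : C) = 4%:C%C) ?cnorm_real ?ger0_norm// rmorph_nat.
move=> H; have S0 : 0 < 4 ^+ size (enum A) :> R by rewrite exprn_gt0.
rewrite -(ler_pM2l S0) (le_trans H)//.
have L0 := Lam_ge0 (R:=R) (d:=d); move: L0; set LL := Lam => L0.
rewrite [leRHS](_ : _ = 2 * (K * LL) * (4 ^+ size (enum A) * (2 ^+ d * wt y))); last ring.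
rewrite [leLHS](_ : _ = 2 * (K * LL) * \prod_(i <- enum A) (8 * h i ^+ 2)); last ring.
rewrite ler_wpM2l ?mulr_ge0//.
rewrite -[X in 2 ^+ X](card_ord d) -prodr_const -big_split /=.
have -> : 4 ^+ size (enum A) = \prod_(i < d) (if 1 <= `|y 0 i| then 4 else 1) :> R.
  rewrite -cardE -prodr_const big_mkcond /=; apply: eq_bigr => i _.
  by rewrite inE.
rewrite -big_split /= big_filter.
rewrite big_mkcond /= -[X in X <= _]/(\prod_(i < d) _).
apply: ler_prod => i _; rewrite inE /h.
case: ifP => yi; last first.
  rewrite ler01 mul1r /qw /= ler_pdivlMr ?one_sqr_gt0// mul1r.
  have y1 : `|y 0 i| <= 1 by rewrite leNgt; apply/negP => /ltW; rewrite yi.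
  have : y 0 i ^+ 2 <= 1 by rewrite -(real_normK (num_real (y 0 i))) -[1](expr1n _ 2) lerXn2r ?nnegrE.
  lra.
rewrite yi mulr_ge0 ?sqr_ge0//= exprVn exprMn (real_normK (num_real (y 0 i))).
have y2 : 1 <= y 0 i ^+ 2 by rewrite -(real_normK (num_real (y 0 i))) -[1](expr1n _ 2) lerXn2r ?nnegrE// ltW.
move: (y 0 i) y2; clear => t y2.
rewrite /qw (_ : 4 * (2 / (1 + t ^+ 2)) = 8 / (1 + t ^+ 2)); last by field; lra.
rewrite ler_wpM2l// lef_pV2 ?posrE; lra.
Qed.

End Decay.

(** * The large sieve inequality *)

Section LargeSieve.
Context {R : realType} {d : nat}.
Local Notation V := 'rV[R]_d.
Local Notation C := R[i].

Definition delta2 (h : R) (b : R -> R) (t : R) : R := b (t + h) + b (t - h) - 2 * b t.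

(** The second difference is an explicit fraction. Its numerator is controlled because the product
    [P] of the two shifted denominators dominates both [1 + t^2] and [1 + h^2]. *)
Lemma delta2_qw h t : `|delta2 h qw t| <= 8 * h ^+ 2 * qw t.
Proof.
rewrite /delta2 /qw.
have a1 : 0 < 1 + (t + h) ^+ 2 by exact: one_sqr_gt0.
have a2 : 0 < 1 + (t - h) ^+ 2 by exact: one_sqr_gt0.
have a3 : 0 < 1 + t ^+ 2 by exact: one_sqr_gt0.
rewrite (_ : _ - _ = (2 * h ^+ 2 * (3 * t ^+ 2 - 1 - h ^+ 2)) /
  ((1 + (t + h) ^+ 2) * (1 + (t - h) ^+ 2) * (1 + t ^+ 2))); last by field; lra.
have D1 : 1 + t ^+ 2 <= (1 + (t + h) ^+ 2) * (1 + (t - h) ^+ 2).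
  by have := sqr_ge0 (t ^+ 2 - h ^+ 2); have := sqr_ge0 t; have := sqr_ge0 h; nra.
have D2 : 1 + h ^+ 2 <= (1 + (t + h) ^+ 2) * (1 + (t - h) ^+ 2).
  by have := sqr_ge0 (t ^+ 2 - h ^+ 2); have := sqr_ge0 t; have := sqr_ge0 h; nra.
set P := _ * (1 + (t - h) ^+ 2) in D1 D2 *.
have P0 : 0 < P by rewrite mulr_gt0.
rewrite normrM normfV [X in _ / X]ger0_norm ?mulr_ge0 ?(ltW P0) ?(ltW a3) ?(ltW a1) ?(ltW a2)//.
rewrite ler_pdivrMr ?mulr_gt0// [leRHS](_ : _ = 2 * h ^+ 2 * (4 * P)); last by field; lra.
have h2 : 0 <= 2 * h ^+ 2 by rewrite mulr_ge0 ?sqr_ge0.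
rewrite normrM (ger0_norm h2) ler_wpM2l//.
by have := sqr_ge0 t; have := sqr_ge0 h; rewrite ler_norml; lra.
Qed.

Lemma D2_prod (i : 'I_d) (h : R) (b : 'I_d -> R -> R) :
  D2 i h (fun x : V => (\prod_j b j (x 0 j))%:C%C) =
  fun x => (\prod_j (if j == i then delta2 h (b j) else b j) (x 0 j))%:C%C.
Proof.
apply/funext => x; rewrite /D2 (_ : 2 = (2 : R)%:C%C); last by rewrite rmorph_nat.
rewrite -!rmorphM -rmorphD -rmorphB; congr (_%:C%C).
have E (t : R) : \prod_j b j ((x + t *: ebase i) 0 j) = b i (x 0 i + t) * \prod_(j < d | j != i) b j (x 0 j).
  rewrite (bigD1 i)//= !mxE eqxx mulr1; congr (_ * _).
  by apply: eq_bigr => j ji; rewrite !mxE (negPf ji) mulr0 addr0.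
have E0 : \prod_j b j (x 0 j) = b i (x 0 i) * \prod_(j < d | j != i) b j (x 0 j) by rewrite (bigD1 i).
rewrite -scaleNr !E E0 [RHS](bigD1 i)//= eqxx.
rewrite [in RHS](eq_bigr (fun j => b j (x 0 j))) => [|j ji]; last by rewrite (negPf ji).
rewrite /delta2; ring.
Qed.

Lemma DD_prod (h : 'I_d -> R) (s : seq 'I_d) (b : 'I_d -> R -> R) : uniq s ->
  DD h s (fun x : V => (\prod_j b j (x 0 j))%:C%C) =
  fun x => (\prod_j (if j \in s then delta2 (h j) (b j) else b j) (x 0 j))%:C%C.
Proof.
elim: s b => [//|i s IH] b /= /andP[iS us].
rewrite D2_prod (IH (fun j => if j == i then delta2 (h i) (b j) else b j))//; apply/funext => x; congr (_%:C%C); apply: eq_bigr => j _.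
rewrite inE; have [->|ji] := eqVneq j i; first by rewrite (negPf iS).
by case: ifP.
Qed.

Lemma cdom_wt : cdom 1 (fun x : V => (wt x)%:C%C).
Proof. exact: cdom_real rdom_wt. Qed.

Lemma icheck_wt (y : V) : cnorm (icheck (fun x : V => (wt x)%:C%C) y) <=
  2 * Lam (R:=R) (d:=d) * 2 ^+ d * wt y.
Proof.
rewrite -[in leRHS](mul1r Lam); apply: (icheck_decay 1) => //; first exact: cdom_wt.
move=> A h h01 x.
rewrite (DD_prod h (enum A) (fun=> qw)) ?enum_uniq// cnorm_real normr_prod mul1r big_enum /=.
rewrite [X in _ <= X * _]big_mkcond /wt -big_split /=; apply: ler_prod => i _.
rewrite normr_ge0 mem_enum /=; case: ifP => _; first exact: delta2_qw.
by rewrite mul1r ger0_norm// qw_ge0.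
Qed.

Lemma ccont_winv (f : V -> C) : Cc f -> Cc (fun x => ((wt x)^-1)%:C%C * f x).
Proof.
move=> fc; apply: CcMl => //; apply: ccont_real => x.
exact: (cvgV (lt0r_neq0 (wt_gt0 x)) (continuous_wt x)).
Qed.

(** The expanded square for the duality argument: the weight cancels in the first three terms and
    survives only in the one quadratic in [p]. *)
Lemma weighted_square_expand (w a : R) (z p : C) : w != 0 ->
  w%:C%C * (((w^-1)%:C%C * z - a%:C%C * Num.conj p) *
            Num.conj ((w^-1)%:C%C * z - a%:C%C * Num.conj p)) =
  ((w^-1)%:C%C * z * Num.conj z + - a%:C%C * (z * p)) +
  (- a%:C%C * Num.conj (z * p) + (a ^+ 2)%:C%C * (w%:C%C * (p * Num.conj p))).
Proof.
move=> w0; case: z => z1 z2; case: p => p1 p2.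
by apply: complex_ext => /=; field.
Qed.

(** A row-sum bound for the Gram matrix: the decay constant of the transform of [wt] times the cell
    sum [32 ^+ d]. *)
Definition Csieve : R := 2 * Lam (R:=R) (d:=d) * 2 ^+ d * 32 ^+ d.

(* Duality: the sampled square sum is tested against the exponential polynomial
   with coefficients [conj (f^ (y k))], whose Gram matrix for the weight [wt]
   has bounded row sums. *)
Lemma large_sieve (f : V -> C) : Cc f ->
  amalg (fun y => cnorm (icheck f y) ^+ 2)
    ((Csieve + 1) * complex.Re (lint (fun x => ((wt x)^-1)%:C%C * f x * Num.conj (f x)))).
Proof.
move=> fc N y yc.
pose u x := ((wt x)^-1)%:C%C * f x.
have uc : Cc u := ccont_winv _ fc.
pose c k := Num.conj (icheck f (y k)).
pose P x := \sum_k c k * ee (y k) x.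
pose S := \sum_k cnorm (icheck f (y k)) ^+ 2.
have cP : ccont P by apply: ccont_sum => k; apply: ccontZ; exact: ccont_ee.
have [fM fMP] := Cc_cdom _ fc.
have fkM k : cdom (cnorm (c k) * fM) (fun x => c k * (f x * ee (y k) x)).
  by apply/cdomZ/cdom_ee.
have fPE : (fun x => f x * P x) = fun x => \sum_k c k * (f x * ee (y k) x).
  by apply/funext => x; rewrite mulr_sumr; apply: eq_bigr => k _; ring.
have SE : lint (fun x => f x * P x) = S%:C%C.
  rewrite fPE (lint_sum _ _ _ fkM) rmorph_sum /=; apply: eq_bigr => k _.
  by rewrite (lintZ _ _ _ (cdom_ee _ _ (y k) fMP)) cnorm_sqrE mulrC.
have fPM : cdom (\sum_k cnorm (c k) * fM) (fun x => f x * P x) by rewrite fPE; exact: cdom_sum fkM.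
pose Gram k l x := (c k * Num.conj (c l)) * ((wt x)%:C%C * ee (y k - y l) x).
have GM k l : cdom (cnorm (c k * Num.conj (c l)) * 1) (Gram k l).
  by apply/cdomZ/cdom_ee; exact: cdom_wt.
have QE : (fun x => (wt x)%:C%C * (P x * Num.conj (P x))) = fun x => \sum_k \sum_l Gram k l x.
  apply/funext => x; rewrite /P rmorph_sum mulr_suml mulr_sumr; apply: eq_bigr => k _.
  rewrite !mulr_sumr; apply: eq_bigr => l _.
  rewrite /Gram rmorphM /= eeDl eeNl; ring.
have QM := cdom_sum _ _ _ (fun k => cdom_sum _ _ _ (GM k)).
have QS : cnorm (lint (fun x => (wt x)%:C%C * (P x * Num.conj (P x)))) <= Csieve * S.
  rewrite QE (lint_sum _ _ _ (fun k => cdom_sum _ _ _ (GM k))).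
  rewrite (eq_bigr (fun k => \sum_l lint (Gram k l))) => [|k _]; last by rewrite (lint_sum _ _ _ (GM k)).
  pose C1 := 2 * Lam (R:=R) (d:=d) * 2 ^+ d.
  have C10 : 0 <= C1 by rewrite !mulr_ge0 ?Lam_ge0.
  rewrite (le_trans (cnorm_sum _ _))//.
  (* Schur's test: [|c_k c_l| <= (|c_k|^2 + |c_l|^2) / 2] reduces the quadratic form to row and
     column sums of [wt (y k - y l)]. *)
  apply: (@le_trans _ _ (\sum_k \sum_l (C1 / 2 * (cnorm (c k) ^+ 2 * wt (y k - y l)) +
                                        C1 / 2 * (cnorm (c l) ^+ 2 * wt (y k - y l))))).
    apply: ler_sum => k _; rewrite (le_trans (cnorm_sum _ _))//; apply: ler_sum => l _.
    rewrite (lintZ _ _ _ (cdom_ee _ _ (y k - y l) cdom_wt)) cnormM cnormM cnorm_conj.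
    have H := icheck_wt (y k - y l); rewrite icheckE -/C1 in H.
    rewrite (le_trans (ler_wpM2l (mulr_ge0 (cnorm_ge0 (c k)) (cnorm_ge0 (c l))) H))//.
    have w0 := wt_ge0 (y k - y l); have := sqr_ge0 (cnorm (c k) - cnorm (c l)).
    have Cw : 0 <= C1 * wt (y k - y l) by rewrite mulr_ge0.
    by move=> H2; have := mulr_ge0 Cw H2; lra.
  rewrite (eq_bigr (fun k => C1 / 2 * \sum_l (cnorm (c k) ^+ 2 * wt (y k - y l)) +
     C1 / 2 * \sum_l (cnorm (c l) ^+ 2 * wt (y k - y l)))) => [|k _]; last first.
    by rewrite big_split /= !mulr_sumr.
  rewrite big_split /= -!mulr_sumr [X in _ + C1 / 2 * X]exchange_big /=.
  have B0 k : \sum_l (cnorm (c k) ^+ 2 * wt (y k - y l)) <= cnorm (c k) ^+ 2 * 32 ^+ d.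
    by rewrite -mulr_sumr ler_wpM2l ?sqr_ge0// cell_sum_wt.
  have B1 l : \sum_k (cnorm (c l) ^+ 2 * wt (y k - y l)) <= cnorm (c l) ^+ 2 * 32 ^+ d.
    rewrite -mulr_sumr ler_wpM2l ?sqr_ge0// (le_trans _ (cell_sum_wt _ _ (y l) yc))//.
    by apply: ler_sum => k _; rewrite -wt_opp opprB.
  have SB : S * 32 ^+ d = \sum_k (cnorm (c k) ^+ 2 * 32 ^+ d).
    by rewrite mulr_suml; apply: eq_bigr => k _; rewrite cnorm_conj.
  have b0 : \sum_k \sum_l (cnorm (c k) ^+ 2 * wt (y k - y l)) <= S * 32 ^+ d.
    by rewrite SB; apply: ler_sum => k _; exact: B0.
  have b1 : \sum_l \sum_k (cnorm (c l) ^+ 2 * wt (y k - y l)) <= S * 32 ^+ d.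
    by rewrite SB; apply: ler_sum => k _; exact: B1.
  rewrite /Csieve -/C1.
  have C20 : 0 <= C1 / 2 by rewrite divr_ge0.
  by have := ler_wpM2l C20 b0; have := ler_wpM2l C20 b1; lra.
(* With [Q <= Csieve * S], nonnegativity of the weighted square gives [U - 2 a S + a^2 Q >= 0]; this
   [a] makes [a^2 Q <= a S], hence [a S <= U]. The added 1 keeps the denominator positive. *)
pose a : R := (Csieve + 1)^-1.
have C0 : 0 < Csieve + 1 by rewrite ltr_wpDl// !mulr_ge0 ?Lam_ge0.
have a0 : 0 < a by rewrite invr_gt0.
pose F x := u x - a%:C%C * Num.conj (P x).
pose A x := ((wt x)^-1)%:C%C * f x * Num.conj (f x).
have Ac : Cc A.
  have := CcMl u (fun x => Num.conj (f x)) (proj1 uc) (Cc_conj _ fc); exact.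
have [AM AMP] := Cc_cdom _ Ac.
have FE : (fun x => (wt x)%:C%C * (F x * Num.conj (F x))) = fun x =>
   (A x + - a%:C%C * (f x * P x)) + (- a%:C%C * Num.conj (f x * P x) +
   (a ^+ 2)%:C%C * ((wt x)%:C%C * (P x * Num.conj (P x)))).
  by apply/funext => x; apply: weighted_square_expand; rewrite gt_eqF ?wt_gt0.
have [PM PMP] : exists M, cdom M (fun x => (wt x)%:C%C * (P x * Num.conj (P x))).
  by eexists; rewrite QE; exact: QM.
pose B x := f x * P x; pose Q x := (wt x)%:C%C * (P x * Num.conj (P x)).
have d1 := cdomD _ _ _ _ AMP (cdomZ (- a%:C%C) _ _ fPM).
have d2 := cdomD _ _ _ _ (cdomZ (- a%:C%C) _ _ (cdom_conj _ _ fPM)) (cdomZ (a ^+ 2)%:C%C _ _ PMP).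
have FM := cdomD _ _ _ _ d1 d2; rewrite -FE in FM.
have Fpos : 0 <= complex.Re (lint (fun x => (wt x)%:C%C * (F x * Num.conj (F x)))).
  rewrite lintE /=; apply: (rlint_ge0 _ _ (cdom_Re _ _ FM)) => x.
  by rewrite -cnorm_sqrE -rmorphM /= mulr_ge0 ?wt_ge0 ?sqr_ge0.
move: Fpos; rewrite FE (lintD _ _ _ _ d1 d2).
rewrite (lintD _ _ _ _ AMP (cdomZ (- a%:C%C) _ _ fPM)).
rewrite (lintD _ _ _ _ (cdomZ (- a%:C%C) _ _ (cdom_conj _ _ fPM)) (cdomZ (a ^+ 2)%:C%C _ _ PMP)).
rewrite (lintZ _ _ _ fPM) (lintZ _ _ _ (cdom_conj _ _ fPM)) (lintZ _ _ _ PMP) (lint_conj _ _ fPM) SE.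
have QR := le_trans (ler_norm _) (le_trans (normr_Re_cnorm _) QS).
rewrite !(ReD, ReM, ReN, ImN)/=.
move: (complex.Re (lint (fun x => (wt x)%:C%C * _))) QR => q QR.
move: (complex.Re _) => U; rewrite !(mul0r, mulr0, oppr0, subr0, sub0r) -/S => H.
have S0 : 0 <= S by apply: sumr_ge0 => k _; exact: sqr_ge0.
have aC : a * (Csieve + 1) = 1 by rewrite mulVf// gt_eqF.
rewrite -(ler_pM2l a0) mulrA aC mul1r.
have : a ^+ 2 * q <= a * S.
  rewrite expr2 -mulrA (ler_wpM2l (ltW a0))// (le_trans (ler_wpM2l (ltW a0) QR))//.
  by rewrite mulrA ler_piMl// -aC ler_wpM2l ?(ltW a0)// lerDl.
lra.
Qed.

End LargeSieve.

(** * Convolution, polarization and approximate identities *)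

Section Convolution.
Context {R : realType} {d : nat}.
Local Notation V := 'rV[R]_d.
Local Notation C := R[i].
Local Notation conv := Defs.conv.
Implicit Types (f g : V -> C) (mu nu : (V -> C) -> C).

(** Dominated convergence for the amalgam norm: domination by [G] everywhere, together with relative
    smallness on a large ball, makes the norm small. The later passages to the limit under a measure
    rest on it. *)
Lemma amalg_small (G : V -> R) B (e : R) : (forall x, 0 <= G x) -> amalg G B -> 0 < e ->
  exists2 L : R, 0 < L & exists2 D : R, 0 < D & forall h : V -> R,
    (forall x, 0 <= h x <= G x) -> (forall x, `|x| <= L -> h x <= D * G x) -> amalg h e.
Proof.
move=> G0 GB e0; have B0 := amalg_ge0 _ _ G0 GB.
have e20 : 0 < e / 2 by rewrite divr_gt0.
have [L L0 LP] := amalg_tail _ _ _ G0 GB e20.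
exists L => //; exists (e / (2 * (B + 1))); first by rewrite divr_gt0// mulr_gt0// ltr_wpDl.
move=> h hG hD; pose h1 x := if `|x| <= L then 0 else h x.
apply: (amalg_le _ (fun x => e / (2 * (B + 1)) * G x + h1 x)).
  move=> x; rewrite /h1; case: ifP => [/hD|_]; first by rewrite addr0.
  by rewrite lerDr mulr_ge0// divr_ge0 ?ltW// mulr_gt0// ltr_wpDl.
apply: (amalg_leB _ (e / (2 * (B + 1)) * B + e / 2)).
  rewrite [leRHS](splitr e) lerD2r [leRHS](_ : _ = e / (2 * (B + 1)) * (B + 1)); last by field; lra.
  by rewrite ler_wpM2l ?lerDl// divr_ge0 ?ltW// mulr_gt0// ltr_wpDl.
apply: amalgD; first by apply: amalgZ => //; rewrite divr_ge0 ?ltW// mulr_gt0// ltr_wpDl.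
apply: LP => [x|x xL]; last by rewrite /h1 xL.
by rewrite /h1; case: ifP => _; [rewrite lexx G0|exact: hG].
Qed.

Lemma cdom_conv M g f (x : V) : cdom M f -> Cc g -> exists N, cdom N (fun y => f y * g (x - y)).
Proof.
move=> fM gc; have [B B0 gB] := Cc_bounded _ gc.
exists (B * M); apply: cdomMb => //; have [cg _] := gc.
apply: (ccont_isometry (fun y => x - y)) cg => y z.
by rewrite opprB addrC addrA subrK distrC.
Qed.

Lemma conv_supp f g (L K : R) : (forall x, L < `|x| -> f x = 0) ->
  (forall x, K < `|x| -> g x = 0) -> forall x, L + K < `|x| -> conv f g x = 0.
Proof.
move=> fL gK x xLK; rewrite /conv (_ : (fun y => _) = fun=> 0) ?lint0//.
apply/funext => y; have [yL|/fL ->] := leP `|y| L; last by rewrite mul0r.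
rewrite gK ?mulr0// -(ltrD2l L) (lt_le_trans xLK)//.
by rewrite -{1}(subrK y x) addrC (le_trans (ler_normD _ _))// lerD2r.
Qed.

Lemma Cc_conv f g : Cc f -> Cc g -> Cc (conv f g).
Proof.
move=> fc gc; have [L L0 fL] := Cc_bounded_supp _ fc; have [K K0 gK] := Cc_bounded_supp _ gc.
apply: (CcI _ (L + K)); [by rewrite addr_gt0| |exact: conv_supp].
have [M fM] := Cc_cdom _ fc; have M0 := cdom_ge0 _ _ fM.
apply/ccont_edP => x e e0.
pose c := 2 * (M * Lam (R:=R) (d:=d)) + 1.
have c0 : 0 < c by rewrite ltr_wpDl// !mulr_ge0 ?Lam_ge0.
have [D D0 DP] := Cc_uniform_continuous _ gc (e / c) (divr_gt0 e0 c0).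
exists D => // y xy.
have [N1 H1] := cdom_conv _ _ _ x fM gc; have [N2 H2] := cdom_conv _ _ _ y fM gc.
rewrite /conv -(lintB _ _ _ _ H1 H2).
have HM : cdom (e / c * M) (fun z => f z * g (x - z) - f z * g (y - z)).
  split; first by case: (cdomB _ _ _ _ H1 H2).
  move=> z; rewrite -mulrBr cnormM mulrC -mulrA ler_pM ?cnorm_ge0 ?(fM.2)//.
  by apply/ltW/DP; rewrite opprB addrA subrK.
rewrite (le_lt_trans (lint_bound _ _ HM))//.
rewrite (_ : 2 * _ = e / c * (c - 1)); last by rewrite /c; ring.
by rewrite mulrBr mulr1 divfK ?gt_eqF// ltrBlDr ltrDl divr_gt0.
Qed.

Lemma radon_linear mu : radon mu -> Cc_linear mu.
Proof. by case. Qed.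

Lemma radon_bound mu (L : R) : radon mu -> exists2 a : R, 0 < a & forall f (M : R), Cc f ->
  (forall x, L < `|x| -> f x = 0) -> (forall x, cnorm (f x) <= M) -> cnorm (mu f) <= a * M.
Proof.
move=> [_ /(_ _ (compact_ballV L))[a aP]]; exists (`|a| + 1); first by rewrite ltr_wpDl.
move=> f M fc fL fM; have M0 : 0 <= M by rewrite (le_trans (cnorm_ge0 (f 0))).
rewrite (le_trans (aP f M fc _ fM)) ?ler_wpM2r//; last by rewrite (le_trans (ler_norm _))// lerDl.
by move=> x /= /negP; rewrite -ltNge; exact: fL.
Qed.

Definition polc (k : 'I_4) : C := nth 0 [:: 1; -1; 'i; - 'i]%C k.

(** Two pairs of arguments are allowed because in the convolution the two factors are evaluated at
    different points; for the transforms both pairs coincide. *)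
Lemma polarization (z w z' w' : C) :
  \sum_(k < 4) polc k * ((z + polc k * w) * Num.conj (z' + polc k * w')) = 4 * (z * Num.conj w').
Proof.
rewrite 4!big_ord_recl big_ord0 /polc /=.
case: z => ? ?; case: w => ? ?; case: z' => ? ?; case: w' => ? ?.
have -> : (4 : C) = (4 +i* 0)%C by rewrite -(rmorph_nat (real_complex R)).
by apply: complex_ext => /=; ring.
Qed.

(** The defining identity concerns squares only; it is applied to [f + polc k * g] for the four
    fourth roots of unity and recombined by linearity of both functionals. *)
Lemma FT_polar mu nu f g : Cc_linear mu -> FT mu nu -> Cc f -> Cc g ->
  mint_is nu (fun y => icheck f y * Num.conj (icheck g y)) (mu (conv f (ctilde g))).
Proof.
move=> lmu [rnu FTmu] fc gc; have lnu := radon_linear _ rnu.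
pose Phi k x := f x + polc k * g x.
have Phic k : Cc (Phi k) by apply: CcD => //; exact: CcZ.
have [fM fMP] := Cc_cdom _ fc; have [gM gMP] := Cc_cdom _ gc.
have PhiM k := cdomD _ _ _ _ fMP (cdomZ (polc k) _ _ gMP).
have PE k y : icheck (Phi k) y = icheck f y + polc k * icheck g y.
  by rewrite (icheckD _ _ _ _ _ fMP (cdomZ (polc k) _ _ gMP)) (icheckZ _ _ _ _ gMP).
have cPhi k : ccont (fun y => ((cnorm (icheck (Phi k) y) ^+ 2)%:C)%C).
  rewrite (eq_fun (fun y => cnorm_sqrE (icheck (Phi k) y))).
  by apply: ccontM; [|apply: ccont_conj]; exact: Cc_ccont_icheck.
have four0 : (4 : C) != 0 by rewrite pnatr_eq0.
have convc k : Cc (conv (Phi k) (ctilde (Phi k))).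
  by apply: Cc_conv => //; exact: Cc_ctilde.
have := mint_sum nu _ _ _ lnu (fun k => ccontZ (4^-1 * polc k) _ (cPhi k))
  (fun k => mintZ _ (4^-1 * polc k) _ _ lnu (cPhi k) (FTmu (Phi k) (Phic k)).2).
congr mint_is.
  apply/funext => y.
  transitivity (4^-1 * \sum_k polc k * ((icheck f y + polc k * icheck g y) *
    Num.conj (icheck f y + polc k * icheck g y))).
    by rewrite mulr_sumr; apply: eq_bigr => k _; rewrite cnorm_sqrE PE -!mulrA.
  by rewrite polarization mulKf.
rewrite (eq_bigr (fun k => 4^-1 * mu (fun x => polc k * conv (Phi k) (ctilde (Phi k)) x))) => [|k _]; last first.
  by rewrite (Cc_linearZ _ _ _ lmu (convc k)) mulrA.
rewrite -mulr_sumr -(Cc_linear_sum _ _ _ lmu (fun k => CcZ _ _ (convc k))).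
rewrite -(Cc_linearZ _ _ _ lmu) => [|]; last by apply: Cc_sum => k; exact: CcZ.
congr mu; apply/funext => x.
have [m mP] : exists m : 'I_4 -> R, forall k, cdom (m k) (fun y => Phi k y * ctilde (Phi k) (x - y)).
  have H (k : 'I_4) : exists N, cdom N (fun y => Phi k y * ctilde (Phi k) (x - y)).
    by apply: cdom_conv (PhiM k) _; exact: Cc_ctilde.
  by have [m mP] := choice H; exists m.
have [N NP] := cdom_conv _ _ _ x fMP (Cc_ctilde _ gc).
rewrite (eq_bigr (fun k => lint (fun y => polc k * (Phi k y * ctilde (Phi k) (x - y))))) => [|k _]; last first.
  by rewrite (lintZ _ _ _ (mP k)).
rewrite -(lint_sum _ _ _ (fun k => cdomZ _ _ _ (mP k))).
rewrite (_ : (fun y => _) = fun y => 4 * (f y * ctilde g (x - y))).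
  by rewrite (lintZ _ _ _ NP) mulKf.
apply/funext => y; exact: (polarization (f y) (g y) (f (- (x - y))) (g (- (x - y)))).
Qed.

Definition bump (e : R) g := Cc g /\ (exists2 r : V -> R, (forall x, 0 <= r x) & g = fun x => (r x)%:C%C) /\
  (forall x, e < `|x| -> g x = 0) /\ lint g = 1.

Lemma lint_weight_le (r : V -> R) (F : V -> C) (K : R) : (forall x, 0 <= r x) ->
  Cc (fun x => (r x)%:C%C) -> lint (fun x => (r x)%:C%C) = 1 -> ccont F -> 0 <= K ->
  (forall x, cnorm (F x) <= K * r x) -> cnorm (lint F) <= 2 * K.
Proof.
move=> r0 rc r1 cF K0 FK.
have [M rM] := Cc_cdom _ rc.
have rR : rdom 0 M r.
  by have := cdom_Re _ _ rM.
have r1' : rlint r = 1 by apply: (@complexI R); rewrite -lint_real r1.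
have KR := rdomZ K _ _ rR.
have FM : cdom (`|K| * M) F.
  by split=> // x; rewrite (le_trans (FK x))// (le_trans (ler_norm _)) ?KR.2.
by rewrite (le_trans (lint_le _ _ _ _ FM KR FK))// (rlintZ _ _ _ rR) r1' mulr1.
Qed.

Lemma bump_conv e f g (eta : R) : 0 <= eta -> Cc f -> bump e g ->
  (forall x y, `|x - y| <= e -> cnorm (f x - f y) <= eta) ->
  forall x, cnorm (conv f (ctilde g) x - f x) <= 2 * eta.
Proof.
move=> eta0 fc [gc [[r r0 gr] [ge g1]]] feta x.
have [fM fMP] := Cc_cdom _ fc; have [gM gMP] := Cc_cdom _ gc.
have [N NP] := cdom_conv _ _ _ x fMP (Cc_ctilde _ gc).
have gs := cdom_shift _ _ x gMP.
have g1s : lint (fun y => g (y - x)) = 1 by rewrite (lint_shift _ _ (- x) gMP).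
have E : f x = lint (fun y => f x * g (y - x)).
  by rewrite (lintZ _ _ _ gs) g1s mulr1.
rewrite [X in _ - X]E /conv -(lintB _ _ _ _ NP (cdomZ (f x) _ _ gs)).
have cgx : ctilde g = fun y => g (- y).
  by apply/funext => y; rewrite /ctilde gr; exact: conjc_real.
apply: (lint_weight_le (fun y => r (y - x))) => //.
- have := Cc_shift _ x gc; rewrite gr; exact.
- by rewrite -[RHS]g1s gr.
- by case: (cdomB _ _ _ _ NP (cdomZ (f x) _ _ gs)).
move=> y; rewrite cgx opprB -mulrBl cnormM.
have [ye|ye] := leP `|y - x| e; last by rewrite ge// cnorm0 mulr0 mulr_ge0.
by rewrite gr cnorm_real ger0_norm// ler_wpM2r// feta.
Qed.

Lemma icheck_bump_dist e g (y : V) : bump e g -> 0 <= e ->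
  cnorm (icheck g y - 1) <= 8 * pi * d%:R * e * `|y|.
Proof.
move=> [gc [[r r0 gr] [ge g1]]] e0.
have [gM gMP] := Cc_cdom _ gc.
rewrite icheckE -g1 -(lintB _ _ _ _ (cdom_ee _ _ y gMP) gMP).
rewrite (_ : 8 * pi * d%:R * e * `|y| = 2 * (4 * pi * d%:R * (e * `|y|))); last by ring.
apply: (lint_weight_le r) => //; rewrite -?gr//.
- by case: (cdomB _ _ _ _ (cdom_ee _ _ y gMP) gMP).
- by rewrite !mulr_ge0 ?pi_ge0.
move=> x; rewrite -{2}[g x]mulr1 -mulrBr cnormM mulrC.
have [xe|xe] := leP `|x| e; last first.
  by rewrite ge// cnorm0 mulr0 !mulr_ge0 ?pi_ge0.
rewrite gr cnorm_real ger0_norm// ler_wpM2r// -(ee0 x).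
rewrite (le_trans (ee_lipschitz _ _ _))// subr0 ler_wpM2l ?mulr_ge0 ?pi_ge0//.
by rewrite ler_wpM2r.
Qed.

Lemma icheck_bump_bound e g (y : V) : bump e g -> cnorm (icheck g y) <= 2.
Proof.
move=> [gc [[r r0 gr] [ge g1]]]; have [gM gMP] := Cc_cdom _ gc.
rewrite icheckE -[2]mulr1; apply: (lint_weight_le r) => //; rewrite -?gr//.
- by case: (cdom_ee _ _ y gMP).
by move=> x; rewrite cnormM cnorm_ee mulr1 mul1r gr cnorm_real ger0_norm.
Qed.

(** On the side of [mu], [f * g~] tends to [f] uniformly with supports in a fixed ball. On the side
    of [nu], the transform of [g] is bounded by 2 and tends to 1 locally uniformly, so [amalg_small]
    applies. The lemma serves both the given pairs [mu_n], [muhat_n] and, at the end, the limit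
    measure. *)
Lemma approx_identity mu nu (M : R) f B : radon mu -> 0 <= M -> wb nu M -> Cc f ->
  amalg (fun y => cnorm (icheck f y)) B ->
  (forall e : R, 0 < e -> exists2 g, bump e g &
    mint_is nu (fun y => icheck f y * Num.conj (icheck g y)) (mu (conv f (ctilde g)))) ->
  mint_is nu (icheck f) (mu f).
Proof.
move=> rmu M0 nuM fc fB H.
have cf := Cc_ccont_icheck _ fc.
have [c cP] := mint_exists _ _ _ _ M0 nuM cf fB.
suff -> : mu f = c by [].
apply/subr0_eq/cnorm_eq0/le_anti; rewrite cnorm_ge0 andbT; apply/ler_addgt0Pr => e e0; rewrite add0r.
have e20 : 0 < e / 2 by rewrite divr_gt0.
have [L L0 fL] := Cc_bounded_supp _ fc.
have [a a0 aP] := radon_bound _ (L + 1) rmu.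
have [D D0 DP] := Cc_uniform_continuous _ fc (e / 2 / (2 * a)) (divr_gt0 e20 (mulr_gt0 (ltr0n _ 2) a0)).
have M1 : 0 < M + 1 by rewrite ltr_wpDl.
(* The majorant carries the factor 3 because [|g^ - 1| <= 2 + 1] for a bump. *)
have G0 (y : V) : 0 <= 3 * cnorm (icheck f y) by rewrite mulr_ge0 ?cnorm_ge0.
have [Y Y0 [K K0 KP]] := amalg_small _ _ _ G0 (amalgZ _ _ _ (ler0n _ 3) fB) (divr_gt0 e20 M1).
pose k := 8 * pi * d%:R * Y + 1 : R.
have k0 : 0 < k by rewrite ltr_wpDl// !mulr_ge0 ?pi_ge0// ltW.
(* The three constraints keep the supports in the ball of radius [L + 1], bring the scale below that
   of uniform continuity of [f], and make the transform of the bump close to 1 on the ball of radius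
   [Y]. *)
pose e1 := Num.min 1 (Num.min (D / 2) (3 * K / k)).
have e10 : 0 < e1 by rewrite !lt_min ltr01 !divr_gt0 ?mulr_gt0.
have e11 : e1 <= 1 by rewrite ge_min lexx.
have e1D : e1 <= D / 2 by rewrite !ge_min lexx orbT.
have e1K : e1 * k <= 3 * K by rewrite -ler_pdivlMr// !ge_min lexx !orbT.
have [g gb gP] := H _ e10.
have [gc [_ [ge _]]] := gb.
have cg := Cc_ccont_icheck _ gc.
rewrite (le_trans (cdist_triangle (mu (conv f (ctilde g))) _ _))// (splitr e) lerD//.
  rewrite cdistC -(Cc_linearB _ _ _ (radon_linear _ rmu) _ fc); last by apply: Cc_conv => //; exact: Cc_ctilde.
  rewrite [leRHS](_ : _ = a * (2 * (e / 2 / (2 * a)))); last by field; lra.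
  apply: aP.
  - by apply: CcB => //; apply: Cc_conv => //; exact: Cc_ctilde.
  - move=> x Lx; rewrite fL ?subr0; last by rewrite (le_lt_trans _ Lx)// lerDl.
    apply: (conv_supp _ _ L 1) Lx => // z z1.
    by rewrite /ctilde ge ?rmorph0// normrN (le_lt_trans e11).
  apply: (bump_conv e1) => //; first by rewrite !divr_ge0 ?ltW ?mulr_gt0.
  move=> x y xy; apply/ltW/DP; rewrite (le_lt_trans xy)// (le_lt_trans e1D)//.
  by rewrite ltr_pdivrMr// ltr_pMr// ltr1n.
have := mint_dist _ _ _ _ _ _ (e / 2 / (M + 1)) nuM (ccontM _ _ cf (ccont_conj _ cg)) cf gP cP.
move=> F; rewrite (le_trans (F _))//; last first.
  by rewrite mulrCA ler_piMr ?(ltW e20)// ler_pdivrMr// mul1r lerDl.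
have fE y : cnorm (icheck f y * Num.conj (icheck g y) - icheck f y) = cnorm (icheck f y) * cnorm (icheck g y - 1).
  by rewrite -{2}[icheck f y]mulr1 -mulrBr cnormM -[1 in LHS](rmorph1 Num.conj) -rmorphB cnorm_conj.
apply: KP => [y|y yY]; rewrite fE.
  rewrite mulr_ge0 ?cnorm_ge0//= mulrC ler_wpM2r ?cnorm_ge0//.
  rewrite (le_trans (cnormD _ _))// cnormN cnorm1 (_ : 3 = 2 + 1 :> R) ?lerD2r; last by ring.
  exact: icheck_bump_bound gb.
rewrite mulrC mulrA ler_wpM2r ?cnorm_ge0// (mulrC K).
rewrite (le_trans (icheck_bump_dist _ _ _ gb (ltW e10)))// (le_trans _ e1K)//.
rewrite -mulrA mulrCA ler_wpM2l ?(ltW e10)// /k.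
rewrite (@le_trans _ _ (8 * pi * d%:R * Y))// ?lerDl// ler_wpM2l// !mulr_ge0 ?pi_ge0//.
Qed.

End Convolution.

(** * The flat function [exp(-1/t)] and its derivatives *)

Section FlatFunction.
Context {R : realType}.

(* The functions [p(1/t) exp(-1/t)] (zero for [t <= 0]) form a class stable under
   differentiation. *)
Definition Ep (p : {poly R}) (t : R) : R :=
  if 0 < t then p.[t^-1] * expR (- t^-1) else 0.

(** With [s = 1/t], the derivative of [p(s) exp(-s)] in [t] is [(p(s) - p'(s)) s^2 exp(-s)], as
    [ds/dt = - s^2]. *)
Definition dEp (p : {poly R}) : {poly R} := (p - p^`()) * 'X^2.

Lemma poly_bound (p : {poly R}) : exists P n, 0 <= P /\ forall s : R, 1 <= s -> `|p.[s]| <= P * s ^+ n.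
Proof.
elim/poly_ind: p => [|p c [P [n [P0 IH]]]].
  by exists 0, 0%N; split=> // s _; rewrite horner0 normr0 mul0r.
exists (P + `|c|), n.+1; split=> [|s s1]; first by rewrite addr_ge0.
rewrite hornerMXaddC (le_trans (ler_normD _ _))// mulrDl lerD//.
  by rewrite normrM exprSr mulrA ler_pM// ?IH// ger0_norm// (le_trans _ s1).
by rewrite ler_peMr// exprn_ege1.
Qed.

Lemma expR_pow_bound (m : nat) (s : R) : (0 < m)%N -> 0 <= s -> s ^+ m * expR (- s) <= m%:R ^+ m.
Proof.
move=> m0 s0; have m0' : 0 < m%:R :> R by rewrite ltr0n.
have sE : s = m%:R * (s / m%:R) by rewrite mulrC divfK ?gt_eqF.
rewrite expRN ler_pdivrMr ?expR_gt0// [in leRHS]sE expRM_natl -exprMn.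
apply: lerXn2r; rewrite ?nnegrE ?mulr_ge0 ?expR_ge0//.
apply: (@le_trans _ _ (m%:R * (s / m%:R))); first by rewrite -sE.
apply: ler_wpM2l; first exact: ltW.
by apply: le_trans (expR_ge1Dx _); rewrite lerDr.
Qed.

(** A quadratic bound at 0 is what makes the difference quotient there tend to 0; it follows from
    the boundedness of [s^m exp(-s)] with two spare powers of [s = 1/t]. *)
Lemma Ep_bound (p : {poly R}) : exists2 K : R, 0 <= K & forall t, `|t| <= 1 -> `|Ep p t| <= K * t ^+ 2.
Proof.
have [P [n [P0 PP]]] := poly_bound p.
have [B B0 BP] : exists2 B : R, 0 <= B & forall s, 0 <= s -> s ^+ (n + 2) * expR (- s) <= B.
  by exists ((n + 2)%:R ^+ (n + 2)) => [|s s0]; [exact: exprn_ge0|apply: expR_pow_bound; rewrite ?addn2].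
exists (P * B) => [|t t1]; first exact: mulr_ge0.
rewrite /Ep; case: ifP => [t0|_]; last first.
  by rewrite normr0 mulr_ge0 ?sqr_ge0// mulr_ge0.
have s1 : 1 <= t^-1 by rewrite invf_ge1// -(ger0_norm (ltW t0)).
have s0 : 0 <= t^-1 by rewrite invr_ge0 ltW.
rewrite normrM (ger0_norm (expR_ge0 _)) (le_trans (ler_wpM2r (expR_ge0 _) (PP _ s1)))//.
rewrite -!mulrA ler_wpM2l//.
have -> : t^-1 ^+ n * expR (- t^-1) = t^-1 ^+ (n + 2) * expR (- t^-1) * t ^+ 2.
  rewrite exprD mulrAC -[in RHS](mulrA (_ ^+ n)) -exprMn mulVf ?gt_eqF// expr1n mulr1//.
by apply: ler_wpM2r; [exact: sqr_ge0|exact: BP].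
Qed.

Lemma is_derive_Ep (p : {poly R}) (t : R) : is_derive t (1:R) (Ep p) (Ep (dEp p) t).
Proof.
have [t0|t0|t0] := ltgtP 0 t.
- have iV : is_derive t (1:R) (fun t : R => t^-1) (- t ^- 2).
    have := is_deriveV (lt0r_neq0 t0) (is_derive_id t (1:R)).
    by rewrite /GRing.scale /= mulr1.
  have d1 := is_derive1_comp (is_derive_poly p (t^-1)) iV.
  have iN : is_derive t (1:R) (fun t : R => - t^-1) (t ^- 2).
    by rewrite -[t ^- 2]opprK; exact: is_deriveN.
  have d2 := @is_derive1_comp _ expR (fun t : R => - t^-1) _ _ _ (is_derive_expR (- t^-1)) iN.
  have d3 : is_derive t (1 : R) (fun t : R => p.[t^-1] * expR (- t^-1)) (Ep (dEp p) t).
    have -> : Ep (dEp p) t = p.[t^-1] * (t ^- 2 * expR (- t^-1)) + expR (- t^-1) * (- t ^- 2 * p^`().[t^-1]).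
      rewrite /Ep t0 /dEp hornerM hornerXn hornerD hornerN exprVn.
      by move: (t ^- 2) (expR _) p.[_] (p^`().[_]) => a b c e; ring.
    apply: is_derive_eq (is_deriveM d1 d2) _.
    by rewrite /GRing.scale /= [in X in _ = X + _](mulrC (t ^- 2)) [in X in _ = _ + X](mulrC (- t ^- 2)).
  apply: near_eq_is_derive d3.
  near=> s; rewrite /Ep ifT//; near: s; exact: lt_nbhsr.
- have d3 : is_derive t (1 : R) (cst 0 : R -> R) (Ep (dEp p) t).
    rewrite /Ep ifF; last by apply/negbTE; rewrite -leNgt ltW.
    exact: is_derive_cst.
  apply: near_eq_is_derive d3.
  near=> s; rewrite /Ep ifF//; apply/negbTE; rewrite -leNgt ltW//.
  near: s; exact: lt_nbhsl.
rewrite -t0 [X in is_derive _ _ _ X](_ : _ = 0); last by rewrite /Ep ltxx.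
(* At 0 the slope function is [Ep p z / z], whose value at [z = 0] is 0 since division by zero gives
   0. *)
apply/is_derive1_caratheodory.
have [K K0 KP] := Ep_bound p.
have E0 : Ep p 0 = 0 by rewrite /Ep ltxx.
exists (fun z => Ep p z / z); split; last by rewrite E0 mul0r.
  move=> z; rewrite E0 !subr0; have [->|z0] := eqVneq z 0; first by rewrite E0 mul0r mulr0.
  by rewrite divfK.
apply/cvgrPdist_lt => e e0; rewrite E0 mul0r.
have N1 : \forall z \near (0 : R), `|z| <= 1 := nbhs0_le ltr01.
have N2 : \forall z \near (0 : R), `|z| < e / (K + 1).
  by apply: nbhs0_lt; rewrite divr_gt0// ltr_wpDl.
apply: filterS2 N1 N2 => z z1 ze; rewrite sub0r normrN normrM normfV.
have [->|z0] := eqVneq z 0; first by rewrite E0 normr0 mul0r.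
rewrite ltr_pdivrMr ?normr_gt0// (le_lt_trans (KP z z1))//.
rewrite -(real_normK (num_real z)) expr2 mulrA ltr_pM2r ?normr_gt0//.
rewrite (@le_lt_trans _ _ ((K + 1) * `|z|))// ?ler_wpM2r ?lerDl//.
by rewrite mulrC -ltr_pdivlMr// ltr_wpDl.
Unshelve. all: by end_near. Qed.

Lemma continuous_Ep (p : {poly R}) : continuous (Ep p).
Proof.
by move=> t; apply/differentiable_continuous/derivable1_diffP; have [] := is_derive_Ep p t.
Qed.

Lemma Ep1_ge0 t : 0 <= Ep 1 t.
Proof. by rewrite /Ep; case: ifP => // _; rewrite hornerC mul1r expR_ge0. Qed.

Lemma Ep1_le1 t : Ep 1 t <= 1.
Proof.
rewrite /Ep; case: ifP => // t0; rewrite hornerC mul1r expRN invf_le1 ?expR_gt0//.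
by rewrite (le_trans _ (expR_ge1Dx _))// lerDl invr_ge0 ltW.
Qed.

Lemma Ep1_gt0 t : 0 < t -> 0 < Ep 1 t.
Proof. by move=> t0; rewrite /Ep t0 hornerC mul1r expR_gt0. Qed.

Lemma Ep_le0 p t : t <= 0 -> Ep p t = 0.
Proof. by move=> t0; rewrite /Ep ifF//; apply/negbTE; rewrite -leNgt. Qed.

Lemma intR_gt0 (f : R -> R) M : continuous f -> qdom M f -> (forall t, 0 <= f t) -> 0 < f 0 ->
  0 < intR f.
Proof.
move=> cf fM f0 f00.
have /continuous_edP/(_ 0 (f 0 / 2) (divr_gt0 f00 (ltr0n _ 2)))[D D0 DP] := cf.
pose A := `[- (D / 2), D / 2]%classic : set R.
have I := qdom_integrable _ _ cf fM.
have fin : (\int[lebesgue_measure]_t (f t)%:E)%E \is a fin_num by exact: integrable_fin_num.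
rewrite /intR /Rintegral -lte_fin fineK//.
have D20 : - (D / 2) < D / 2 by rewrite lt_neqAle; lra.
apply: (@lt_le_trans _ _ ((f 0 / 2)%:E * lebesgue_measure A)%E).
  rewrite lebesgue_measure_itv /= lte_fin D20 -EFinD -EFinM lte_fin mulr_gt0 ?divr_gt0//.
  by rewrite opprK addr_gt0// divr_gt0.
have mA : measurable A by exact: measurable_itv.
have mf : measurable_fun setT (EFin \o f) by exact: continuous_measurableE.
apply: (@le_trans _ _ (\int[lebesgue_measure]_(t in A) (f t)%:E)%E).
  rewrite -(integral_cst lebesgue_measure mA); apply: ge0_le_integral => //.
  - by move=> t _; rewrite lee_fin divr_ge0 ?ltW.
  - exact: measurable_funTS.
  move=> t; rewrite /A /= in_itv/= => /andP[t1 t2]; rewrite lee_fin.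
  have : `|0 - t| < D by rewrite sub0r normrN ltr_norml; apply/andP; split; lra.
  by move=> /DP; rewrite ltr_norml => /andP[? ?]; lra.
by apply: ge0_subset_integral => //; move=> t _; rewrite lee_fin.
Qed.

End FlatFunction.

(** * An explicit class of smooth functions, and smooth bumps *)

Section SmoothClass.
Context {R : realType} {d : nat}.
Local Notation V := 'rV[R]_d.
Local Notation C := R[i].

(** A syntactic class closed under partial derivatives, so that smoothness of all orders follows by
    induction on the construction. It contains exactly the ingredients needed for bumps, their
    translates and their combinations. *)
Inductive SG : (V -> R) -> Prop :=
| SG_cst c : SG (fun=> c)
| SG_Ep p (a c : R) i : SG (fun x => Ep p (a * x 0 i + c))
| SG_add f g : SG f -> SG g -> SG (fun x => f x + g x)
| SG_mul f g : SG f -> SG g -> SG (fun x => f x * g x).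

Lemma is_derive_lineP (f : V -> R) (x v : V) (df : R) :
  is_derive (0 : R) (1 : R) (fun t : R => f (t *: v + x)) df -> is_derive x v f df.
Proof.
have E : (fun h : R => h^-1 *: (((fun t : R => f (t *: v + x)) \o shift 0) (h *: (1 : R)) -
    (fun t : R => f (t *: v + x)) 0)) = (fun h : R => h^-1 *: ((f \o shift x) (h *: v) - f x)).
  by apply/funext => h /=; rewrite addr0 scale0r add0r /GRing.scale /= mulr1.
by case=> D1 D2; split; [rewrite /derivable -E|rewrite /derive -E].
Qed.

Lemma SG_derive (f : V -> R) : SG f -> forall i, exists2 g, SG g &
  forall x, is_derive x (ebase i) f (g x).
Proof.
elim=> [c|p a c j|f1 g1 _ IHf _ IHg|f1 g1 fS IHf gS IHg] i.
- by exists (fun=> 0) => [|x]; [exact: SG_cst|exact: is_derive_cst].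
- exists (fun x => (a * (j == i)%:R) * Ep (dEp p) (a * x 0 j + c)).
    by apply: SG_mul; [exact: SG_cst|exact: SG_Ep].
  move=> x; apply: is_derive_lineP.
  rewrite (_ : (fun t : R => _) = Ep p \o (fun t : R => (a * (j == i)%:R) * t + (a * x 0 j + c))); last first.
    by apply/funext => t /=; congr Ep; rewrite !mxE; ring.
  rewrite [X in is_derive _ _ _ X]mulrC; apply: is_derive1_comp.
    by rewrite mulr0 add0r; exact: is_derive_Ep.
  by apply: is_derive_eq; rewrite /GRing.scale /= mulr1 addr0.
- have [f2 S2 D2] := IHf i; have [g2 S3 D3] := IHg i.
  exists (fun x => f2 x + g2 x) => [|x]; first exact: SG_add.
  exact: is_deriveD.
have [f2 S2 D2] := IHf i; have [g2 S3 D3] := IHg i.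
exists (fun x => f1 x * g2 x + g1 x * f2 x) => [|x].
  by apply: SG_add; apply: SG_mul.
exact: is_deriveM.
Qed.

Lemma SG_continuous f : SG f -> continuous f.
Proof.
elim=> [c x|p a c j|f1 g1 _ cf _ cg|f1 g1 _ cf _ cg].
- exact: cst_continuous.
- apply: (@continuous_compR V R R (fun x : V => a * x 0 j + c) (Ep p)); last exact: continuous_Ep.
  apply: continuousDR; last by move=> x; exact: cst_continuous.
  exact/continuousZR/continuous_coord.
- exact: continuousDR.
- exact: continuousMR.
Qed.

Lemma SG_pder f s : SG f -> SG (pder s f).
Proof.
move=> fS; elim: s => [//|i s IH] /=; have [g gS gD] := SG_derive _ IH i.
by rewrite (_ : (fun x => _) = g)//; apply/funext => x; have [_ ->] := gD x.
Qed.

Lemma SG_smooth f : SG f -> smoothR f.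
Proof.
move=> fS s i x; have [g gS gD] := SG_derive _ (SG_pder _ s fS) i.
by have [] := gD x.
Qed.

Lemma SG_shift f (b : V) : SG f -> SG (fun x => f (x - b)).
Proof.
elim=> [c|p a c j|f1 g1 _ Sf _ Sg|f1 g1 _ Sf _ Sg].
- exact: SG_cst.
- rewrite (_ : (fun x : V => _) = fun x : V => Ep p (a * x 0 j + (c - a * b 0 j))); first exact: SG_Ep.
  by apply/funext => x; congr Ep; rewrite !mxE; ring.
- exact: SG_add.
- exact: SG_mul.
Qed.

Lemma SG_prod (I : finType) (F : I -> V -> R) : (forall i, SG (F i)) -> SG (fun x => \prod_i F i x).
Proof.
move=> FS; elim: (index_enum I) => [|i s IH].
  by under eq_fun do rewrite big_nil; exact: SG_cst.
by under eq_fun do rewrite big_cons; exact: SG_mul.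
Qed.

Lemma derive_eq0_out (f : V -> R) (L : R) (v : V) : (forall x, L < `|x| -> f x = 0) ->
  forall x, L < `|x| -> 'D_v f x = 0.
Proof.
move=> fL x xL.
have N : \near x, f x = cst 0 x.
  apply/nbhs_ballP; exists (`|x| - L) => /=; first by rewrite subr_gt0.
  move=> y; rewrite -ball_normE /= => xy; apply: fL.
  by have := lerB_dist x y; lra.
by rewrite (near_eq_derive v N) derive_cst.
Qed.

Lemma pder_eq0_out (f : V -> R) (L : R) s : (forall x, L < `|x| -> f x = 0) ->
  forall x, L < `|x| -> pder s f x = 0.
Proof. by move=> fL; elim: s => [//|i s IH] /=; exact: derive_eq0_out. Qed.

(** The working test functions: a stable subclass of the smooth compactly supported functions, large
    enough for its transforms to be dense in the amalgam norm. *)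
Definition S0 (f : V -> C) := SG (fun x => complex.Re (f x)) /\ SG (fun x => complex.Im (f x)) /\
  exists2 L : R, 0 < L & forall x, L < `|x| -> f x = 0.

Lemma S0_ccont f : S0 f -> ccont f.
Proof. by move=> [fR [fI _]]; split; exact: SG_continuous. Qed.

Lemma S0_Cc f : S0 f -> Cc f.
Proof. by move=> fS; have [_ [_ [L L0 fL]]] := fS; apply: (CcI _ L) => //; exact: S0_ccont. Qed.

Lemma S0_smooth f : S0 f -> smooth f.
Proof. by move=> [fR [fI _]]; split; exact: SG_smooth. Qed.

Lemma S0_Ccinf f : S0 f -> Ccinf f.
Proof. by move=> fS; split; [exact: S0_Cc|exact: S0_smooth]. Qed.

Lemma S0_Schwartz f : S0 f -> Schwartz f.
Proof.
move=> fS; split; first exact: S0_smooth.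
move=> s k; have [fR [fI [L L0 fL]]] := fS.
pose g x := (pder s (fun y => complex.Re (f y)) x +i* pder s (fun y => complex.Im (f y)) x)%C.
have gL x : L < `|x| -> g x = 0.
  by move=> xL; rewrite /g !(pder_eq0_out _ L)// => y /fL ->.
have cg : ccont g by split; apply: SG_continuous; exact: SG_pder.
have [B B0 gB] := Cc_bounded _ (CcI _ _ L0 cg gL).
exists ((1 + L) ^+ k * B) => x; have [xL|xL] := leP `|x| L; last first.
  by rewrite /cpder_norm -/(g x) gL// cnorm0 mulr0 mulr_ge0 ?(ltW B0)// exprn_ge0// addr_ge0// ltW.
apply: ler_pM; [by rewrite exprn_ge0// addr_ge0|exact: cnorm_ge0| |exact: gB].
by rewrite lerXn2r ?nnegrE ?addr_ge0 ?lerD2l// ltW.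
Qed.

Lemma S0_D f g : S0 f -> S0 g -> S0 (fun x => f x + g x).
Proof.
move=> [fR [fI [L L0 fL]]] [gR [gI [K K0 gK]]]; split; [|split].
- by rewrite (eq_fun (fun x => ReD (f x) (g x))); exact: SG_add.
- by rewrite (eq_fun (fun x => ImD (f x) (g x))); exact: SG_add.
exists (Num.max L K) => [|x]; first by rewrite lt_max L0.
by rewrite gt_max => /andP[/fL -> /gK ->]; rewrite addr0.
Qed.

Lemma S0_Z (a : C) f : S0 f -> S0 (fun x => a * f x).
Proof.
move=> [fR [fI [L L0 fL]]]; split; [|split].
- rewrite (eq_fun (fun x => ReM a (f x))).
  rewrite (_ : (fun x => _) = fun x => complex.Re a * complex.Re (f x) + (- complex.Im a) * complex.Im (f x)).
    by apply: SG_add; apply: SG_mul => //; exact: SG_cst.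
  by apply/funext => x; rewrite mulNr.
- rewrite (eq_fun (fun x => ImM a (f x))).
  by apply: SG_add; apply: SG_mul => //; exact: SG_cst.
by exists L => // x /fL ->; rewrite mulr0.
Qed.

Lemma S0_0 : S0 (fun=> 0).
Proof. by split; [exact: SG_cst|split; [exact: SG_cst|exists 1]]. Qed.

Lemma S0_sum (I : finType) (F : I -> V -> C) : (forall i, S0 (F i)) -> S0 (fun x => \sum_i F i x).
Proof.
move=> FS; elim: (index_enum I) => [|i s IH].
  by under eq_fun do rewrite big_nil; exact: S0_0.
by under eq_fun do rewrite big_cons; exact: S0_D.
Qed.

Lemma S0_shift f (b : V) : S0 f -> S0 (fun x => f (x - b)).
Proof.
move=> [fR [fI [L L0 fL]]]; split; [|split]; [exact: (SG_shift _ b fR)|exact: (SG_shift _ b fI)|].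
exists (L + `|b|) => [|x xL]; first by rewrite ltr_wpDr.
by apply: fL; rewrite -(ltrD2r `|b|) (lt_le_trans xL)// -{1}(subrK b x) ler_normD.
Qed.

Definition bfun (e : R) (t : R) : R := Ep 1 (e^-1 * t + 1) * Ep 1 (- e^-1 * t + 1).

(** The bump is a product of even one-dimensional functions [bfun], normalised. Being real and even
    it satisfies [ctilde g = g], so convolution with [ctilde g] is convolution with [g]. *)
Lemma bump_exists (e : R) : 0 < e -> exists2 g, bump e g & S0 g /\ ctilde g = g.
Proof.
move=> e0.
pose B (x : V) : R := \prod_i bfun e (x 0 i).
have B0 x : 0 <= B x by apply: prodr_ge0 => i _; rewrite mulr_ge0 ?Ep1_ge0.
have bS : SG B.
  by apply: SG_prod => i; apply: SG_mul; exact: SG_Ep.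
have be0 t : e < `|t| -> bfun e t = 0.
  rewrite ltr_normr => /orP[te|te]; rewrite /bfun.
    rewrite [X in _ * X]Ep_le0 ?mulr0// mulNr addrC subr_le0 mulrC ler_pdivlMr// mul1r ltW//.
  rewrite Ep_le0 ?mul0r// -[t]opprK mulrN addrC subr_le0 mulrC ler_pdivlMr// mul1r ltW//.
have BL x : e < `|x| -> B x = 0.
  move=> xe; have [i xi] := normr_rV_gt _ _ (ltW e0) xe.
  by rewrite /B (bigD1 i)//= be0 ?mul0r.
have cB := SG_continuous _ bS.
have cb : continuous (bfun e).
  apply: continuousMR.
    apply: (@continuous_compR R R R (fun t => e^-1 * t + 1) (Ep 1)); last exact: continuous_Ep.
    apply: continuousDR; last by move=> t; exact: cst_continuous.
    by apply: continuousZR => t; exact: cvg_id.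
  apply: (@continuous_compR R R R (fun t => - e^-1 * t + 1) (Ep 1)); last exact: continuous_Ep.
  apply: continuousDR; last by move=> t; exact: cst_continuous.
  by apply: continuousZR => t; exact: cvg_id.
have Bc : Cc (fun x => (B x)%:C%C).
  by apply: (CcI _ e) => // [|x /BL ->]; first exact: ccont_real.
have [M BM] := Cc_cdom _ Bc; have BR : rdom 0 M B := cdom_Re _ _ BM.
have bq : exists M, qdom M (bfun e).
  exists (1 + e ^+ 2) => t; have [te|/be0 ->] := leP `|t| e; last first.
    by rewrite normr0 mulr_ge0 ?qw_ge0// ltW// one_sqr_gt0.
  rewrite (@le_trans _ _ 1)//.
    by rewrite /bfun normrM !ger0_norm ?Ep1_ge0// mulr_ile1 ?Ep1_ge0 ?Ep1_le1.
  rewrite /qw ler_pdivlMr ?one_sqr_gt0// mul1r lerD2l -(real_normK (num_real t)).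
  by rewrite lerXn2r ?nnegrE// ltW.
(* Normalisation requires a positive integral; the product formula reduces this to dimension one,
   where the integrand is positive at 0. *)
have I0 : 0 < rlint B.
  rewrite /rlint (rint_prod (fun=> bfun e))//.
  apply: prodr_gt0 => i _; rewrite leqNgt ltn_ord /=; have [M' bM'] := bq.
  apply: (intR_gt0 _ _ cb bM') => [t|]; first by rewrite mulr_ge0 ?Ep1_ge0.
  by rewrite /bfun !mulr0 add0r mulr_gt0 ?Ep1_gt0.
exists (fun x => ((rlint B)^-1 * B x)%:C%C); last split.
- split; [|split; [|split]].
  + by have := CcZ (rlint B)^-1%:C%C _ Bc; rewrite (eq_fun (fun x => esym (rmorphM _ _ (B x)))).
  + by exists (fun x => (rlint B)^-1 * B x) => // x; rewrite mulr_ge0// invr_ge0 ltW.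
  + by move=> x /BL ->; rewrite mulr0.
  + by rewrite lint_real (rlintZ _ _ _ BR) mulVf// gt_eqF.
- split; [|split]; [|exact: SG_cst|by exists e => // x /BL ->; rewrite mulr0].
  by apply: SG_mul => //; exact: SG_cst.
apply/funext => x; rewrite /ctilde; apply: (etrans (conjc_real _)); congr ((_ * _)%:C%C).
apply: eq_bigr => i _; rewrite /bfun mxE [RHS]mulrC; congr (Ep 1 (_ + 1) * Ep 1 (_ + 1)); ring.
Qed.

End SmoothClass.

(** * Decay of transforms of Schwartz functions *)

Section SchwartzDecay.
Context {R : realType} {d : nat}.
Local Notation V := 'rV[R]_d.
Local Notation C := R[i].

Lemma MVT_point (f df : R -> R) (a b : R) : a < b -> (forall t, is_derive t (1:R) f (df t)) ->
  exists2 c, a < c < b & f b - f a = df c * (b - a).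
Proof.
move=> ab fdf; have [] := @MVT _ f df a b ab.
  apply: continuous_subspaceT => t.
  by apply/differentiable_continuous/derivable1_diffP; have [] := fdf t.
by move=> c; rewrite in_itv /= => ? ->; exists c.
Qed.

Lemma is_derive_shift (g : V -> R) (x a v : V) df :
  is_derive (x + a) v g df -> is_derive x v (fun y => g (y + a)) df.
Proof.
have E : (fun h : R => h^-1 *: (((fun y => g (y + a)) \o shift x) (h *: v) - g (x + a))) =
    (fun h : R => h^-1 *: ((g \o shift (x + a)) (h *: v) - g (x + a))).
  by apply/funext => h /=; rewrite addrA.
by case=> D1 D2; split; [rewrite /derivable E|rewrite /derive E].
Qed.

Lemma is_derive_line (g : V -> R) (x v : V) (t : R) df :
  is_derive (x + t *: v) v g df -> is_derive t (1 : R) (fun s => g (x + s *: v)) df.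
Proof.
have E : (fun h : R => h^-1 *: (((fun s : R => g (x + s *: v)) \o shift t) (h *: (1 : R)) - g (x + t *: v))) =
    (fun h : R => h^-1 *: ((g \o shift (x + t *: v)) (h *: v) - g (x + t *: v))).
  apply/funext => h; have hE : h *: (1 : R) = h by exact: mulr1.
  by rewrite /= hE scalerDl addrCA.
by case=> D1 D2; split; [rewrite /derivable E|rewrite /derive E].
Qed.

Lemma smoothR_is_derive (g : V -> R) s i x : smoothR g ->
  is_derive x (ebase i) (pder s g) (pder (i :: s) g x).
Proof. by move=> sg; split; [exact: sg|]. Qed.

Definition d2 (i : 'I_d) (h : R) (g : V -> R) (x : V) : R :=
  g (x + h *: ebase i) + g (x - h *: ebase i) - 2 * g x.

Lemma is_derive_d2 i h j (g g' : V -> R) :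
  (forall x, is_derive x (ebase j) g (g' x)) ->
  forall x, is_derive x (ebase j) (d2 i h g) (d2 i h g' x).
Proof.
move=> gg' x.
have h1 := is_derive_shift _ _ _ _ _ (gg' (x + h *: ebase i)).
have h2 := is_derive_shift _ _ _ _ _ (gg' (x - h *: ebase i)).
have h3 : is_derive x (ebase j) (fun y => 2 * g y) (2 * g' x) by exact: is_deriveZ.
exact: is_deriveB (is_deriveD h1 h2) h3.
Qed.

Lemma pder_d2 i h (g : V -> R) s : smoothR g -> pder s (d2 i h g) = d2 i h (pder s g).
Proof.
move=> sg; elim: s => [//|j s IH] /=; rewrite -/(pder s (d2 i h g)) IH.
apply/funext => x.
by have [_ ->] := is_derive_d2 i h j _ _ (fun x => smoothR_is_derive _ s j x sg) x.
Qed.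

Lemma smoothR_d2 i h (g : V -> R) : smoothR g -> smoothR (d2 i h g).
Proof.
move=> sg s j x; rewrite pder_d2//.
by have [] := is_derive_d2 i h j _ _ (fun x => smoothR_is_derive _ s j x sg) x.
Qed.

Lemma wt_line (x : V) (t : R) i : `|t| <= 1 -> wt (x + t *: ebase i) <= 4 * wt x.
Proof.
move=> t1; rewrite /wt (bigD1 i)//= [in leRHS](bigD1 i)//= mulrA.
rewrite (eq_bigr (fun j => qw (x 0 j))) => [|j ji]; last by rewrite !mxE (negPf ji) mulr0 addr0.
apply: ler_wpM2r; first by apply: prodr_ge0 => j _; exact: qw_ge0.
rewrite !mxE eqxx mulr1 (le_trans (qw_shift _ _))//; apply: ler_wpM2r; first exact: qw_ge0.
have : t ^+ 2 <= 1 by rewrite -(real_normK (num_real t)) -[1](expr1n _ 2) lerXn2r ?nnegrE.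
lra.
Qed.

Lemma d2_bound i (h P : R) (u u1 u2 : V -> R) : 0 <= h <= 1 ->
  (forall x, is_derive x (ebase i) u (u1 x)) -> (forall x, is_derive x (ebase i) u1 (u2 x)) ->
  (forall x, `|u2 x| <= P * wt x) -> forall x, `|d2 i h u x| <= P * (8 * h ^+ 2) * wt x.
Proof.
move=> /andP[h0 h1] du du1 uP x.
have P0 : 0 <= P.
  by have := le_trans (normr_ge0 _) (uP x); rewrite pmulr_lge0// wt_gt0.
move: h0; rewrite le_eqVlt => /orP[/eqP <-|h0].
  by rewrite /d2 scale0r subr0 addr0 (_ : _ - _ = 0) ?normr0 ?mulr_ge0 ?wt_ge0//; ring.
pose phi t := u (x + t *: ebase i); pose phi1 t := u1 (x + t *: ebase i).
have dphi t : is_derive t (1 : R) phi (phi1 t) by exact: is_derive_line.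
have dphi1 t : is_derive t (1 : R) phi1 (u2 (x + t *: ebase i)) by exact: is_derive_line.
have dN t : is_derive t (1 : R) (fun t => phi (- t)) (- phi1 (- t)).
  have iN : is_derive t (1 : R) (fun t : R => - t) (-1) by exact: is_deriveN.
  by have := @is_derive1_comp _ phi (fun t : R => - t) _ _ _ (dphi (- t)) iN; rewrite mulrN1.
have dD t : is_derive t (1 : R) (fun t => phi t + phi (- t)) (phi1 t - phi1 (- t)).
  exact: is_deriveD.
have [c /andP[c0 ch] E1] := MVT_point _ _ _ _ h0 dD.
have cc : - c < c by rewrite gtrN.
have [c' /andP[cc1 cc2] E2] := MVT_point _ _ _ _ cc dphi1.
have -> : d2 i h u x = u2 (x + c' *: ebase i) * (2 * c * h).
  transitivity ((phi1 c - phi1 (- c)) * (h - 0)); last by rewrite E2; ring.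
  rewrite -E1 /phi /d2 oppr0 scale0r addr0 scaleNr; ring.
have c'1 : `|c'| <= 1 by rewrite ler_norml; apply/andP; split; lra.
rewrite normrM (ger0_norm (_ : 0 <= 2 * c * h)); last by rewrite !mulr_ge0// ltW.
apply: (@le_trans _ _ (P * (4 * wt x) * (2 * h * h))).
  apply: ler_pM => //; first by rewrite !mulr_ge0// ltW.
    by rewrite (le_trans (uP _))// ler_wpM2l// wt_line.
  by rewrite ler_wpM2r ?(ltW h0)// ler_wpM2l// ltW.
by rewrite le_eqVlt (_ : _ == _ = true)//; apply/eqP; ring.
Qed.

Fixpoint rDD (h : 'I_d -> R) (s : seq 'I_d) (g : V -> R) : V -> R :=
  if s is i :: s' then rDD h s' (d2 i (h i) g) else g.

Lemma DD_rDD h s (f : V -> C) :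
  DD h s f = fun x => (rDD h s (fun y => complex.Re (f y)) x +i* rDD h s (fun y => complex.Im (f y)) x)%C.
Proof.
elim: s f => [|i s IH] f /=; first by apply/funext => x; case: (f x).
rewrite IH; apply/funext => x; congr (rDD _ _ _ _ +i* rDD _ _ _ _)%C; apply/funext => y; rewrite /D2 /d2.
  by rewrite mulr2n mulrDl mul1r !(ReD,ReN); ring.
by rewrite mulr2n mulrDl mul1r !(ImD,ImN); ring.
Qed.

Definition dbl (s : seq 'I_d) : seq 'I_d := flatten [seq [:: i; i] | i <- s].

Lemma rDD_bound h s (g : V -> R) (P : R) : (forall i, 0 <= h i <= 1) -> smoothR g ->
  (forall x, `|pder (dbl s) g x| <= P * wt x) ->
  forall x, `|rDD h s g x| <= P * \prod_(i <- s) (8 * h i ^+ 2) * wt x.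
Proof.
move=> h01; elim: s g P => [|i s IH] g P sg gP x /=; first by rewrite big_nil mulr1; exact: gP.
rewrite big_cons mulrA; apply: IH => [|y]; first exact: smoothR_d2.
rewrite pder_d2//; apply: (d2_bound _ _ _ _ (pder (i :: dbl s) g) (pder (i :: i :: dbl s) g)) => // z;
  exact: smoothR_is_derive.
Qed.

Lemma wt_lower_pow (x : V) : ((1 + `|x|) ^+ (2 * d))^-1 <= wt x.
Proof.
apply: le_trans (wt_lower _ _ (lexx `|x|)).
rewrite lef_pV2 ?posrE ?exprn_gt0 ?one_sqr_gt0 ?ltr_wpDr// exprM.
apply: lerXn2r; rewrite ?nnegrE ?sqr_ge0 ?addr_ge0 ?sqr_ge0//.
by rewrite sqrrD expr1n mul1r -addrA lerD2l lerDr mulrn_wge0.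
Qed.

Lemma snormP s k (f : V -> C) : Schwartz f -> snorm s k f = (fine (snorm s k f))%:E /\
  forall x, (1 + `|x|) ^+ k * cpder_norm s f x <= fine (snorm s k f).
Proof.
move=> [_ /(_ s k)[M fM]].
have ub x : (((1 + `|x|) ^+ k * cpder_norm s f x)%:E <= snorm s k f)%E.
  by apply: ereal_sup_ubound; exists x.
have fin : snorm s k f \is a fin_num.
  rewrite fin_numElt (lt_le_trans _ (ub 0)) ?ltNyr//=.
  apply: (@le_lt_trans _ _ M%:E); last exact: ltry.
  by apply: ge_ereal_sup => _ [x _ <-]; rewrite lee_fin.
by split=> [|x]; [rewrite fineK|rewrite -lee_fin fineK].
Qed.

Lemma cpder_wt s (f : V -> C) x : Schwartz f -> cpder_norm s f x <= fine (snorm s (2 * d) f) * wt x.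
Proof.
move=> fS; have [_ fM] := snormP s (2 * d) _ fS.
have p0 : 0 < (1 + `|x|) ^+ (2 * d) by rewrite exprn_gt0// ltr_wpDr.
have := fM x; rewrite mulrC -ler_pdivlMr// => H; rewrite (le_trans H)//.
apply: ler_wpM2l; last exact: wt_lower_pow.
by apply: le_trans (fM x); rewrite mulr_ge0 ?(ltW p0) ?cnorm_ge0.
Qed.

(** One seminorm for each set of coordinates in which [icheck_decay] takes differences: two
    derivatives in each of them, and the power [2 * d], since [(1 + |x|)^(2 d)] dominates
    [1 / wt x]. The same list witnesses continuity in [tempered_actionP]. *)
Definition decayF : seq (seq 'I_d * nat) := [seq (dbl (enum A), (2 * d)%N) | A : {set 'I_d}].

Definition decayN (f : V -> C) : R := \sum_(p <- decayF) fine (snorm p.1 p.2 f).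

(** [smoothR] provides only partial derivatives, not joint continuity. The coordinates of [x] are
    replaced by those of [y] one at a time, with the mean value theorem along each axis; this is how
    Schwartz functions are shown to be continuous. *)
Lemma smoothR_lipschitz (g : V -> R) (M : R) : smoothR g ->
  (forall i x, `|pder [:: i] g x| <= M) -> forall x y, `|g x - g y| <= M *+ d * `|x - y|.
Proof.
move=> sg gM x y.
pose z k : V := \row_j (if (j < k)%N then y 0 j else x 0 j).
have step k : (k <= d)%N -> `|g x - g (z k)| <= M *+ k * `|x - y|.
  elim: k => [_|k IH kd].
    rewrite (_ : z 0%N = x) ?subrr ?normr0 ?mulr0n ?mul0r//.
    by apply/rowP => j; rewrite mxE.
  rewrite (le_trans (ler_distD (g (z k)) _ _))// mulrSr mulrDl lerD ?IH 1?ltnW//.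
  pose i := Ordinal kd; pose w t := z k + t *: ebase i.
  have zE : z k.+1 = w (y 0 i - x 0 i).
    apply/rowP => j; rewrite !mxE ltnS leq_eqVlt.
    have [ji|ji] := eqVneq j i.
      by rewrite ji /= eqxx ltnn mulr1 addrC subrK.
    have -> : (j == k :> nat) = false by apply/negbTE/negP => /eqP jk; move/negP: ji; apply; apply/eqP/val_inj.
    by rewrite /= mulr0 addr0.
  have z0 : z k = w 0 by rewrite /w scale0r addr0.
  have dw t : is_derive t (1 : R) (fun t => g (w t)) (pder [:: i] g (w t)).
    by apply: is_derive_line; exact: (smoothR_is_derive _ [::]).
  rewrite zE [in X in `|X - _|]z0 (le_trans (MVT_bound _ _ M _ _ dw _))//.
  have M0 : 0 <= M by apply: le_trans (gM i 0).
  rewrite sub0r opprB ler_wpM2l//.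
  by have := normr_coord (x - y) i; rewrite !mxE.
have := step d (leqnn d); rewrite (_ : z d = y)//.
by apply/rowP => j; rewrite mxE ltn_ord.
Qed.

Lemma cpder_Re s (f : V -> C) x : `|pder s (fun y => complex.Re (f y)) x| <= cpder_norm s f x.
Proof. exact: (normr_Re_cnorm (_ +i* _)%C). Qed.

Lemma cpder_Im s (f : V -> C) x : `|pder s (fun y => complex.Im (f y)) x| <= cpder_norm s f x.
Proof. exact: (normr_Im_cnorm (_ +i* _)%C). Qed.

Lemma Schwartz_ccont (f : V -> C) : Schwartz f -> ccont f.
Proof.
move=> [[sR sI] fB].
have [M MP] : exists M : R, forall i x, cpder_norm [:: i] f x <= M.
  have [m mP] := choice (fun i => fB [:: i] 0%N).
  exists (\sum_i `|m i|) => i x; have := mP i x; rewrite expr0 mul1r => H.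
  rewrite (le_trans H)// (le_trans (ler_norm _))// (bigD1 i)//= lerDl sumr_ge0//.
split; apply/continuous_edP => x e e0.
all: exists (e / (`|M| *+ d + 1)); first by rewrite divr_gt0// ltr_wpDl// mulrn_wge0.
all: move=> y; rewrite ltr_pdivlMr ?ltr_wpDl ?mulrn_wge0// => xy.
all: rewrite (le_lt_trans _ xy)//.
  rewrite (le_trans (smoothR_lipschitz _ `|M| sR _ _ _))//.
    by move=> i z; rewrite (le_trans (cpder_Re _ _ _))// (le_trans (MP _ _))// ler_norm.
  by rewrite mulrC ler_wpM2l// lerDl.
rewrite (le_trans (smoothR_lipschitz _ `|M| sI _ _ _))//.
  by move=> i z; rewrite (le_trans (cpder_Im _ _ _))// (le_trans (MP _ _))// ler_norm.
by rewrite mulrC ler_wpM2l// lerDl.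
Qed.

Lemma Schwartz_cdom1 (f : V -> C) : Schwartz f -> exists M, cdom1 M f.
Proof.
move=> fS; have [M fM] := fS.2 [::] (2 * d).+1.
exists M; split; first exact: Schwartz_ccont.
move=> x; have p0 : 0 < (1 + `|x|) ^+ (2 * d) by rewrite exprn_gt0// ltr_wpDr.
have fE : cpder_norm [::] f x = cnorm (f x) by rewrite /cpder_norm /=; case: (f x).
have := fM x; rewrite fE exprSr -mulrA mulrC -ler_pdivlMr// => H; rewrite (le_trans H)//.
apply: ler_wpM2l; last exact: wt_lower_pow.
by apply: le_trans (fM x); rewrite mulr_ge0 ?exprn_ge0 ?addr_ge0 ?cnorm_ge0.
Qed.

Lemma icheck_Schwartz (f : V -> C) : Schwartz f ->
  forall y, cnorm (icheck f y) <= 2 * (2 * decayN f * Lam (R:=R) (d:=d)) * 2 ^+ d * wt y.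
Proof.
move=> fS; have [M fM] := Schwartz_cdom1 _ fS.
have N0 p : 0 <= fine (snorm p.1 p.2 f).
  have [_ H] := snormP p.1 p.2 _ fS; apply: le_trans (H 0).
  by rewrite mulr_ge0 ?exprn_ge0 ?addr_ge0 ?cnorm_ge0.
have D0 : 0 <= decayN f by apply: sumr_ge0.
have NA (A : {set 'I_d}) : fine (snorm (dbl (enum A)) (2 * d) f) <= decayN f.
  rewrite /decayN /decayF big_map big_enum /= (bigD1 A)//= lerDl.
  by apply: sumr_ge0 => B _; exact: (N0 (_, _)).
have [[sR sI] _] := fS.
apply: (icheck_decay M); [exact: cdom1_cdom|by rewrite mulr_ge0|].
move=> A h h01 x; rewrite DD_rDD (le_trans (cnorm_ReIm _))//=.
have W s y : s = dbl (enum A) -> cpder_norm s f y <= decayN f * wt y.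
  by move=> ->; rewrite (le_trans (cpder_wt _ _ _ fS))// ler_wpM2r ?wt_ge0.
have bR := rDD_bound h (enum A) _ (decayN f) h01 sR (fun y => le_trans (cpder_Re _ _ _) (W _ y erefl)) x.
have bI := rDD_bound h (enum A) _ (decayN f) h01 sI (fun y => le_trans (cpder_Im _ _ _) (W _ y erefl)) x.
by rewrite (le_trans (lerD bR bI))// le_eqVlt (_ : _ == _ = true)//; apply/eqP; ring.
Qed.

End SchwartzDecay.

(** * The Fejer kernel on an equispaced grid *)

Section Fejer.
Context {R : realType}.
Local Notation C := R[i].

Definition wave (s : R) : C := expi (2 * pi * s).

Lemma cnorm_wave_sub1 s : cnorm (wave s - 1) ^+ 2 = 2 - 2 * cos (2 * pi * s).
Proof.
rewrite /cnorm sqr_sqrtr ?addr_ge0 ?sqr_ge0// /wave !(ReD,ImD,ReN,ImN)/=.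
have := cos2Dsin2 (2 * pi * s); set c := cos _; set t := sin _ => H.
rewrite subr0 (_ : _ + _ = (c ^+ 2 + t ^+ 2) + 1 - 2 * c); last by ring.
by rewrite H; ring.
Qed.

(** The squared distance between 1 and [wave dl], a lower bound for that of [wave s] when [s] is at
    least [dl] away from the integers 0, 1 and -1 and [|s| <= 1]. *)
Definition gap (dl : R) : R := 2 - 2 * cos (2 * pi * dl).

Lemma gap_gt0 dl : 0 < dl <= 2^-1 -> 0 < gap dl.
Proof.
move=> /andP[d0 d1]; have p0 := pi_gt0 R.
have : cos (2 * pi * dl) < cos 0.
  rewrite ltr_cos ?in_itv/= ?lexx ?pi_ge0//; first by rewrite !mulr_gt0.
  rewrite !mulr_ge0 ?pi_ge0 ?(ltW d0)//= mulrAC ler_piMl ?pi_ge0//; lra.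
by rewrite cos0 /gap => H; lra.
Qed.

(** By evenness and the reflection of [t] to [1 - t], the argument may be taken in [[dl, 1/2]],
    where the cosine of [2 pi t] decreases. *)
Lemma gap_le dl s : 0 < dl <= 2^-1 -> dl <= `|s| <= 1 - dl -> gap dl <= cnorm (wave s - 1) ^+ 2.
Proof.
move=> /andP[d0 d1]; have p0 := pi_gt0 R; rewrite cnorm_wave_sub1.
have -> : cos (2 * pi * s) = cos (2 * pi * `|s|).
  by rewrite -[LHS]cos_norm normrM ger0_norm// mulr_ge0// pi_ge0.
move: (`|s|) => t /andP[t0 t1].
suff H : cos (2 * pi * t) <= cos (2 * pi * dl) by rewrite /gap; lra.
have cmono (a b : R) : 0 <= a -> a <= b -> b <= 2^-1 -> cos (2 * pi * b) <= cos (2 * pi * a).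
  move=> a0 ab b1; have b0 := le_trans a0 ab.
  have pE (c : R) : c <= 2^-1 -> 2 * pi * c <= pi.
    by move=> c1; rewrite mulrAC ler_piMl ?pi_ge0//; lra.
  have := ab; rewrite le_eqVlt => /orP[/eqP -> //|ab'].
  have a1 : 2 * pi * a <= pi by apply: pE; exact: le_trans b1.
  have b2 : 2 * pi * b <= pi by exact: pE.
  have a2 : 0 <= 2 * pi * a by rewrite !mulr_ge0 ?pi_ge0.
  have b3 : 0 <= 2 * pi * b by rewrite !mulr_ge0 ?pi_ge0.
  by apply/ltW; rewrite ltr_cos ?in_itv/= ?a1 ?a2 ?b2 ?b3// ltr_pM2l// mulr_gt0.
have [th|th] := leP t 2^-1; first by apply: cmono => //; exact: ltW.
have -> : cos (2 * pi * t) = cos (2 * pi * (1 - t)).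
  rewrite -cosN (_ : 2 * pi * (1 - t) = - (2 * pi * t) + pi *+ 2) ?cosD2pi//.
  by rewrite mulr2n; ring.
apply: cmono; lra.
Qed.

Lemma waveD s t : wave (s + t) = wave s * wave t.
Proof. by rewrite /wave mulrDr expiD. Qed.

Lemma waveN s : wave (- s) = Num.conj (wave s).
Proof. by rewrite /wave mulrN expiN. Qed.

Lemma waveMn s n : wave (n%:R * s) = wave s ^+ n.
Proof. by rewrite /wave mulrCA [n%:R * _]mulr_natl expiMn. Qed.

Lemma cnorm_wave s : cnorm (wave s) = 1.
Proof. exact: cnorm_expi. Qed.

Definition dker (n : nat) (s : R) : C := \sum_(j < n) wave (j%:R * s).

(** The classical Fejer kernel divided by [n]: with this normalisation its [n] equispaced translates
    sum to 1. *)
Definition fejer (n : nat) (s : R) : R := (n%:R ^- 2) * cnorm (dker n s) ^+ 2.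

Lemma fejer_ge0 n s : 0 <= fejer n s.
Proof. by rewrite mulr_ge0 ?invr_ge0 ?exprn_ge0 ?cnorm_ge0. Qed.

(** The geometric sum turns [dker n s * (wave s - 1)] into [wave s ^+ n - 1], of modulus at most 2;
    this is the origin of the 4. *)
Lemma fejer_far n s dl : 0 < dl <= 2^-1 -> dl <= `|s| <= 1 - dl ->
  fejer n s <= 4 / (n%:R ^+ 2 * gap dl).
Proof.
move=> hd hs; have g0 := gap_gt0 _ hd; have gs := gap_le _ _ hd hs.
rewrite invfM mulrCA /fejer; apply: ler_wpM2l; first by rewrite invr_ge0 exprn_ge0.
rewrite ler_pdivlMr// (le_trans (ler_wpM2l (sqr_ge0 _) gs))// -exprMn -cnormM.
have -> : dker n s * (wave s - 1) = wave s ^+ n - 1.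
  by rewrite subrX1 mulrC; congr (_ * _); apply: eq_bigr => j _; rewrite waveMn.
rewrite (_ : 4 = 2 ^+ 2 :> R); last by rewrite -natrX.
rewrite lerXn2r ?nnegrE ?cnorm_ge0// (le_trans (cnormD _ _))// cnormN cnorm1 -waveMn cnorm_wave.
by rewrite mulr2n.
Qed.

Lemma wave_geom n (k : R) : wave k ^+ n = 1 -> wave k != 1 -> \sum_(m < n) wave k ^+ m = 0.
Proof.
move=> kn k1; have := subrX1 (wave k) n; rewrite kn subrr => /esym/eqP.
by rewrite mulf_eq0 subr_eq0 (negPf k1) => /eqP.
Qed.

Lemma wave_neq1 s : 0 < `|s| < 1 -> wave s != 1.
Proof.
move=> /andP[s0 s1]; apply/eqP => H.
have h1 : 0 < Num.min `|s| (1 - `|s|) <= 2^-1.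
  by rewrite lt_min s0 subr_gt0 s1 ge_min /=; apply/orP; have [h|h] := leP `|s| 2^-1; [left|right; lra].
have h2 : Num.min `|s| (1 - `|s|) <= `|s| <= 1 - Num.min `|s| (1 - `|s|).
  by rewrite ge_min lexx /= lerBrDl -lerBrDr ge_min lexx orbT.
have := lt_le_trans (gap_gt0 _ h1) (gap_le _ _ h1 h2).
by rewrite H subrr cnorm0 expr0n ltxx.
Qed.

(** In the expansion of [|dker|^2] as a double sum over [j], [l], summation over the grid
    annihilates every term with [l != j], since [n]-th roots of unity other than 1 have vanishing
    power sums. The diagonal contributes [n * n]. *)
Lemma fejer_sum n s : (0 < n)%N -> \sum_(m < n) fejer n (s - m%:R / n%:R) = 1.
Proof.
move=> n0; have n0' : n%:R != 0 :> R by rewrite pnatr_eq0 -lt0n.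
apply: (@complexI R); rewrite rmorph_sum /=.
pose q (j l : 'I_n) : R := - ((j%:R - l%:R) / n%:R).
have E (m : 'I_n) : (fejer n (s - m%:R / n%:R))%:C%C = (n%:R ^- 2)%:C%C *
    \sum_(j < n) \sum_(l < n) wave ((j%:R - l%:R) * s) * wave (q j l) ^+ m.
  rewrite /fejer rmorphM /= cnorm_sqrE; congr (_ * _).
  rewrite /dker rmorph_sum mulr_suml; apply: eq_bigr => j _.
  rewrite mulr_sumr; apply: eq_bigr => l _.
  transitivity (wave (j%:R * (s - m%:R / n%:R)) * wave (- (l%:R * (s - m%:R / n%:R)))).
    by rewrite waveN.
  by rewrite -waveMn -!waveD; congr wave; rewrite /q; field.
rewrite (eq_bigr _ (fun m _ => E m)) -mulr_sumr exchange_big /=.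
rewrite (eq_bigr (fun=> n%:R)) => [|j _].
  have nC : (n%:R : C) = (n%:R : R)%:C%C by rewrite rmorph_nat.
  rewrite sumr_const card_ord -[n%:R *+ n]mulr_natr nC -!rmorphM /=; congr (_%:C%C).
  by field.
rewrite exchange_big (bigD1 j)//= [X in _ + X]big1 => [|l lj]; last first.
  rewrite -mulr_sumr wave_geom ?mulr0//.
    rewrite -waveMn /q (_ : n%:R * _ = l%:R * 1 - j%:R * 1); last by field.
    rewrite waveD waveN !waveMn (_ : wave 1 = 1) ?expr1n ?rmorph1 ?mul1r//.
    by rewrite /wave mulr1 /expi mulr_natl cos2pi -[pi *+ 2]add0r sinD2pi sin0.
  apply: wave_neq1; rewrite /q normrN normrM normfV (ger0_norm (ler0n _ n)).
  have nn : 0 < n%:R :> R by rewrite ltr0n.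
  rewrite ltr_pdivrMr// mul1r divr_gt0 ?normr_gt0 ?subr_eq0 ?eqr_nat//=; last by rewrite eq_sym.
  have := ltn_ord j; have := ltn_ord l; rewrite -!(ltr_nat R) => h1 h2.
  have := ler0n R j; have := ler0n R l; rewrite ltr_norml; lra.
rewrite addr0 (eq_bigr (fun=> 1)) => [|m _]; first by rewrite sumr_const card_ord.
by rewrite /q subrr mul0r mul0r oppr0 /wave mulr0 expi0 expr1n mulr1.
Qed.

End Fejer.

(** * Approximation by trigonometric polynomials *)

Section TrigApprox.
Context {R : realType} {d : nat}.
Local Notation V := 'rV[R]_d.
Local Notation C := R[i].

(** Trigonometric polynomials enter only through this property: multiplying by them preserves
    transforms of [S0] functions. It holds for characters and is stable under sums and products, so
    no coefficients need to be tracked. *)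
Definition mult (P : V -> C) := forall f : V -> C, S0 f ->
  exists2 f', S0 f' & forall y, icheck f' y = P y * icheck f y.

Lemma S0_cdom (f : V -> C) : S0 f -> exists M, cdom M f.
Proof. by move=> fS; exact/Cc_cdom/S0_Cc. Qed.

Lemma mult_ee (a : V) : mult (ee a).
Proof.
move=> f fS; have [M fM] := S0_cdom _ fS.
exists (fun x => f (x - a)) => [|y]; first exact: S0_shift.
by rewrite (icheck_shift _ _ _ _ fM) eeC.
Qed.

Lemma mult_cst (c : C) : mult (fun=> c).
Proof.
move=> f fS; have [M fM] := S0_cdom _ fS.
by exists (fun x => c * f x) => [|y]; [exact: S0_Z|exact: icheckZ fM].
Qed.

Lemma multD (P Q : V -> C) : mult P -> mult Q -> mult (fun y => P y + Q y).
Proof.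
move=> mP mQ f fS; have [f1 S1 E1] := mP f fS; have [f2 S2 E2] := mQ f fS.
have [M1 D1] := S0_cdom _ S1; have [M2 D2] := S0_cdom _ S2.
exists (fun x => f1 x + f2 x) => [|y]; first exact: S0_D.
by rewrite (icheckD _ _ _ _ _ D1 D2) E1 E2 mulrDl.
Qed.

Lemma multM (P Q : V -> C) : mult P -> mult Q -> mult (fun y => P y * Q y).
Proof.
move=> mP mQ f fS; have [f1 S1 E1] := mQ f fS; have [f2 S2 E2] := mP f1 S1.
by exists f2 => // y; rewrite E2 E1 mulrA.
Qed.

Lemma mult_sum (I : finType) (F : I -> V -> C) : (forall i, mult (F i)) ->
  mult (fun y => \sum_i F i y).
Proof.
move=> FS; elim: (index_enum I) => [|i s IH].
  by under eq_fun do rewrite big_nil; exact: mult_cst.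
by under eq_fun do rewrite big_cons; exact: multD.
Qed.

Lemma mult_prod (I : finType) (F : I -> V -> C) : (forall i, mult (F i)) ->
  mult (fun y => \prod_i F i y).
Proof.
move=> FS; elim: (index_enum I) => [|i s IH].
  by under eq_fun do rewrite big_nil; exact: mult_cst.
by under eq_fun do rewrite big_cons; exact: multM.
Qed.

Lemma mult_fejer n i (T b : R) : mult (fun y => (fejer n (y 0 i / T + b))%:C%C).
Proof.
pose S y := dker n ((y : V) 0 i / T + b).
have wE j (y : V) : wave (j%:R * (y 0 i / T + b)) = wave (j%:R * b) * ee ((j%:R / T) *: ebase i) y.
  have E := dotv_ebase y (j%:R / T) i.
  by rewrite eeC /ee E -/(wave _) -waveD; congr wave; ring.
have mS : mult S.
  rewrite (_ : S = fun y => \sum_(j < n) (wave (j%:R * b) * ee ((j%:R / T) *: ebase i) y)); last first.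
    by apply/funext => y; apply: eq_bigr => j _; rewrite wE.
  by apply: mult_sum => j; apply: multM; [exact: mult_cst|exact: mult_ee].
have mS' : mult (fun y => Num.conj (S y)).
  rewrite (_ : (fun y => _) = fun y => \sum_(j < n) (Num.conj (wave (j%:R * b)) * ee (- ((j%:R / T) *: ebase i)) y)); last first.
    by apply/funext => y; rewrite rmorph_sum; apply: eq_bigr => j _; rewrite wE rmorphM /= eeNl.
  by apply: mult_sum => j; apply: multM; [exact: mult_cst|exact: mult_ee].
rewrite (_ : (fun y => _) = fun y => (n%:R ^- 2)%:C%C * (S y * Num.conj (S y))).
  by apply: multM; [exact: mult_cst|exact: multM].
by apply/funext => y; rewrite /fejer rmorphM /= cnorm_sqrE.
Qed.

(* Fejer interpolation on a period cube four times larger than the cube where the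
   approximation is needed; the interpolant has the same sup bound as [u]. *)
Lemma trig_approx (u : V -> C) (U L e : R) : Cc u -> (forall y, cnorm (u y) <= U) -> 0 < L -> 0 < e ->
  exists2 P, mult P & (forall y, cnorm (P y) <= U) /\ forall y, `|y| <= L -> cnorm (P y - u y) <= e.
Proof.
move=> uc uU L0 e0; have U0 : 0 <= U := le_trans (cnorm_ge0 _) (uU 0).
have [D D0 DP] := Cc_uniform_continuous _ uc (e / 2) (divr_gt0 e0 (ltr0n _ 2)).
(* For [|y| <= L] the rescaled coordinates satisfy [|y_i / T| <= 1/4] and the grid offsets lie in
   [[-1/2, 1/2]], so the kernel arguments stay within [3/4 <= 1 - dl], as [fejer_far] demands. The
   second bound on [dl] makes nodes close to [y] fall within the scale [D / 2]. *)
pose T := 4 * L; have T0 : 0 < T by rewrite mulr_gt0.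
pose dl := Num.min 4^-1 (D / (2 * T)).
have hd : 0 < dl <= 2^-1.
  rewrite lt_min invr_gt0 ltr0n divr_gt0 ?mulr_gt0//= ge_min; apply/orP; left; lra.
have dl4 : dl <= 4^-1 by rewrite ge_min lexx.
have dlT : dl * T <= D / 2.
  rewrite -ler_pdivlMr// (le_trans (_ : _ <= D / (2 * T))) ?ge_min ?lexx ?orbT//.
  by rewrite invfM mulrA.
have g0 := gap_gt0 _ hd.
(* A far node costs at most [2 U]. For each of the [d] coordinates, the [n] grid points contribute
   in total at most [n * 4 / (n^2 gap)], so the far part is at most [A / n]. *)
pose A := 2 * U * d%:R * (4 / gap dl).
have A0 : 0 <= A by apply: mulr_ge0; [rewrite !mulr_ge0|rewrite divr_ge0// ltW].
pose n := (Num.truncn (2 * A / e)).+1.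
have nA : A / n%:R <= e / 2.
  have : 2 * A / e < n%:R by exact: truncnS_gt.
  rewrite ltr_pdivrMr// => /ltW H; rewrite ler_pdivrMr ?ltr0n//.
  by rewrite -(ler_pM2l (ltr0n _ 2 : 0 < 2%:R :> R)) (le_trans H)// le_eqVlt (_ : _ == _ = true)//; apply/eqP; field.
have n0 : 0 < n%:R :> R by rewrite ltr0n.
pose b (m : 'I_n) : R := 2^-1 - m%:R / n%:R.
pose sc (m : 'I_n) (t : R) := t / T + b m.
(* These are the points at which all the arguments [sc (k i)] vanish, that is, where the kernel
   [K k] peaks. *)
pose node (k : {ffun 'I_d -> 'I_n}) : V := \row_i (- (T * b (k i))).
pose K (k : {ffun 'I_d -> 'I_n}) (y : V) : R := \prod_i fejer n (sc (k i) (y 0 i)).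
have K0 k y : 0 <= K k y by apply: prodr_ge0 => i _; exact: fejer_ge0.
have S1 t : \sum_(m < n) fejer n (sc m t) = 1.
  rewrite -[RHS](fejer_sum n (t / T + 2^-1))//; apply: eq_bigr => m _; congr fejer.
  by rewrite /sc /b addrA.
have KS y : \sum_k K k y = 1.
  by rewrite (sum_prod_ffun _ (fun m t => fejer n (sc m t))) big1.
exists (fun y => \sum_k u (node k) * (K k y)%:C%C); last split.
- apply: mult_sum => k; apply: multM; first exact: mult_cst.
  rewrite (_ : (fun y => _) = fun y : V => \prod_i (fejer n (sc (k i) (y 0 i)))%:C%C).
    by apply: mult_prod => i; exact: mult_fejer.
  by apply/funext => y; rewrite rmorph_prod.
- move=> y; rewrite (le_trans (cnorm_sum _ _))// -[leRHS]mulr1 -(KS y) mulr_sumr.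
  apply: ler_sum => k _; rewrite cnormM cnorm_real (ger0_norm (K0 _ _)).
  by rewrite ler_wpM2r.
(* If no coordinate is far, uniform continuity bounds the error by [e / 2]; otherwise the sum of the
   indicators [far] is at least 1 and pays for the trivial bound [2 U]. *)
move=> y yL; pose far i (m : 'I_n) : R := if dl <= `|sc m (y 0 i)| then 1 else 0.
have uy : u y = \sum_k u y * (K k y)%:C%C by rewrite -mulr_sumr -rmorph_sum /= KS mulr1.
rewrite uy -sumrB (le_trans (cnorm_sum _ _))//.
have B k : cnorm (u (node k) - u y) <= e / 2 + 2 * U * \sum_i far i (k i).
  have far0 i m : 0 <= far i m by rewrite /far; case: ifP.
  have S0 : 0 <= \sum_i far i (k i) by apply: sumr_ge0.
  have [/existsP[i hi]|/existsPn H] := boolP [exists i, dl <= `|sc (k i) (y 0 i)|].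
    rewrite (le_trans (cnormD _ _))// cnormN.
    have F1 : 1 <= \sum_i far i (k i).
      by rewrite (bigD1 i)//= {1}/far hi lerDl sumr_ge0.
    have := uU (node k); have := uU y.
    have := ler_wpM2l (mulr_ge0 (ler0n _ 2) U0) F1; rewrite mulr1; lra.
  apply: (@le_trans _ _ (e / 2)); last by rewrite lerDl !mulr_ge0.
  apply/ltW/DP; apply: (@le_lt_trans _ _ (D / 2)); last by rewrite ltr_pdivrMr// ltr_pMr// ltr1n.
  apply: normr_rV_le => [|i]; first by rewrite divr_ge0// ltW.
  have := H i; rewrite -ltNge => /ltW; rewrite !mxE => Hi.
  rewrite distrC opprK (_ : y 0 i + T * b (k i) = sc (k i) (y 0 i) * T); last first.
    by rewrite /sc mulrDl divfK ?gt_eqF// (mulrC T).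
  by rewrite normrM (gtr0_norm T0) (le_trans _ dlT)// ler_wpM2r// ltW.
apply: (@le_trans _ _ (\sum_k (e / 2 * K k y + 2 * U * \sum_i far i (k i) * K k y))).
  apply: ler_sum => k _; rewrite -mulrBl cnormM cnorm_real (ger0_norm (K0 _ _)).
  by rewrite -mulr_suml mulrA -mulrDl ler_wpM2r.
rewrite big_split /= -!mulr_sumr KS mulr1 exchange_big /= [leRHS](splitr e) lerD2l.
rewrite (le_trans _ nA)// /A -!mulrA ler_wpM2l// ler_wpM2l//.
rewrite mulr_natl -[X in _ *+ X](card_ord d) -sumr_const; apply: ler_sum => i _.
have -> : \sum_(k : {ffun 'I_d -> 'I_n}) far i (k i) * K k y = \sum_(k : {ffun 'I_d -> 'I_n}) \prod_j ((if j == i then far i (k j) else 1) * fejer n (sc (k j) (y 0 j))).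
  apply: eq_bigr => k _; rewrite big_split /=; congr (_ * _).
  by rewrite -big_mkcond big_pred1_eq.
(* The sum over grid points factors by coordinates; those other than [i] sum to 1, leaving a
   one-dimensional far sum. *)
rewrite -(bigA_distr_bigA (fun j (m : 'I_n) => (if j == i then far i m else 1) * fejer n (sc m (y 0 j)))) /=.
rewrite (bigD1 i)//= eqxx [X in _ * X]big1 ?mulr1 => [|j ji]; last first.
  by rewrite (negPf ji) -[RHS](S1 (y 0 j)); apply: eq_bigr => m _; rewrite mul1r.
rewrite [leRHS](_ : _ = \sum_(m < n) (4 / (n%:R ^+ 2 * gap dl))); last first.
  by rewrite sumr_const card_ord -mulr_natr; field; rewrite !gt_eqF.
apply: ler_sum => m _; rewrite /far; case: ifP => [hm|_]; last first.
  by rewrite mul0r divr_ge0// mulr_ge0 ?exprn_ge0 ?(ltW g0)// ltW.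
rewrite mul1r; apply: fejer_far => //; rewrite hm /=.
have yi : `|y 0 i / T| <= 4^-1.
  rewrite normrM normfV (gtr0_norm T0) ler_pdivrMr// /T mulrA mulVf ?mul1r//.
  exact: le_trans (normr_coord y i) yL.
have m1 : 0 <= m%:R / n%:R :> R by rewrite divr_ge0.
have m2 : m%:R / n%:R <= 1 :> R by rewrite ler_pdivrMr// mul1r ler_nat ltnW.
rewrite /sc /b ler_norml; move: yi; rewrite ler_norml => /andP[y1 y2].
clear -y1 y2 m1 m2 dl4; apply/andP; split; lra.
Qed.

End TrigApprox.

(** * Density of transforms, Riemann sums of translates, and the convolution theorem *)

Section Density.
Context {R : realType} {d : nat}.
Local Notation V := 'rV[R]_d.
Local Notation C := R[i].
Local Notation conv := Defs.conv.

Lemma S0_decay (f : V -> C) : S0 f -> exists2 K : R, 0 <= K & forall y, cnorm (icheck f y) <= K * wt y.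
Proof.
move=> /S0_Schwartz/icheck_Schwartz H; have [K HK] : exists K, forall y, cnorm (icheck f y) <= K * wt y by eexists; exact: H.
exists K => //.
by have := le_trans (cnorm_ge0 _) (HK 0); rewrite pmulr_lge0// wt_gt0.
Qed.

(** The bump [chi] is so narrow that [|chi^| >= 1/2] on the support of [g]; thus [g = u chi^] with
    [u] in C_c. Replacing [u] by a multiplier [P] with the same sup bound gives the transform of an
    [S0] function, and the decay of [chi^] dominates the error outside the ball where [P] is close
    to [u]. *)
Lemma S0_icheck_dense (g : V -> C) (e : R) : Cc g -> 0 < e ->
  exists2 f, S0 f & amalg (fun y => cnorm (g y - icheck f y)) e.
Proof.
move=> gc e0; have [L L0 gL] := Cc_bounded_supp _ gc.
pose k : R := 8 * pi * d%:R * L + 1.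
have k0 : 0 < k by rewrite ltr_wpDl// !mulr_ge0 ?pi_ge0// ltW.
have e10 : 0 < (2 * k)^-1 by rewrite invr_gt0 mulr_gt0.
have [chi chib [chiS _]] := bump_exists (d := d) _ e10.
have [K K0 KP] := S0_decay _ chiS.
have chic := Cc_ccont_icheck _ (S0_Cc _ chiS).
(* The maximum with [1/4 = (1/2)^2] keeps the quotient continuous everywhere without changing it on
   the support of [g]. *)
pose m y := Num.max (cnorm (icheck chi y) ^+ 2) 4^-1.
have m0 y : 0 < m y by rewrite lt_max invr_gt0 ltr0n orbT.
have cm : continuous m.
  move=> y; apply: (@continuous_max _ V (fun y => cnorm (icheck chi y) ^+ 2) (fun=> 4^-1)).
    by apply: continuousMR; exact: ccont_cnorm.
  exact: cst_continuous.
pose u y := ((m y)^-1)%:C%C * Num.conj (icheck chi y) * g y.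
have uc : Cc u.
  apply: CcMl => //; apply: ccontM; last exact: ccont_conj.
  by apply: ccont_real => y; exact: (cvgV (lt0r_neq0 (m0 y)) (cm y)).
have ug y : u y * icheck chi y = g y.
  have [yL|/gL gy0] := leP `|y| L; last by rewrite /u gy0 mulr0 mul0r.
  have half : 2^-1 <= cnorm (icheck chi y).
    have := icheck_bump_dist _ _ y chib (ltW e10) => H.
    have : 8 * pi * d%:R * (2 * k)^-1 * `|y| <= 2^-1.
      rewrite mulrAC ler_pdivrMr ?mulr_gt0// mulrA mulVf ?pnatr_eq0// mul1r /k.
      by rewrite (le_trans (ler_wpM2l _ yL)) ?lerDl// !mulr_ge0 ?pi_ge0.
    have := cdist_triangle (icheck chi y) 1 0; rewrite !subr0 cnorm1 cdistC; lra.
  have mE : m y = cnorm (icheck chi y) ^+ 2.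
    rewrite /m max_l// (_ : 4^-1 = 2^-1 ^+ 2); last by rewrite exprVn -natrX.
    by rewrite lerXn2r ?nnegrE// ?cnorm_ge0// invr_ge0.
  rewrite /u (_ : _ * icheck chi y = ((m y)^-1)%:C%C * (icheck chi y * Num.conj (icheck chi y)) * g y); last by ring.
  by rewrite -cnorm_sqrE -mE -rmorphM mulVf ?mul1r// gt_eqF.
have [U U0 UP] := Cc_bounded _ uc.
pose G (y : V) : R := 2 * U * K * wt y.
have G0 y : 0 <= G y by rewrite !mulr_ge0 ?wt_ge0// ltW.
have GA : amalg G (2 * U * K * 32 ^+ d).
  by apply: amalgZ; [rewrite !mulr_ge0// ltW|exact: amalg_wt].
have [Y Y0 [D D0 DP]] := amalg_small _ _ _ G0 GA e0.
have [P Pm [PU PY]] := trig_approx u U Y (D * (2 * U)) uc UP Y0 (mulr_gt0 D0 (mulr_gt0 (ltr0n _ 2) U0)).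
have [f fS fE] := Pm _ chiS.
have E y : cnorm (g y - icheck f y) = cnorm (P y - u y) * cnorm (icheck chi y).
  by rewrite fE -ug -mulrBl cnormM cdistC.
exists f => //; apply: DP => [y|y yY]; rewrite E.
  rewrite mulr_ge0 ?cnorm_ge0//= /G -mulrA; apply: ler_pM; rewrite ?cnorm_ge0//.
  by rewrite (le_trans (cnormD _ _))// cnormN mulr2n mulrDl mul1r lerD.
rewrite /G -mulrA mulrA; apply: ler_pM; rewrite ?cnorm_ge0//; exact: PY.
Qed.

(** The weights are the integrals of [h] against a partition of unity of mesh [dl]. What matters is
    that [A] and [L] do not depend on [dl]: the sums stay dominated as the mesh shrinks. *)
Lemma riemann_sum (h : V -> C) : Cc h -> exists2 A : R, 0 < A & exists2 L : R, 0 < L &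
  forall dl : R, 0 < dl -> exists (I : finType) (c : I -> C) (a : I -> V),
    \sum_i cnorm (c i) <= A /\ (forall i, L + dl < `|a i| -> c i = 0) /\
    forall (F : V -> C) (w : R), ccont F -> (forall x z, `|x - z| <= dl -> cnorm (F x - F z) <= w) ->
      cnorm (lint (fun x => h x * F x) - \sum_i c i * F (a i)) <= A * w.
Proof.
move=> hc; have [L L0 hL] := Cc_bounded_supp _ hc; have [M hM] := Cc_cdom _ hc.
have M0 := cdom_ge0 _ _ hM.
pose A := 2 * (M * Lam (R:=R) (d:=d)) + 1.
have LL : 0 <= 2 * (M * Lam (R:=R) (d:=d)) by rewrite !mulr_ge0 ?Lam_ge0.
exists A; first by rewrite ltr_wpDl.
exists L => // dl dl0.
pose N := (Num.truncn (L / dl)).+1.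
have LN : L / dl <= N%:R by apply/ltW; exact: truncnS_gt.
pose I := {ffun 'I_d -> 'I_(N.*2.+1)}.
pose t (k : I) (x : V) : R := tau N k (dl^-1 *: x).
pose a (k : I) : V := dl *: cellc N k.
have t0 k x : 0 <= t k x by exact: tau_ge0.
have ct k : continuous (t k).
  rewrite (_ : t k = fun x : V => \prod_i tent (dl^-1 * x 0 i - (cellc N k : V) 0 i)).
    apply: (continuous_prod_coord (fun i s => tent (dl^-1 * s - (cellc N k : V) 0 i))) => i.
    apply: (@continuous_compR R R R (fun s => dl^-1 * s - (cellc N k : V) 0 i) tent); last exact: continuous_tent.
    apply: continuousBR; last by move=> s; exact: cst_continuous.
    by apply: continuousZR => s; exact: cvg_id.
  by apply/funext => x; apply: eq_bigr => i _; rewrite !mxE.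
have tS x : `|x| <= L -> \sum_k t k x = 1.
  move=> xL; apply: sum_tau; rewrite (le_trans _ LN)// normrZ gtr0_norm ?invr_gt0// mulrC.
  by rewrite ler_wpM2r// invr_ge0 ltW.
have tE k x : dl < `|x - a k| -> t k x = 0.
  move=> H; apply: tau_eq0; rewrite (_ : _ - _ = dl^-1 *: (x - a k)).
    by rewrite normrZ gtr0_norm ?invr_gt0// mulrC ltr_pdivlMr// mul1r.
  by rewrite scalerBr /a scalerA mulVf ?gt_eqF// scale1r.
pose hk k x := (t k x)%:C%C * h x.
have hkc k : Cc (hk k) by apply: CcMl => //; exact: ccont_real.
have [m mP] : exists m : I -> R, forall k, cdom (m k) (hk k).
  by have [m mP] := choice (fun k => Cc_cdom _ (hkc k)); exists m.
have hE x : h x = \sum_k hk k x.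
  rewrite /hk -mulr_suml -rmorph_sum /=.
  by have [xL|/hL ->] := leP `|x| L; rewrite ?mulr0// tS// mul1r.
have tH x : \sum_k t k x * cnorm (h x) = cnorm (h x).
  rewrite -mulr_suml.
  by have [xL|/hL ->] := leP `|x| L; rewrite ?cnorm0 ?mulr0// tS// mul1r.
exists I, (fun k => lint (hk k)), a; split; [|split].
- pose H x := (cnorm (h x))%:C%C : C.
  have Hc : Cc H.
    apply: (CcI _ L) => // [|x /hL hx]; first by apply/ccont_real/ccont_cnorm; have [] := hc.
    by rewrite /H hx cnorm0.
  have HkE k : (fun x => (t k x)%:C%C * H x) = fun x => (t k x * cnorm (h x))%:C%C.
    by apply/funext => x; rewrite rmorphM.
  have Hkc k : Cc (fun x => (t k x * cnorm (h x))%:C%C).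
    by rewrite -HkE; apply: CcMl => //; exact: ccont_real.
  have [m' mP'] := choice (fun k => Cc_cdom _ (Hkc k)).
  apply: (@le_trans _ _ (\sum_k 2 * rlint (fun x => t k x * cnorm (h x)))).
    apply: ler_sum => k _; apply: (lint_le _ _ _ _ (mP k) (cdom_Re _ _ (mP' k))) => x /=.
    by rewrite /hk cnorm_realM.
  rewrite -mulr_sumr.
  have -> : \sum_k rlint (fun x => t k x * cnorm (h x)) = rlint (fun x => cnorm (h x)).
    apply: (@complexI R); rewrite rmorph_sum /= -lint_real.
    rewrite (eq_bigr _ (fun k _ => esym (lint_real _))) -(lint_sum _ _ _ mP').
    by congr lint; apply/funext => x; rewrite -rmorph_sum /= tH.
  have [M' HM'] := Cc_cdom _ Hc.
  have hR : rdom 0 M (fun x => cnorm (h x)).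
    by split; [apply: ccont_cnorm; have [] := hc|move=> x; rewrite ger0_norm ?cnorm_ge0//; case: hM].
  rewrite (@le_trans _ _ (2 * (M * Lam (R:=R) (d:=d))))// ?lerDl// ler_wpM2l//.
  exact: le_trans (ler_norm _) (rlint_bound _ _ hR).
- move=> k ka; rewrite -[RHS](lint0 (R:=R) (d:=d)); congr lint; apply/funext => x.
  have [xL|/hL hx] := leP `|x| L; last by rewrite /hk hx mulr0.
  rewrite /hk tE ?mul0r//; have := ler_distD x (a k) 0; rewrite !subr0 distrC; lra.
move=> F w cF Fw; have w0 : 0 <= w by rewrite (le_trans (cnorm_ge0 _) (Fw 0 0 _))// subrr normr0 ltW.
have [M' hF] : exists M', cdom M' (fun x => h x * F x).
  apply: Cc_cdom; have := CcMl F h cF hc.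
  by rewrite (eq_fun (fun x => mulrC (F x) (h x))).
have hkF k := cdomZ (F (a k)) _ _ (mP k).
have -> : lint (fun x => h x * F x) - \sum_k lint (hk k) * F (a k) =
    lint (fun x => h x * F x - \sum_k F (a k) * hk k x).
  rewrite (lintB _ _ _ _ hF (cdom_sum _ _ _ hkF)) (lint_sum _ _ _ hkF); congr (_ - _).
  by apply: eq_bigr => k _; rewrite (lintZ _ _ _ (mP k)) mulrC.
have [cG _] := cdomB _ _ _ _ hF (cdom_sum _ _ _ hkF).
apply: (@le_trans _ _ (2 * (w * M * Lam (R:=R) (d:=d)))); last first.
  rewrite (_ : A * w = 2 * (w * M * Lam (R:=R) (d:=d)) + w) ?lerDl// /A; ring.
apply: lint_bound; split=> // x.
have -> : h x * F x - \sum_k F (a k) * hk k x = \sum_k hk k x * (F x - F (a k)).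
  by rewrite {1}hE mulr_suml -sumrB; apply: eq_bigr => k _; ring.
rewrite (le_trans (cnorm_sum _ _))//.
apply: (@le_trans _ _ (\sum_k w * (t k x * cnorm (h x)))).
  apply: ler_sum => k _; rewrite cnormM /hk cnorm_realM// mulrC.
  have [xa|/tE ->] := leP `|x - a k| dl; last by rewrite mul0r !mulr0.
  by apply: ler_wpM2r; [rewrite mulr_ge0 ?cnorm_ge0|exact: Fw].
by rewrite -mulr_sumr tH -mulrA ler_wpM2l//; case: hM.
Qed.

(** The same weights and points serve both sides of the transform: they approximate [h * g] by
    translates of [g], uniformly and with fixed support, and [h^] by a trigonometric polynomial,
    locally uniformly. *)
Lemma conv_approx (h g : V -> C) : Cc h -> Cc g -> exists2 A : R, 0 < A & exists2 L : R, 0 < L &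
  forall e Y : R, 0 < e -> 0 < Y -> exists (I : finType) (c : I -> C) (a : I -> V),
    [/\ forall y, cnorm (\sum_i c i * ee (a i) y) <= A,
        forall x, L < `|x| -> \sum_i c i * g (x - a i) = 0,
        forall x, cnorm (conv h g x - \sum_i c i * g (x - a i)) <= e &
        forall y, `|y| <= Y -> cnorm (icheck h y - \sum_i c i * ee (a i) y) <= e].
Proof.
move=> hc gc; have [A A0 [L L0 H]] := riemann_sum _ hc.
have [K K0 gK] := Cc_bounded_supp _ gc.
exists A => //; exists (L + 1 + K) => [|e Y e0 Y0]; first by rewrite !addr_gt0.
have [D D0 DP] := Cc_uniform_continuous _ gc (e / A) (divr_gt0 e0 A0).
pose b : R := 4 * pi * d%:R * Y + 1.
have b0 : 0 < b by rewrite ltr_wpDl// !mulr_ge0 ?pi_ge0// ltW.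
pose dl := Num.min 1 (Num.min (D / 2) (e / A / b)).
have dl0 : 0 < dl by rewrite !lt_min ltr01 !divr_gt0.
have dl1 : dl <= 1 by rewrite ge_min lexx.
have dl2 : dl <= D / 2 by rewrite !ge_min lexx orbT.
have dl3 : dl * b <= e / A by rewrite -ler_pdivlMr// !ge_min lexx !orbT.
have [I [c [a [cA [ca HF]]]]] := H dl dl0.
have Ae : A * (e / A) = e by rewrite mulrC divfK ?gt_eqF.
exists I, c, a; split.
- move=> y; rewrite (le_trans (cnorm_sum _ _))// (le_trans _ cA)//.
  by apply: ler_sum => i _; rewrite cnormM cnorm_ee mulr1.
- move=> x xL; apply: big1 => i _; have [ai|/ca ->] := leP `|a i| (L + dl); last by rewrite mul0r.
  by rewrite gK ?mulr0//; have := lerB_dist x (a i); lra.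
- move=> x; rewrite -[leRHS]Ae; apply: HF.
    have := ccont_shift _ x (ccont_opp _ (proj1 gc)).
    by rewrite (eq_fun (fun y => congr1 g (opprB y x))).
  move=> y z yz; apply/ltW/DP; rewrite opprB addrC addrA subrK distrC.
  by rewrite (le_lt_trans yz)// (le_lt_trans dl2)// ltr_pdivrMr// ltr_pMr// ltr1n.
move=> y yY; rewrite -[leRHS]Ae icheckE.
rewrite (eq_bigr (fun i => c i * ee y (a i))) => [|i _]; last by rewrite eeC.
apply: HF; first exact: ccont_ee.
move=> x z xz; rewrite !(eeC y) (le_trans (ee_lipschitz _ _ _))// (le_trans _ dl3)//.
rewrite mulrA mulrC; apply: ler_pM => //; first by rewrite !mulr_ge0 ?pi_ge0.
apply: (@le_trans _ _ (4 * pi * d%:R * Y)); last by rewrite lerDl.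
by rewrite ler_wpM2l// !mulr_ge0 ?pi_ge0.
Qed.

Lemma icheck_trig (g : V -> C) (I : finType) (c : I -> C) (a : I -> V) y : Cc g ->
  icheck (fun x => \sum_i c i * g (x - a i)) y = (\sum_i c i * ee (a i) y) * icheck g y.
Proof.
move=> gc; have [M gM] := Cc_cdom _ gc.
have ga i := cdom_shift _ _ (a i) gM.
rewrite (icheck_sum _ _ _ _ (fun i => cdomZ (c i) _ _ (ga i))) mulr_suml; apply: eq_bigr => i _.
by rewrite (icheckZ _ _ _ _ (ga i)) (icheck_shift _ _ _ _ gM) eeC mulrA.
Qed.

Lemma Cc_trig (g : V -> C) (I : finType) (c : I -> C) (a : I -> V) : Cc g ->
  Cc (fun x => \sum_i c i * g (x - a i)).
Proof. by move=> gc; apply: Cc_sum => i; apply: CcZ; exact: Cc_shift. Qed.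

(** The convolution theorem without interchanging integrals: it is exact for finite sums of
    translates ([icheck_trig]), and both sides are limits of these by [conv_approx]. *)
Lemma icheck_conv (h g : V -> C) : Cc h -> Cc g ->
  forall y, icheck (conv h g) y = icheck h y * icheck g y.
Proof.
move=> hc gc y; have [A A0 [L L0 H]] := conv_approx _ _ hc gc.
have convc := Cc_conv _ _ hc gc; have [K K0 cK] := Cc_bounded_supp _ convc.
pose L' := Num.max L K.
pose B : R := 2 * ((1 + L' ^+ 2) ^+ d * Lam (R:=R) (d:=d)) + cnorm (icheck g y) + 1.
have B1 : 0 <= 2 * ((1 + L' ^+ 2) ^+ d * Lam (R:=R) (d:=d)).
  by rewrite !mulr_ge0 ?Lam_ge0// exprn_ge0// ltW// one_sqr_gt0.
have B0 : 0 < B by rewrite ltr_wpDl// addr_ge0// cnorm_ge0.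
apply/subr0_eq/cnorm_eq0/le_anti; rewrite cnorm_ge0 andbT; apply/ler_addgt0Pr => e e0; rewrite add0r.
have [I [c [a [_ aL aC aI]]]] := H (e / B) (`|y| + 1) (divr_gt0 e0 B0) (ltr_wpDl (normr_ge0 _) ltr01).
pose q x := \sum_i c i * g (x - a i).
have qc : Cc q by exact: Cc_trig.
have [Mc HMc] := Cc_cdom _ convc; have [Mq HMq] := Cc_cdom _ qc.
have eB0 : 0 <= e / B by rewrite divr_ge0// ltW.
have D : cdom (e / B * (1 + L' ^+ 2) ^+ d) (fun x => conv h g x - q x).
  apply: cdom_supp => // [|x].
    by apply: ccontB; [case: convc|case: qc].
  by rewrite gt_max => /andP[xL xK]; rewrite cK// /q aL// subr0.
rewrite (le_trans (cdist_triangle (icheck q y) _ _))//.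
rewrite -(icheckB _ _ _ _ _ HMc HMq).
have b1 := icheck_bound _ _ y D.
have b2 : cnorm (icheck q y - icheck h y * icheck g y) <= e / B * cnorm (icheck g y).
  rewrite icheck_trig// -mulrBl cnormM ler_wpM2r ?cnorm_ge0// cdistC aI//.
  by rewrite lerDl.
rewrite (le_trans (lerD b1 b2))//.
apply: (@le_trans _ _ (e / B * B)); last by rewrite divfK ?gt_eqF.
move: (e / B) eB0 => t t0; rewrite /B !mulrDr mulr1.
rewrite (_ : 2 * (t * _ * _) = t * (2 * ((1 + L' ^+ 2) ^+ d * Lam (R:=R) (d:=d)))); last by ring.
by rewrite lerDl.
Qed.

(** Riemann sums [q] of translates of [chi] are again in [S0], so the hypothesis applies to them. On
    the measure side they are dominated by a multiple of [wt], since the polynomials are bounded by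
    [A] and [chi^] decays. *)
Lemma mint_conv mu nu (M : R) (h chi : V -> C) : radon mu -> 0 <= M -> wb nu M ->
  (forall f, S0 f -> mint_is nu (icheck f) (mu f)) -> Cc h -> S0 chi ->
  mint_is nu (fun y => icheck h y * icheck chi y) (mu (conv h chi)).
Proof.
move=> rmu M0 nuM Hf hc chiS; have chic := S0_Cc _ chiS.
have [K K0 KP] := S0_decay _ chiS.
have [hM hMP] := Cc_cdom _ hc.
have [A A0 [L L0 H]] := conv_approx _ _ hc chic.
pose B := 2 * (hM * Lam (R:=R) (d:=d)).
have hB y : cnorm (icheck h y) <= B := icheck_bound _ _ y hMP.
have B0 : 0 <= B := le_trans (cnorm_ge0 _) (hB 0).
have ch := Cc_ccont_icheck _ hc; have cchi := Cc_ccont_icheck _ chic.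
pose G (y : V) : R := (A + B) * K * wt y.
have AB0 : 0 < A + B by rewrite ltr_wpDr.
have G0 y : 0 <= G y by rewrite !mulr_ge0 ?wt_ge0// ltW.
have GA : amalg G ((A + B) * K * 32 ^+ d).
  by apply: amalgZ; [rewrite !mulr_ge0// ltW|exact: amalg_wt].
have hG y : cnorm (icheck h y * icheck chi y) <= G y.
  rewrite cnormM /G -mulrA; apply: ler_pM; rewrite ?cnorm_ge0//.
  by rewrite (le_trans (hB y))// lerDr ltW.
have [c cP] := mint_exists _ _ _ _ M0 nuM (ccontM _ _ ch cchi) (amalg_le _ _ _ hG GA).
suff -> : mu (conv h chi) = c by [].
apply/subr0_eq/cnorm_eq0/le_anti; rewrite cnorm_ge0 andbT; apply/ler_addgt0Pr => e e0; rewrite add0r.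
have e20 : 0 < e / 2 by rewrite divr_gt0.
have M1 : 0 < M + 1 by rewrite ltr_wpDl.
have [Y Y0 [D D0 DP]] := amalg_small _ _ _ G0 GA (divr_gt0 e20 M1).
have convc := Cc_conv _ _ hc chic; have [K' K'0 cK'] := Cc_bounded_supp _ convc.
have [b b0 bP] := radon_bound _ (Num.max L K') rmu.
(* One accuracy for both sides: the first bound is for [mu] applied to [h * chi - q], the second for
   the relative smallness required by [amalg_small]. *)
pose eta := Num.min (e / 2 / b) (D * (A + B)).
have eta0 : 0 < eta by rewrite lt_min !(divr_gt0, mulr_gt0).
have eta1 : b * eta <= e / 2 by rewrite mulrC -ler_pdivlMr// ge_min lexx.
have eta2 : eta <= D * (A + B) by rewrite ge_min lexx orbT.
have [I [cc [a [cA aL aC aI]]]] := H eta Y eta0 Y0.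
pose q x := \sum_i cc i * chi (x - a i).
have qS : S0 q by apply: S0_sum => i; apply: S0_Z; exact: S0_shift.
have qc := S0_Cc _ qS.
rewrite (le_trans (cdist_triangle (mu q) _ _))// (splitr e) lerD//.
  rewrite -(Cc_linearB _ _ _ (radon_linear _ rmu) convc qc) (le_trans _ eta1)//.
  apply: bP => //; first exact: CcB.
  by move=> x; rewrite gt_max => /andP[xL xK]; rewrite cK'// /q aL// subr0.
have F := mint_dist _ _ _ _ _ _ (e / 2 / (M + 1)) nuM (Cc_ccont_icheck _ qc) (ccontM _ _ ch cchi) (Hf _ qS) cP.
rewrite (le_trans (F _))//; last first.
  by rewrite mulrCA ler_piMr ?(ltW e20)// ler_pdivrMr// mul1r lerDl.
have E y : cnorm (icheck q y - icheck h y * icheck chi y) =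
    cnorm (icheck h y - \sum_i cc i * ee (a i) y) * cnorm (icheck chi y).
  by rewrite icheck_trig// -mulrBl cnormM cdistC.
apply: DP => [y|y yY]; rewrite E /G.
  rewrite mulr_ge0 ?cnorm_ge0//= -mulrA; apply: ler_pM; rewrite ?cnorm_ge0//.
  by rewrite (le_trans (cnormD _ _))// cnormN addrC lerD.
rewrite mulrA mulrA -mulrA; apply: ler_pM; rewrite ?cnorm_ge0//.
exact: le_trans (aI y yY) eta2.
Qed.

End Density.

(** * The action of a transformable measure on Schwartz functions *)

Section TemperedAction.
Context {R : realType} {d : nat}.
Local Notation V := 'rV[R]_d.
Local Notation C := R[i].
Local Notation conv := Defs.conv.
Implicit Types (mu nu : (V -> C) -> C) (f g : V -> C).

Definition icheck_decays f := ccont (icheck f) /\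
  exists2 K : R, 0 <= K & forall y, cnorm (icheck f y) <= K * wt y.

(* On functions of C_c whose transform decays, both branches give the same value
   (lemma [Cc_mint_icheck]), so this extends [mu]. *)
Definition tempered_action mu nu f : C :=
  if `[< icheck_decays f >] then xget 0 [set c | mint_is nu (icheck f) c] else mu f.

Lemma icheck_decays_amalg f : icheck_decays f -> exists B, amalg (fun y => cnorm (icheck f y)) B.
Proof.
by move=> [cf [K K0 KP]]; exists (K * 32 ^+ d); exact: amalg_cdom.
Qed.

Lemma tempered_action_mint mu nu (M : R) f : 0 <= M -> wb nu M -> icheck_decays f ->
  mint_is nu (icheck f) (tempered_action mu nu f).
Proof.
move=> M0 nuM fd; rewrite /tempered_action asboolT//; apply: xgetPex.
by have [B fB] := icheck_decays_amalg _ fd; exact: (mint_exists _ _ _ _ M0 nuM fd.1 fB).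
Qed.

Lemma Schwartz_decays f : Schwartz f -> icheck_decays f.
Proof.
move=> fS; have [M fM] := Schwartz_cdom1 _ fS; split; first exact: ccont_icheck fM.
have [K HK] : exists K, forall y, cnorm (icheck f y) <= K * wt y by eexists; exact: icheck_Schwartz.
exists K => //.
by have := le_trans (cnorm_ge0 _) (HK 0); rewrite pmulr_lge0// wt_gt0.
Qed.

Lemma icheck_decays_modul (t : V) f : icheck_decays f -> icheck_decays (modul t f).
Proof.
move=> [cf [K K0 KP]].
have E : icheck (modul t f) = fun y => icheck f (y - t).
  by apply/funext => y; exact: icheck_modul.
rewrite /icheck_decays E; split; first exact: ccont_shift.
exists (K * \prod_i (2 * (1 + (- t) 0 i ^+ 2))) => [|y]; first by rewrite mulr_ge0 ?prod_shift_ge0.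
by rewrite (le_trans (KP _))// -mulrA ler_wpM2l// wt_shift.
Qed.

(** Polarization against bumps gives the identity for [f * g~], and shrinking the bump gives it for
    [f]. Decay of the transform guarantees that the limiting integral exists. *)
Lemma Cc_mint_icheck mu nu (M : R) f : radon mu -> FT mu nu -> 0 <= M -> wb nu M -> Cc f ->
  icheck_decays f -> mint_is nu (icheck f) (mu f).
Proof.
move=> rmu FTmu M0 nuM fc fd; have [B fB] := icheck_decays_amalg _ fd.
apply: (approx_identity mu nu M f B) => // e e0.
have [g gb _] := bump_exists (d := d) _ e0; exists g => //.
by apply: FT_polar => //; [exact: radon_linear|case: gb].
Qed.

(** This makes hypothesis (i) applicable to the chosen extension. On [Ccinf] functions the agreement
    with [mu] is immediate in the branch without decay, and is [Cc_mint_icheck] in the other. *)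
Lemma tempered_actionP mu nu (M : R) : radon mu -> FT mu nu -> 0 <= M -> wb nu M ->
  tempered_ext mu (tempered_action mu nu).
Proof.
move=> rmu FTmu M0 nuM; split; [|split].
- move=> a f g fS gS.
  have fd := Schwartz_decays _ fS; have gd := Schwartz_decays _ gS.
  have [m /cdom1_cdom fm] := Schwartz_cdom1 _ fS; have [m' /cdom1_cdom gm] := Schwartz_cdom1 _ gS.
  have E : icheck (fun x => a * f x + g x) = fun y => a * icheck f y + icheck g y.
    by apply/funext => y; rewrite (icheckD _ _ _ _ _ (cdomZ a _ _ fm) gm) (icheckZ _ _ _ _ fm).
  have cf := fd.1; have cg := gd.1.
  have fgd : icheck_decays (fun x => a * f x + g x).
    rewrite /icheck_decays E; split; first by apply: ccontD => //; exact: ccontZ.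
    have [_ [K K0 KP]] := fd; have [_ [K' K'0 KP']] := gd.
    exists (cnorm a * K + K') => [|y]; first by rewrite addr_ge0// mulr_ge0// cnorm_ge0.
    rewrite (le_trans (cnormD _ _))// mulrDl lerD// cnormM -mulrA ler_wpM2l ?cnorm_ge0//.
  apply: (mint_is_unique nu (icheck (fun x => a * f x + g x))).
    exact: tempered_action_mint nuM fgd.
  rewrite E; apply: mint_lin => //; [by case: nuM| |].
    exact: tempered_action_mint nuM fd.
  exact: tempered_action_mint nuM gd.
- pose K := 2 * (2 * Lam (R:=R) (d:=d)) * 2 ^+ d * 32 ^+ d.
  exists decayF, (M * K); split; first by rewrite !mulr_ge0// ?Lam_ge0// exprn_ge0.
  move=> f fS; rewrite (eq_bigr (fun p => (fine (snorm p.1 p.2 f))%:E)) => [|p _]; last first.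
    by have [] := snormP p.1 p.2 _ fS.
  rewrite sumEFin -EFinM lee_fin -/(decayN f) -mulrA.
  have fd := Schwartz_decays _ fS.
  apply: (mint_bound nu M (icheck f)); [by []|by case: fd|exact: tempered_action_mint nuM fd|].
  rewrite (_ : K * decayN f = 2 * (2 * decayN f * Lam (R:=R) (d:=d)) * 2 ^+ d * 32 ^+ d); last first.
    by rewrite /K; ring.
  by apply: amalg_cdom; split; [case: fd|exact: icheck_Schwartz].
move=> f [fc _]; rewrite /tempered_action; case: asboolP => // fd.
apply: (mint_is_unique nu (icheck f)); last exact: (Cc_mint_icheck _ _ M).
have := tempered_action_mint mu nu M f M0 nuM fd.
by rewrite /tempered_action asboolT.
Qed.

(** Modulating [f] translates its transform, and a translate of the integrand can be read as a
    translate of the measure; uniqueness of the integral identifies the two values. *)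
Lemma mint_trans_action mu nu (M : R) f (t : V) : 0 <= M -> (forall t, wb (trans nu t) M) ->
  icheck_decays f -> mint_is (trans nu t) (icheck f) (tempered_action mu nu (modul t f)).
Proof.
move=> M0 nuM fd; have [B fB] := icheck_decays_amalg _ fd.
have [c cP] := mint_exists _ _ _ _ M0 (nuM t) fd.1 fB.
have nu0 : wb nu M.
  have := nuM 0; rewrite (_ : trans nu 0 = nu)//; apply/funext => g; rewrite /trans.
  by congr nu; apply/funext => x; rewrite subr0.
suff -> : tempered_action mu nu (modul t f) = c by [].
apply: (mint_is_unique nu (icheck (modul t f))).
  by apply: tempered_action_mint nu0 _ => //; exact: icheck_decays_modul.
rewrite (_ : icheck _ = fun y => icheck f (y - t)); first exact: mint_trans.
by apply/funext => y; exact: icheck_modul.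
Qed.

End TemperedAction.

(** * The limit of the transformed measures *)

Section LimitMeasure.
Context {R : realType} {d : nat}.
Local Notation V := 'rV[R]_d.
Local Notation C := R[i].
Local Notation conv := Defs.conv.
Context (nu_ : nat -> (V -> C) -> C) (M : R).

Definition lim_is (u : nat -> C) (c : C) := forall e : R, 0 < e -> exists N : nat,
  forall n, (N <= n)%N -> cnorm (u n - c) <= e.

Lemma lim_is_unique u c c' : lim_is u c -> lim_is u c' -> c = c'.
Proof.
move=> uc uc'; apply/subr0_eq/cnorm_eq0/le_anti; rewrite cnorm_ge0 andbT.
apply/ler_addgt0Pr => e e0; rewrite add0r; have e20 : 0 < e / 2 by rewrite divr_gt0.
have [N NP] := uc _ e20; have [N' NP'] := uc' _ e20.
rewrite (le_trans (cdist_triangle (u (maxn N N')) _ _))// (splitr e) lerD//.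
  by rewrite cdistC NP// leq_maxl.
by rewrite NP'// leq_maxr.
Qed.

Lemma lim_is_lin (a : C) u v c c' : lim_is u c -> lim_is v c' ->
  lim_is (fun n => a * u n + v n) (a * c + c').
Proof.
move=> uc vc e e0; have e20 : 0 < e / 2 by rewrite divr_gt0.
have a0 : 0 < cnorm a + 1 by rewrite ltr_wpDl// cnorm_ge0.
have [N NP] := uc _ (divr_gt0 e20 a0); have [N' NP'] := vc _ e20.
exists (maxn N N') => n; rewrite geq_max => /andP[/NP h /NP' h'].
rewrite (_ : _ - _ = a * (u n - c) + (v n - c')); last by ring.
rewrite (le_trans (cnormD _ _))// (splitr e) lerD// cnormM.
rewrite (le_trans (ler_wpM2l (cnorm_ge0 _) h))// mulrCA ler_piMr ?(ltW e20)//.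
by rewrite ler_pdivrMr// mul1r lerDl.
Qed.

Lemma lim_is_bound u c (B : R) : lim_is u c -> (forall n, cnorm (u n) <= B) -> cnorm c <= B.
Proof.
move=> uc uB; apply/ler_addgt0Pr => e e0; have [N NP] := uc _ e0.
rewrite -(subKr (u N) c) (le_trans (cnormD _ _))// cnormN lerD//; exact: NP.
Qed.

Definition limit_measure : (V -> C) -> C := fun g => xget 0 [set c | lim_is (fun n => nu_ n g) c].

Context (nuC : forall g, Cc g -> forall e : R, 0 < e -> exists N : nat, forall m n (t : V),
  (N <= m)%N -> (N <= n)%N -> cnorm (trans (nu_ m) t g - trans (nu_ n) t g) <= e).

Lemma limit_measureP g : Cc g -> lim_is (fun n => nu_ n g) (limit_measure g).
Proof.
move=> gc; apply: (xgetPex 0 (P := [set c | lim_is (fun n => nu_ n g) c])).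
apply: cauchy_lim => e e0; have [N NP] := nuC _ gc _ e0; exists N => m n Nm Nn.
have := NP m n 0 Nm Nn; rewrite /trans.
by rewrite (eq_fun (fun x => congr1 g (subr0 x))).
Qed.

(** In the product topology the test functions are [g (x - y)], the translates by [x] of the
    reflection of [g]. The comparison index [m] depends on [x], but [N] does not, since the Cauchy
    condition is uniform in the translation. *)
Lemma limit_measure_prod_conv : prod_conv nu_ limit_measure.
Proof.
move=> g gc e e0; have e20 : 0 < e / 2 by rewrite divr_gt0.
have goc := Cc_opp _ gc.
have [N NP] := nuC _ goc _ e20; exists N => n Nn x.
have gE : (fun y => g (- (y - x))) = (fun y => g (x - y)).
  by apply/funext => y; rewrite opprB.
have gxc : Cc (fun y => g (x - y)) by rewrite -gE; exact: Cc_shift goc.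
have [N' NP'] := limit_measureP _ gxc _ e20; pose m := maxn N N'.
rewrite (le_trans (cdist_triangle (nu_ m (fun y => g (x - y))) _ _))// (splitr e) lerD//.
  by have := NP n m x Nn (leq_maxl _ _); rewrite /trans gE.
exact: NP' (leq_maxr _ _).
Qed.

Context (nuM : forall n, wb (nu_ n) M) (M0 : 0 <= M).

Lemma limit_measure_wb : wb limit_measure M.
Proof.
split=> [a f g fc gc|g B gc gB].
  apply: (lim_is_unique (fun n => nu_ n (fun x => a * f x + g x))).
    by apply: limit_measureP; apply: CcD => //; exact: CcZ.
  have := lim_is_lin a _ _ _ _ (limit_measureP _ fc) (limit_measureP _ gc).
  by rewrite (eq_fun (fun n => esym ((nuM n).1 a f g fc gc))).
by apply: (lim_is_bound _ _ _ (limit_measureP _ gc)) => n; apply: (nuM n).2.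
Qed.

Lemma wb_radon (nu : (V -> C) -> C) : wb nu M -> radon nu.
Proof.
move=> [lnu nuB]; split=> [//|K /compact_sub_ball[L L0 KL]].
exists (M * ((1 + L ^+ 2) ^+ d * 32 ^+ d)) => f B fc fK fB.
have B0 : 0 <= B := le_trans (cnorm_ge0 _) (fB 0).
rewrite -mulrA; apply: nuB => //; rewrite mulrC mulrA; apply: amalg_cdom.
apply: cdom_supp => //; first by case: fc.
by move=> x xL; apply: fK => /KL; rewrite leNgt xL.
Qed.

(** The [S0] identities survive the limit by [mint_limit]; they extend to [f * f~ * chi] by
    [mint_conv] and to [f * f~] by [approx_identity]. *)
Lemma FT_limit mu (T_ : nat -> (V -> C) -> C) : radon mu ->
  (forall f, S0 f -> forall n, mint_is (nu_ n) (icheck f) (T_ n f)) ->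
  (forall f, S0 f -> lim_is (T_ ^~ f) (mu f)) ->
  FT mu limit_measure.
Proof.
move=> rmu Tm Tl; have nuW := limit_measure_wb.
have HS f : S0 f -> mint_is limit_measure (icheck f) (mu f).
  move=> fS; have [cf [K K0 KP]] := Schwartz_decays _ (S0_Schwartz _ fS).
  apply: (mint_limit nu_ _ M (icheck f) (K * 32 ^+ d) (T_ ^~ f)) => //.
  - exact: amalg_cdom.
  - by move=> g gc; exact: limit_measureP.
  - by move=> n; exact: Tm.
  - exact: Tl.
split; first exact: wb_radon.
move=> f fc; pose h := conv f (ctilde f); have hc : Cc h by apply: Cc_conv => //; exact: Cc_ctilde.
have [m fm] := Cc_cdom _ fc.
have hE y : icheck h y = (cnorm (icheck f y) ^+ 2)%:C%C.
  by rewrite icheck_conv//; [rewrite (icheck_ctilde _ _ _ fm) cnorm_sqrE|exact: Cc_ctilde].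
(* For [f] merely in C_c there is no pointwise decay of [|f^|^2] to rely on; the sampled bound
   supplies both the finite total variation and the amalgam bound needed to shrink [chi]. *)
have LS := large_sieve _ fc; set B := _ * _ in LS.
split.
  apply: (@le_lt_trans _ _ (M * B)%:E); last exact: ltry.
  apply: ge_ereal_sup => _ [g [gc gf] <-]; rewrite lee_fin; apply: nuW.2 => //.
  exact: amalg_le LS.
rewrite -(eq_fun hE); apply: (approx_identity mu _ M h B) => //.
  by rewrite (eq_fun (fun y => congr1 cnorm (hE y))); apply: amalg_le LS => y; rewrite cnorm_real ger0_norm// sqr_ge0.
move=> e e0; have [chi chib [chiS chiE]] := bump_exists (d := d) _ e0; exists chi => //.
have [m' chim] := S0_cdom _ chiS.
rewrite chiE (_ : (fun y => _) = fun y => icheck h y * icheck chi y).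
  exact: (mint_conv _ _ M).
by apply/funext => y; rewrite -(icheck_ctilde _ _ _ chim) chiE.
Qed.

End LimitMeasure.

(** * The uniform Cauchy property of the transforms, and the conclusion *)

Theorem theorem5p2 (R : realType) (d : nat)
  (mu_ : nat -> ('rV[R]_d -> R[i]) -> R[i])
  (muhat_ : nat -> ('rV[R]_d -> R[i]) -> R[i])
  (mu : ('rV[R]_d -> R[i]) -> R[i]) :
  (forall n, radon (mu_ n)) ->
  (forall n, FT (mu_ n) (muhat_ n)) ->
  radon mu ->
  (* (i) *)
  (forall (T_ : nat -> ('rV[R]_d -> R[i]) -> R[i]) (T : ('rV[R]_d -> R[i]) -> R[i]),
     (forall n, tempered_ext (mu_ n) (T_ n)) -> tempered_ext mu T ->
     forall f, Schwartz f -> forall eps : R, 0 < eps -> exists N : nat,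
       forall n : nat, (N <= n)%N -> forall t : 'rV[R]_d,
         cnorm (T_ n (modul t f) - T (modul t f)) <= eps) ->
  (* (ii) *) vaguely_bounded mu_ ->
  (* (iii) *) tempered mu ->
  (* (iv) *) equi_translation_bounded muhat_ ->
  exists muhat, FT mu muhat /\ prod_conv muhat_ muhat.
Proof.
move=> rmu_ FT_ rmu convT _ [T TP] etb.
have [M0 M0P] := etb _ (compact_ballV 1).
(* [wb_trans] takes a nonnegative bound and returns it increased by 1. *)
pose M := Num.max M0 0 + 1.
have M00 : 0 <= Num.max M0 0 by rewrite le_max lexx orbT.
have Mge0 : 0 <= M by rewrite addr_ge0.
have wbt n t : wb (trans (muhat_ n) t) M.
  apply: wb_trans => // [|s]; first by apply: radon_linear; case: (FT_ n).
  by rewrite (le_trans (M0P n s))// lee_fin le_max lexx.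
have wb0 n : wb (muhat_ n) M.
  have := wbt n 0; rewrite (_ : trans _ 0 = muhat_ n)//; apply/funext => g; rewrite /trans.
  by rewrite (eq_fun (fun x => congr1 g (subr0 x))).
pose T_ n := tempered_action (mu_ n) (muhat_ n).
have T_P n : tempered_ext (mu_ n) (T_ n) by exact: tempered_actionP (wb0 n).
have lim_T := convT T_ T T_P TP.
have nuC g : Cc g -> forall e : R, 0 < e -> exists N : nat, forall m n (t : 'rV[R]_d),
    (N <= m)%N -> (N <= n)%N -> cnorm (trans (muhat_ m) t g - trans (muhat_ n) t g) <= e.
  (* Four errors: the replacement of [g] by the transform of [f] for [m] and for [n], and the
     distances of [T_ m] and [T_ n] from [T]. *)
  move=> gc e e0; have e40 : 0 < e / 4 by rewrite divr_gt0.
  have M1 : 0 < M by rewrite ltr_wpDl.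
  (* The approximant is chosen once; since every translate of every [muhat_ n] has the bound [M],
     the error [e / 4] is uniform in the index and in [t]. *)
  have [f fS fg] := S0_icheck_dense _ _ gc (divr_gt0 e40 M1).
  have fd := Schwartz_decays _ (S0_Schwartz _ fS).
  have [N NP] := lim_T f (S0_Schwartz _ fS) _ e40; exists N => m n t Nm Nn.
  have D k : cnorm (trans (muhat_ k) t g - T_ k (modul t f)) <= e / 4.
    have H := mint_dist _ _ _ _ _ _ _ (wbt k t) gc.1 fd.1 (mint_Cc _ _ gc)
      (mint_trans_action (mu_ k) _ _ _ t Mge0 (wbt k) fd) fg.
    by rewrite (le_trans H)// mulrC divfK ?gt_eqF.
  have h1 := D m; have h2 := D n; have h3 := NP m Nm t; have h4 := NP n Nn t.
  have t1 := cdist_triangle (T_ m (modul t f)) (trans (muhat_ m) t g) (trans (muhat_ n) t g).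
  have t2 := cdist_triangle (T (modul t f)) (T_ m (modul t f)) (trans (muhat_ n) t g).
  have t3 := cdist_triangle (T_ n (modul t f)) (T (modul t f)) (trans (muhat_ n) t g).
  rewrite cdistC in h2; rewrite cdistC in h4.
  clear -h1 h2 h3 h4 t1 t2 t3; lra.
exists (limit_measure muhat_); split; last exact: limit_measure_prod_conv.
apply: (FT_limit _ M nuC wb0 Mge0 mu T_ rmu) => f fS.
  by move=> n; apply: tempered_action_mint (wb0 n) _ => //; exact/Schwartz_decays/S0_Schwartz.
(* Only [t = 0] is needed here, and [T f = mu f] because [S0] functions are smooth with compact
   support. *)
move=> e e0; have [N NP] := lim_T f (S0_Schwartz _ fS) _ e0; exists N => n Nn.
have := NP n Nn 0; rewrite !modul0.
by rewrite (TP.2.2 _ (S0_Ccinf _ fS)).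
Qed.
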